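(* Let $k\in\{2,3\}$. On the reference square $\hat Q=(-1,1)^2$, the space $W_h^{1}(\hat Q)$ (case $k=2$) is spanned by the three piecewise constant functions $c^{(1)},c^{(2)},c^{(3)}$ together with $\widetilde P_h^{1}(\hat Q)$, and the space $W_h^{2}(\hat Q)$ (case $k=3$) is spanned by $c^{(1)},c^{(2)},c^{(3)}$ together with $\widetilde P_h^{1}(\hat Q)+\widetilde P_h^{2}(\hat Q)$, where, writing a piecewise constant function as its tuple of values on $(\hat T_1,\hat T_2,\hat T_3,\hat T_4)$, $$c^{(1)}=(0,1,0,-1),\qquad c^{(2)}=(-1,0,1,0),\qquad c^{(3)}=(1,1,1,1).$$ Moreover, for every convex quadrilateral $Q$, $$W_h^{k-1}(Q)=\{q:\ q=\hat q\circ F_Q^{-1}\ \text{for some }\hat q\in W_h^{k-1}(\hat Q)\}.$$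
   Context: For a convex quadrilateral $Q$, $\mathcal T_h^Q$ is the set of four triangles obtained by cutting $Q$ along its two diagonals. For $\hat Q=(-1,1)^2$ these triangles are $\hat T_1$ (bottom), $\hat T_2$ (left), $\hat T_3$ (top), $\hat T_4$ (right), meeting at the origin; the triangles $T_1,\dots,T_4$ of $Q$ are labelled correspondingly (in the same cyclic order). $F_Q:\hat Q\to Q$ is the continuous piecewise affine map whose restriction to each $\hat T_i$ is an affine map $F_i(\hat{\boldsymbol x})=B_i\hat{\boldsymbol x}+\boldsymbol b_i$ of $\hat T_i$ onto $T_i$ (vertices of $\hat Q$ go to vertices of $Q$ and the origin goes to the intersection of the diagonals of $Q$). $P_j(T)$ is the space of polynomials of degree at most $j$ on $T$; $\widetilde P_j(T)$ is the space of homogeneous polynomials of degree $j$. $V_h^k(Q)=\{\boldsymbol u\in[H^1(Q)]^2:\boldsymbol u|_T\in[P_k(T)]^2\ \forall T\in\mathcal T_h^Q\}$ and $W_h^{k-1}(Q)=\mathrm{div}\,V_h^k(Q)$ (and likewise with $\hat Q$ in place of $Q$). $\widetilde P_h^{j}(\hat Q)=\{u\in L^2(\hat Q):u|_T\in\widetilde P_j(T)\ \text{for each of the four triangles }T\text{ of }\hat Q\}$. *)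

(* Defs.v *)
(* All spaces below are sets of total functions
   plane -> R, and only the values on the domain at hand, up to a null set,
   matter: L2, H1, Vh, Wh and PTh are unions of full classes of functions
   equal almost everywhere on the domain (restricted to measurable
   representatives), so equality of such sets is equality of the
   corresponding subspaces of L^2. *)
From HB Require Import structures.
From mathcomp Require Import all_boot all_order all_algebra.
From mathcomp Require Import all_classical all_reals all_analysis.
From mathcomp Require Import ring lra.

Set Implicit Arguments.
Unset Strict Implicit.
Unset Printing Implicit Defensive.

Import Order.TTheory GRing.Theory Num.Theory numFieldNormedType.Exports.
Local Open Scope classical_set_scope.
Local Open Scope ring_scope.

Notation plane R := (R * R)%type.

Section Defs.
Context {R : realType}.
Implicit Types (Om : set (plane R)) (x : plane R) (v : 'I_4 -> plane R).

(** Quadrilaterals and their triangulation *)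

(* Strictly positive convex combinations: the interior of the convex hull as
   soon as the points are not all on one line. *)
Definition open_hull n (p : 'I_n -> plane R) : set (plane R) :=
  [set x | exists l : 'I_n -> R,
     [/\ forall i, 0 < l i, \sum_i l i = 1 & x = \sum_i l i *: p i]].

Definition cross (a b : plane R) : R := a.1 * b.2 - a.2 * b.1.

(* A quadrilateral is given by its vertices v 0, v 1, v 2, v 3 in cyclic order
   (in either orientation); indices are added modulo 4. Convexity: the two
   vertices not on a given side lie strictly on the same side of its line. *)
Definition convex_quad v : Prop :=
  forall i : 'I_4,
    0 < cross (v (i + 1) - v i) (v (i + 2) - v i)
        * cross (v (i + 1) - v i) (v (i + 3) - v i).

Definition quad v : set (plane R) := open_hull v.

Definition quad_diagonal (a b : plane R) : set (plane R) :=
  [set (1 - t) *: a + t *: b | t in `[0, 1]].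

Definition quad_center v : plane R :=
  xget 0 (quad_diagonal (v 0) (v 2) `&` quad_diagonal (v 1) (v 3)).

Definition tri v (i : 'I_4) : set (plane R) :=
  open_hull (fun j : 'I_3 => nth 0 [:: quad_center v; v i; v (i + 1)] j).

(* The vertices of (-1,1)^2, ordered so that tri vref 0, 1, 2, 3 are the
   bottom, left, top and right triangles. *)
Definition vref (i : 'I_4) : plane R :=
  nth 0 [:: (1, -1); (-1, -1); (-1, 1); (1, 1)] i.

Definition affine_map (B : 'M[R]_2) (b x : plane R) : plane R :=
  (B 0 0 * x.1 + B 0 1 * x.2, B 1 0 * x.1 + B 1 1 * x.2) + b.

(* Only the values of F on the closed square are constrained. *)
Definition reference_map v (F : plane R -> plane R) : Prop :=
  [/\ {within closure (quad vref), continuous F},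
      forall i, exists (B : 'M[R]_2) (b : plane R),
        forall x, tri vref i x -> F x = affine_map B b x,
      forall i, F @` tri vref i = tri v i,
      forall i, F (vref i) = v i
    & F (quad_center vref) = quad_center v].

(** L^2 and H^1 *)

Definition lebesgue2 := (@lebesgue_measure R \x @lebesgue_measure R)%E.

Definition L2 Om : set (plane R -> R) :=
  [set f : plane R -> R | measurable_fun Om f /\
           lebesgue2.-integrable Om (fun x => (f x ^+ 2)%:E)].

Definition dir (i : 'I_2) : plane R := ((i == 0)%:R, (i == 1)%:R).

Definition partial (i : 'I_2) (f : plane R -> R) : plane R -> R :=
  fun x => 'D_(dir i) f x.

Definition partials (s : seq 'I_2) (f : plane R -> R) : plane R -> R :=
  foldr partial f s.

Definition smooth (f : plane R -> R) : Prop :=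
  forall s, continuous (partials s f) /\
            forall x i, derivable (partials s f) x (dir i).

Definition test_function Om (phi : plane R -> R) : Prop :=
  smooth phi /\
  exists K : set (plane R),
    [/\ compact K, K `<=` Om & forall x, ~ K x -> phi x = 0].

Definition weak_partial Om (i : 'I_2) (u g : plane R -> R) : Prop :=
  L2 Om g /\
  forall phi, test_function Om phi ->
    \int[lebesgue2]_(x in Om) (u x * partial i phi x) =
    - \int[lebesgue2]_(x in Om) (g x * phi x).

Definition H1 Om : set (plane R -> R) :=
  [set u : plane R -> R | L2 Om u /\ forall i, exists g, weak_partial Om i u g].

(** Polynomials and the discrete spaces *)

Definition polyfun (j : nat) : set (plane R -> R) :=
  [set p : plane R -> R | exists c : nat -> nat -> R, forall x,
     p x = \sum_(a < j.+1) \sum_(b < j.+1 | (a + b <= j)%N)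
             c a b * x.1 ^+ a * x.2 ^+ b].

Definition hpolyfun (j : nat) : set (plane R -> R) :=
  [set p : plane R -> R | exists c : nat -> R, forall x,
     p x = \sum_(a < j.+1) c a * x.1 ^+ a * x.2 ^+ (j - a)].

Definition ae_eq_in (T : set (plane R)) (u p : plane R -> R) : Prop :=
  {ae lebesgue2, forall x, T x -> u x = p x}.

(* A vector field is the family of its two components. *)
Definition Vh v (k : nat) : set ('I_2 -> plane R -> R) :=
  [set u : 'I_2 -> plane R -> R | forall i : 'I_2, H1 (quad v) (u i) /\
     forall m : 'I_4, exists2 p, polyfun k p & ae_eq_in (tri v m) (u i) p].

(* Wh v j is div (Vh v (j + 1)). *)
Definition Wh v (j : nat) : set (plane R -> R) :=
  [set q : plane R -> R | exists u g : 'I_2 -> plane R -> R,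
     [/\ Vh v j.+1 u,
         forall i, weak_partial (quad v) i (u i) (g i)
       & q = \sum_i g i]].

Definition PTh (j : nat) : set (plane R -> R) :=
  [set u : plane R -> R | L2 (quad vref) u /\
     forall m : 'I_4, exists2 p, hpolyfun j p & ae_eq_in (tri vref m) u p].

Definition pwconst (s : seq R) : plane R -> R :=
  fun x => \sum_(m < 4) s`_m * \1_(tri vref m) x.

Definition c1 := pwconst [:: 0; 1; 0; -1].
Definition c2 := pwconst [:: -1; 0; 1; 0].
Definition c3 := pwconst [:: 1; 1; 1; 1].

Definition lin_span (S : set (plane R -> R)) : set (plane R -> R) :=
  [set f : plane R -> R | exists n (a : 'I_n -> R) (g : 'I_n -> plane R -> R),
     (forall i, S (g i)) /\ f = \sum_i a i *: g i].

End Defs.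

(** Well-posedness of the geometric definitions: the diagonals of a convex
    quadrilateral do meet, vref yields (-1,1)^2 with its centre at the origin,
    and a reference map exists. *)

Section Geometry.
Context {R : realType}.
Implicit Types (v : 'I_4 -> plane R).

Let scE (a b : R) : a *: b = a * b. Proof. by []. Qed.

Lemma center_diagonals v : convex_quad v ->
  (quad_diagonal (v 0) (v 2) `&` quad_diagonal (v 1) (v 3)) (quad_center v).
Proof.
move=> cv; suff [z zP] : exists z, (quad_diagonal (v 0) (v 2) `&` quad_diagonal (v 1) (v 3)) z.
  exact: (xgetPex 0 (ex_intro _ z zP)).
have e (i j k : 'I_4) : val i = val j -> v i = v j by move=> /val_inj ->.
have := cv 0; have := cv 1; have := cv 2; have := cv 3.
rewrite !add0r (_ : 1 + 1 = 2 :> 'I_4); last by apply/val_inj.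
rewrite (_ : 1 + 2 = 3 :> 'I_4); last by apply/val_inj.
rewrite (_ : 1 + 3 = 0 :> 'I_4); last by apply/val_inj.
rewrite (_ : 2 + 1 = 3 :> 'I_4); last by apply/val_inj.
rewrite (_ : 2 + 2 = 0 :> 'I_4); last by apply/val_inj.
rewrite (_ : 2 + 3 = 1 :> 'I_4); last by apply/val_inj.
rewrite (_ : 3 + 1 = 0 :> 'I_4); last by apply/val_inj.
rewrite (_ : 3 + 2 = 1 :> 'I_4); last by apply/val_inj.
rewrite (_ : 3 + 3 = 2 :> 'I_4); last by apply/val_inj.
case: (v 0) => a1 a2; case: (v 1) => b1 b2; case: (v 2) => d1 d2; case: (v 3) => f1 f2.
rewrite /cross /=.
set o012 := (b1 - a1) * (d2 - a2) - (b2 - a2) * (d1 - a1).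
set o013 := (b1 - a1) * (f2 - a2) - (b2 - a2) * (f1 - a1).
set o023 := (d1 - a1) * (f2 - a2) - (d2 - a2) * (f1 - a1).
set o123 := (d1 - b1) * (f2 - b2) - (d2 - b2) * (f1 - b1).
have E : o012 + o023 = o013 + o123 by rewrite /o012 /o013 /o023 /o123; ring.
rewrite (_ : (a1 - f1) * (b2 - f2) - (a2 - f2) * (b1 - f1) = o013); last by rewrite /o013; ring.
rewrite (_ : (a1 - f1) * (d2 - f2) - (a2 - f2) * (d1 - f1) = o023); last by rewrite /o023; ring.
rewrite (_ : (f1 - d1) * (a2 - d2) - (f2 - d2) * (a1 - d1) = o023); last by rewrite /o023; ring.
rewrite (_ : (f1 - d1) * (b2 - d2) - (f2 - d2) * (b1 - d1) = o123); last by rewrite /o123; ring.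
rewrite (_ : (d1 - b1) * (a2 - b2) - (d2 - b2) * (a1 - b1) = o012); last by rewrite /o012; ring.
move=> H3 H2 H1' H0.
have [e0 [e1 [e2 D0]]] : 0 <= o013 / (o012 + o023) /\ 0 <= o012 / (o012 + o023) /\
   (0 <= o123 / (o012 + o023) /\ 0 <= o023 / (o012 + o023)) /\ o012 + o023 != 0.
  have [p|n|z] := ltgtP 0 o012.
  - have p1 : 0 < o013 by rewrite -(pmulr_rgt0 _ p).
    have p2 : 0 < o023 by rewrite -(pmulr_rgt0 _ p1).
    have p3 : 0 < o123 by rewrite -(pmulr_rgt0 _ p2).
    have D : 0 < o012 + o023 by rewrite addr_gt0.
    by rewrite !divr_ge0 ?ltW // gt_eqF.
  - have p1 : o013 < 0 by rewrite -(nmulr_rgt0 _ n).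
    have p2 : o023 < 0 by rewrite -(nmulr_rgt0 _ p1).
    have p3 : o123 < 0 by rewrite -(nmulr_rgt0 _ p2).
    have D : o012 + o023 < 0 by lra.
    by rewrite !mulr_le0 ?invr_le0 ?ltW // lt_eqF.
  - by move: H0; rewrite -z mul0r ltxx.
have [e2' e3'] := e2.
have F1 : o013 / (o012 + o023) + o123 / (o012 + o023) = 1.
  by rewrite -mulrDl -E divff.
have F2 : o012 / (o012 + o023) + o023 / (o012 + o023) = 1.
  by rewrite -mulrDl divff.
have [u Eu] : {u | u = o013 / (o012 + o023)} by exists (o013 / (o012 + o023)).
have [w Ew] : {u | u = o012 / (o012 + o023)} by exists (o012 / (o012 + o023)).
exists ((1 - u) *: (a1, a2) + u *: (d1, d2)); split.
  exists u => //=; rewrite in_itv /=; apply/andP; lra.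
exists w; first by rewrite /= in_itv /=; apply/andP; lra.
rewrite Eu Ew /o013 /o012 /o023; move: D0; rewrite /o012 /o023 => D0.
congr (_, _); rewrite /GRing.scale /= ?scE ?scE; field; by [].
Qed.

Lemma center_vref : quad_center (@vref R) = 0.
Proof.
have cv : convex_quad (@vref R).
  case=> -[|[|[|[|//]]]] ? ; rewrite /vref /cross /=; lra.
have [[t _ Et] [s _]] := center_diagonals cv.
rewrite -Et => -[]; rewrite /= /GRing.scale /= ?scE => h1 h2.
by congr (_, _) ; rewrite /GRing.scale /= ?scE; lra.
Qed.

Lemma quad_vrefE :
  quad (@vref R) = [set x : plane R | -1 < x.1 < 1 /\ -1 < x.2 < 1].
Proof.
apply/seteqP; split => -[x y] /=; rewrite ?in_itv /=.
  move=> [l [l0]]; rewrite !big_ord_recl !big_ord0 /vref /= => l1.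
  have := (l0 0, l0 (lift 0 0), l0 (lift 0 (lift 0 0)), l0 (lift 0 (lift 0 (lift 0 0)))).
  move=> [[[]]]; rewrite /= => p0 p1 p2 p3 -[-> ->]; rewrite /GRing.scale /= ?scE; lra.
move=> [X Y]; exists (fun i => nth 0 [:: (1+x)*(1-y)/4; (1-x)*(1-y)/4; (1-x)*(1+y)/4; (1+x)*(1+y)/4] i).
split.
- by case=> -[|[|[|[|//]]]] ? /=; apply: divr_gt0 => //; apply: mulr_gt0; lra.
- by rewrite !big_ord_recl !big_ord0 /=; field.
- by rewrite !big_ord_recl !big_ord0 /= /vref /=; congr (_, _); rewrite /GRing.scale /= ?scE; field.
Qed.

Lemma reference_map_exists v : exists F, reference_map v F.
Proof.
pose s (x : plane R) := (x.1 - x.2) / 2.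
pose t (x : plane R) := - (x.1 + x.2) / 2.
pose z := quad_center v.
pose F (x : plane R) := z + (Num.max 0 (s x)) *: (v 0 - z) + (Num.max 0 (- s x)) *: (v 2 - z)
  + (Num.max 0 (t x)) *: (v 1 - z) + (Num.max 0 (- t x)) *: (v 3 - z).
have key (m : 'I_4) (a b : R) : 0 <= a -> 0 <= b ->
    F (a *: vref m + b *: vref (m + 1)) = z + a *: (v m - z) + b *: (v (m + 1) - z).
  move=> a0 b0; rewrite /F.
  have M0 x : x <= 0 -> Num.max 0 x = 0 :> R by move=> ?; apply/max_idPl.
  have M1 x : 0 <= x -> Num.max 0 x = x :> R by move=> ?; apply/max_idPr.
  have N0 : - 0 = 0 :> R by rewrite oppr0.
  have st i : s (vref i) = nth 0 [:: 1; 0; -1; 0] i.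
    by case: i => -[|[|[|[|//]]]] ?; rewrite /s /vref /=; lra.
  have tt' i : t (vref i) = nth 0 [:: 0; 1; 0; -1] i.
    by case: i => -[|[|[|[|//]]]] ?; rewrite /t /vref /=; lra.
  have -> : s (a *: vref m + b *: vref (m + 1)) = a * s (vref m) + b * s (vref (m+1)).
    by rewrite /s /= /GRing.scale /= ?scE; lra.
  have -> : t (a *: vref m + b *: vref (m + 1)) = a * t (vref m) + b * t (vref (m+1)).
    by rewrite /t /= /GRing.scale /= ?scE; lra.
  rewrite !st !tt'.
  have mE : [|| m == 0, m == 1, m == 2 | m == 3].
    by case: m => -[|[|[|[|//]]]].
  have Ma := M1 _ a0; have Mb := M1 _ b0.
  have Ma' : Num.max 0 (- a) = 0 by apply: M0; lra.
  have Mb' : Num.max 0 (- b) = 0 by apply: M0; lra.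
  case/or4P : mE => /eqP ->.
  - rewrite add0r /= !mulr0 !mulr1 add0r addr0 ?Mb ?Mb' ?Ma ?Ma'.
    by rewrite !scale0r !addr0.
  - rewrite (_ : 1 + 1 = 2 :> 'I_4); last by apply/val_inj.
    rewrite /= !mulr0 !mulr1 add0r addr0 mulrN1 opprK ?Mb ?Mb' ?Ma ?Ma'.
    by rewrite !scale0r !addr0 addrAC.
  - rewrite (_ : 2 + 1 = 3 :> 'I_4); last by apply/val_inj.
    rewrite /= !mulr0 add0r addr0 !mulrN1 !opprK ?Mb ?Mb' ?Ma ?Ma'.
    by rewrite !scale0r !addr0.
  - rewrite (_ : 3 + 1 = 0 :> 'I_4); last by apply/val_inj.
    rewrite /= !mulr0 !mulr1 add0r addr0 !mulrN1 !opprK ?Mb ?Mb' ?Ma ?Ma'.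
    by rewrite !scale0r !addr0 addrAC.
have triE u (m : 'I_4) : tri u m = [set x | exists a b : R,
    [/\ 0 < a, 0 < b, a + b < 1 & x = quad_center u + a *: (u m - quad_center u) + b *: (u (m + 1) - quad_center u)]].
  apply/seteqP; split => x /=.
    move=> [l [l0]]; rewrite !big_ord_recl !big_ord0 /= => l1 ->.
    exists (l (lift ord0 ord0)), (l (lift ord0 (lift ord0 ord0))).
    move: (l0 ord0) (l0 (lift ord0 ord0)) (l0 (lift ord0 (lift ord0 ord0))) l1 => p0 p1 p2 l1.
    split => //; first lra.
    have -> : l ord0 = 1 - l (lift ord0 ord0) - l (lift ord0 (lift ord0 ord0)) by lra.
    by congr (_, _); rewrite /GRing.scale /= ?scE; ring.
  move=> [a [b [a0 b0 ab ->]]].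
  exists (fun i => nth 0 [:: 1 - a - b; a; b] i); split.
  - by case=> -[|[|[|//]]] ? //=; lra.
  - by rewrite !big_ord_recl !big_ord0 /=; lra.
  - by rewrite !big_ord_recl !big_ord0 /=; congr (_, _); rewrite /GRing.scale /= ?scE; ring.
exists F; split.
- apply: continuous_subspaceT => x.
  have cs : {for x, continuous s}.
    by apply: cvgMl; apply: cvgB; [exact: cvg_fst|exact: cvg_snd].
  have ct : {for x, continuous t}.
    by apply: cvgMl; apply: cvgN; apply: cvgD; [exact: cvg_fst|exact: cvg_snd].
  have cm (f : plane R -> R) : {for x, continuous f} ->
     {for x, continuous (fun y => Num.max 0 (f y))}.
    by move=> cf; apply: (@continuous_max _ _ (cst 0) f) => //; exact: cvg_cst.
  rewrite /F; apply: cvgD; [apply: cvgD; [apply: cvgD; [apply: cvgD|]|]|];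
    try exact: cvg_cst; apply: cvgZr_tmp; apply: cm => //; exact: cvgN.
- move=> m; pose w := vref m : plane R; pose w' := vref (m + 1) : plane R.
  have [dm Em] : {d | d = v m - z} by exists (v m - z).
  have [dn En] : {d | d = v (m + 1) - z} by exists (v (m + 1) - z).
  pose c := cross w w'.
  have c0 : c != 0.
    clear Em En dm dn.
    have [e|e] : c = 2 \/ c = -2; last by rewrite e; lra.
      rewrite /c /w /w' /cross /vref.
      by case: m @w @w' @c => -[|[|[|[|//]]]] ? /=; (left; lra) || (right; lra).
    by rewrite e; lra.
  exists (\matrix_(i, j) ((if j == 0 then w'.2 * (if i == 0 then dm.1 else dm.2) - w.2 * (if i == 0 then dn.1 else dn.2)
     else w.1 * (if i == 0 then dn.1 else dn.2) - w'.1 * (if i == 0 then dm.1 else dm.2)) / c)), z.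
  move=> x; rewrite triE center_vref => -[a [b [a0 b0 ab ->]]].
  rewrite add0r !subr0 key ?ltW // /affine_map !mxE /= -/w -/w' -Em -En.
  move: c0; rewrite /c /cross; move: (w) (w') => [w1 w2] [w'1 w'2].
  move: (dm) (dn) (z) => [p1 p2] [q1 q2] [z1 z2] /= c0.
  congr (_, _); rewrite /GRing.scale /= ?scE; rewrite ?eqxx; field; by [].
- move=> m; rewrite !triE center_vref; apply/seteqP; split => [_ [x [a [b [a0 b0 ab ->]]] <-]|x [a [b [a0 b0 ab ->]]]].
    by rewrite add0r !subr0 key ?ltW //; exists a, b.
  exists (a *: vref m + b *: vref (m+1)); last by rewrite key ?ltW.
  by exists a, b; rewrite add0r !subr0.
- move=> m; have := key m 1 0 ler01 (lexx _).
  by rewrite !scale0r !addr0 !scale1r addrC subrK.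
- have := key 0 0 0 (lexx _) (lexx _).
  by rewrite center_vref !scale0r !addr0.
Qed.

End Geometry.

(* Main.v *)
Require Import Defs.
From mathcomp Require Import all_boot all_order all_algebra.
From mathcomp Require Import all_classical all_reals all_analysis measurable_realfun.
From mathcomp Require Import ring lra.
Set Implicit Arguments.
Unset Strict Implicit.
Unset Printing Implicit Defensive.
Import Order.TTheory GRing.Theory Num.Theory numFieldNormedType.Exports.
Local Open Scope classical_set_scope.
Local Open Scope ring_scope.

(* On each triangle the divergence of a field in Vh is a polynomial q_m of degree
   j. A component u of the field is continuous across the diagonals, so
   u_0 - u_1 + u_2 - u_3 vanishes on both of them and has zero gradient at their
   intersection z; hence q_0 - q_1 + q_2 - q_3 = 0 at z. Conversely, a piecewise
   polynomial satisfying this single condition is a sum of polynomials cut off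
   along the diagonals, each of which is the divergence of a polynomial field
   vanishing on the cut. The condition is thus a complete description of Wh; it is
   invariant under the piecewise affine maps between quadrilaterals, and on the
   square it only restricts the constant parts of the q_m, leaving the span of
   c1, c2, c3. *)

(** * Open sets and continuous functions on the plane *)

Section PlaneMeasure.
Context {R : realType}.
Local Notation P := (plane R).
Local Notation lam := (@lebesgue_measure R).
Local Notation mu := (@lebesgue2 R).

(** An element of H1 has no values on a diagonal, so continuity across it has to be extracted from
    the test-function identity. Everything is done on slices parallel to the axes: Fubini and the
    one-dimensional fundamental theorem of calculus replace traces and the divergence theorem, and
    bumps may be products of one-variable functions. The fundamental lemma is needed because a weak
    partial derivative is an arbitrary L2 function until it is identified with the classical
    derivative on each triangle. The converse rests on coordinates [s], [t] along the diagonals with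
    origin at their intersection. Every monomial in [s], [t] except the constant one has a
    polynomial primitive, along one of the diagonals, that vanishes on both of them; the exceptional
    constant is what the condition at the intersection removes. Since membership in the spaces is
    insensitive to null sets, passing from one quadrilateral to another needs no Jacobian: it
    suffices that affine bijections pull null sets back to null sets. *)

Definition box (a b c d : R) : set P := [set x | a < x.1 < b /\ c < x.2 < d].
Definition cbox (a b c d : R) : set P := [set x | a <= x.1 <= b /\ c <= x.2 <= d].

Lemma box_setX a b c d : box a b c d = `]a, b[%classic `*` `]c, d[%classic.
Proof. by apply/seteqP; split => -[x y]; rewrite /box /= !in_itv. Qed.

Lemma cbox_setX a b c d : cbox a b c d = `[a, b]%classic `*` `[c, d]%classic.
Proof. by apply/seteqP; split => -[x y]; rewrite /cbox /= !in_itv. Qed.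

Lemma box_sub_cbox a b c d : box a b c d `<=` cbox a b c d.
Proof. by move=> x [/andP[? ?] /andP[? ?]]; split; apply/andP; split; exact: ltW. Qed.

Lemma measurable_box a b c d : measurable (box a b c d).
Proof. by rewrite box_setX; apply: measurableX. Qed.

Lemma compact_cbox a b c d : compact (cbox a b c d).
Proof. by rewrite cbox_setX; apply: compact_setX; exact: segment_compact. Qed.

Lemma lebesgue2_box_fin a b c d : (mu (box a b c d) < +oo)%E.
Proof.
rewrite box_setX /lebesgue2 product_measure1E//= !lebesgue_measure_itv/=.
by case: ifP; case: ifP => _ _; rewrite ?mul0e ?mule0 // -?EFinD -?EFinM ltry.
Qed.

Lemma open_box_nbhs (U : set P) (x : P) : open U -> U x ->
  exists2 e : R, 0 < e & forall y : P, `|y.1 - x.1| < e -> `|y.2 - x.2| < e -> U y.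
Proof.
rewrite openE => oU /oU /nbhs_ballP [e e0 eU]; exists e => // y y1 y2.
by apply: eU; split; rewrite /= /ball /= distrC.
Qed.

(** Rational corners make the family countable, so open sets are countable unions of such boxes. The
    closed version [crbox] records that the box is compactly contained in an open set, which leaves
    room for test functions. *)
Definition rbox (q : rat * rat * rat * rat) : set P :=
  box (ratr q.1.1.1) (ratr q.1.1.2) (ratr q.1.2) (ratr q.2).
Definition crbox (q : rat * rat * rat * rat) : set P :=
  cbox (ratr q.1.1.1) (ratr q.1.1.2) (ratr q.1.2) (ratr q.2).

Lemma measurable_rbox q : measurable (rbox q).
Proof. exact: measurable_box. Qed.

Lemma open_rbox (U : set P) (x : P) : open U -> U x ->
  exists q, rbox q x /\ crbox q `<=` U.
Proof.
move=> oU Ux; have [e e0 eU] := open_box_nbhs oU Ux.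
have rat_near (t : R) : exists a b : rat,
    [/\ t - e < ratr a, ratr a < t, t < ratr b & ratr b < t + e].
  have [a] := @rat_in_itvoo R (t - e) t ltac:(by rewrite ltrBlDr ltrDl).
  have [b] := @rat_in_itvoo R t (t + e) ltac:(by rewrite ltrDl).
  by rewrite !in_itv /= => /andP[? ?] /andP[? ?]; exists a, b.
have [a [b [a1 a2 b1 b2]]] := rat_near x.1.
have [c [d [c1 c2 d1 d2]]] := rat_near x.2.
exists (a, b, c, d); split; first by split; apply/andP.
by move=> y [/= /andP[? ?] /andP[? ?]]; apply: eU; rewrite ltr_norml; apply/andP; split; lra.
Qed.

Lemma open_bigcup_rbox (U : set P) : open U ->
  U = \bigcup_(q in [set q | crbox q `<=` U]) rbox q.
Proof.
move=> oU; apply/seteqP; split => x; first by move=> /(open_rbox oU)[q [? ?]]; exists q.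
by move=> [q /= qU qx]; apply: qU; exact: box_sub_cbox.
Qed.

Lemma measurable_open (U : set P) : open U -> measurable U.
Proof.
move=> /open_bigcup_rbox ->; rewrite bigcup_mkcond.
apply: countable_bigcupT_measurable; first exact: countableP.
by move=> q; case: ifP => // _; exact: measurable_box.
Qed.

Lemma open_continuous_measurable (D : set P) (f : P -> R) : open D ->
  (forall x, D x -> {for x, continuous f}) -> measurable_fun D f.
Proof.
move=> oD cf mD; apply: (measurability _ (RGenOInfty.measurableE R)) => //.
move=> _ [_ [a ->] <-]; apply: measurable_open.
rewrite openE => x [Dx fx] /=.
have oa : open `]a, +oo[%classic by exact: interval_open.
have nf := cf x Dx _ (open_nbhs_nbhs (conj oa fx)).
apply: filterI; last exact: nf.
by move: oD; rewrite openE => /(_ x Dx).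
Qed.

Lemma continuous_measurable (D : set P) (f : P -> R) :
  continuous f -> measurable_fun D f.
Proof.
move=> cf; apply: measurable_funTS; apply: open_continuous_measurable => [|x _].
  exact: openT.
exact: cf.
Qed.

Lemma integrable_bounded (D : set P) (f : P -> R) (M : R) : measurable D ->
  (mu D < +oo)%E -> measurable_fun D f -> (forall x, D x -> `|f x| <= M) ->
  mu.-integrable D (EFin \o f).
Proof.
move=> mD fD mf bf; apply: measurable_bounded_integrable => //.
exists M; split; first by rewrite num_real.
by move=> N MN x Dx /=; apply: le_trans (bf x Dx) (ltW MN).
Qed.

Definition bounded_plane (D : set P) := exists M : R, D `<=` cbox (-M) M (-M) M.

Lemma bounded_plane_box (D : set P) : bounded_plane D ->
  exists M, D `<=` box (-M) M (-M) M.
Proof.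
move=> [M DM]; exists (M + 1) => x /DM [/andP[? ?] /andP[? ?]].
by split; apply/andP; split; lra.
Qed.

Lemma bounded_plane_fin (D : set P) : measurable D -> bounded_plane D -> (mu D < +oo)%E.
Proof.
move=> mD /bounded_plane_box[M DM]; apply: le_lt_trans (lebesgue2_box_fin (-M) M (-M) M).
by apply: le_measure => //; rewrite inE //; exact: measurable_box.
Qed.

Lemma continuous_bounded (D : set P) (f : P -> R) : bounded_plane D ->
  continuous f -> exists M, forall x, D x -> `|f x| <= M.
Proof.
move=> [M DM] cf.
have : compact (f @` cbox (-M) M (-M) M).
  by apply: continuous_compact; [exact: continuous_subspaceT|exact: compact_cbox].
move=> /compact_bounded [N [_ /(_ (N + 1))]]; rewrite ltrDl ltr01 => /(_ isT) Nf.
by exists (N + 1) => x /DM Dx; apply: Nf; exists x.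
Qed.

Lemma continuous_integrable (D : set P) (f : P -> R) : measurable D -> bounded_plane D ->
  continuous f -> mu.-integrable D (EFin \o f).
Proof.
move=> mD bD cf; have [M Mf] := continuous_bounded bD cf.
apply: (integrable_bounded (M := M)) => //; first exact: bounded_plane_fin.
exact: continuous_measurable.
Qed.

End PlaneMeasure.

(** * Integration along coordinate lines *)

Section Green.
Context {R : realType}.
Local Notation P := (plane R).
Local Notation lam := (@lebesgue_measure R).
Local Notation mu := (@lebesgue2 R).

(** The argument [a] goes to coordinate [i] and [b] to the other one, so that both coordinate
    directions share one slicing argument. *)
Definition pt (i : 'I_2) (a b : R) : P := if i == 0 then (a, b) else (b, a).

Lemma plane_eq (x y : P) : x.1 = y.1 -> x.2 = y.2 -> x = y.
Proof. by case: x y => [? ?] [? ?] /= -> ->. Qed.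

Lemma scaleRE (a b : R) : a *: b = a * b. Proof. by []. Qed.

Lemma ord2P (i : 'I_2) : i = 0 \/ i = 1.
Proof. by case: i => -[|[|//]] ?; [left|right]; exact: val_inj. Qed.

Lemma pt0 a b : pt 0 a b = (a, b). Proof. by []. Qed.
Lemma pt1 a b : pt 1 a b = (b, a). Proof. by []. Qed.

Definition crd (i : 'I_2) (x : P) : R := if i == 0 then x.1 else x.2.

Lemma ptK i (x : P) : pt i (crd i x) (crd (1 - i) x) = x.
Proof. by case: (ord2P i) => ->; case: x. Qed.

Lemma continuous_pt i b : continuous (fun a => pt i a b).
Proof.
move=> a; case: (ord2P i) => ->; rewrite /pt /=.
  by apply: (@cvg_pair _ _ _ _ (nbhs a) (nbhs b) _ _ _ id (fun=> b)); [exact: cvg_id|exact: cvg_cst].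
by apply: (@cvg_pair _ _ _ _ (nbhs b) (nbhs a) _ _ _ (fun=> b) id); [exact: cvg_cst|exact: cvg_id].
Qed.

(** Fubini applied to the extension of [f] by zero, with direction [i] as the inner variable. *)
Lemma iterated_integral i (D : set P) (f : P -> R) : measurable D ->
  mu.-integrable D (EFin \o f) ->
  (\int[mu]_(z in D) (f z)%:E =
   \int[lam]_y \int[lam]_(x in [set x | D (pt i x y)]) (f (pt i x y))%:E)%E.
Proof.
move=> mD intf0; have intf : mu.-integrable setT ((EFin \o f) \_ D).
  by apply: (proj1 (integrable_mkcond _ _)).
rewrite integral_mkcond.
transitivity (\int[lam]_y \int[lam]_x ((EFin \o f) \_ D) (pt i x y))%E; last first.
  apply: eq_integral => y _; rewrite [RHS]integral_mkcond; apply: eq_integral => x _.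
  by rewrite /patch /=; congr (if _ then _ else _); apply/idP/idP; rewrite !inE.
case: (ord2P i) => ->; first exact: (esym (integral21_prod_meas1 intf)).
exact: (esym (integral12_prod_meas1 intf)).
Qed.

Lemma ftc_oo (h h' : R -> R) (a b : R) : a < b -> continuous h' ->
  (forall x, is_derive (x : R) (1 : R) h (h' x)) ->
  (\int[lam]_(x in `]a, b[) (h' x)%:E = (h b - h a)%:E)%E.
Proof.
move=> ab ch' dh.
have ch : continuous h.
  by move=> x; apply/differentiable_continuous/derivable1_diffP; case: (dh x).
have mh' : measurable_fun `]a, b[ (EFin \o h').
  by apply/measurable_EFinP; apply: measurable_funTS; exact: continuous_measurable_fun.
rewrite -(integral_itv_bndoo true false mh') (@continuous_FTC2 _ _ h) ?EFinB//.
- exact: continuous_subspaceT.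
- split; first by move=> x _; case: (dh x).
    by apply: cvg_at_right_filter; exact: ch.
  by apply: cvg_at_left_filter; exact: ch.
- by move=> x _; rewrite derive1E; case: (dh x).
Qed.

(** Both difference quotients are the same function of the increment, so a partial derivative is an
    ordinary derivative on a slice. *)
Lemma is_derive_ptP i (h : P -> R) (d x y : R) :
  is_derive (pt i x y) (dir i) h d <-> is_derive (x : R) (1 : R) (fun t => h (pt i t y)) d.
Proof.
have E : (fun e : R => e^-1 *: ((h \o shift (pt i x y)) (e *: dir i) - h (pt i x y))) =
  (fun e : R => e^-1 *: (((fun t => h (pt i t y)) \o shift x) (e *: (1 : R)) - h (pt i x y))).
  apply/funext => e /=; congr (_ *: (h _ - _)).
  apply: plane_eq; case: (ord2P i) => -> /=;
    by rewrite /pt /dir /= ?scaleRE ?eqxx /= ?mulr1 ?mulr0 ?add0r.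
by split => -[dh hd]; split; move: dh hd; rewrite /derivable /derive E.
Qed.

Lemma closure_pt i (O : set P) (y x : R) :
  closure [set x | O (pt i x y)] x -> closure O (pt i x y).
Proof.
move=> cx B nB; have := cx _ (continuous_pt nB).
by move=> [t [Ot Bt]]; exists (pt i t y).
Qed.

(** The endpoints are the infimum and the supremum. That they belong to the closure is what later
    allows a boundary condition to be applied at the two ends of a slice. *)
Lemma open_interval_oo (S : set R) : open S -> is_interval S ->
  (exists M : R, forall x, S x -> `|x| <= M) -> S !=set0 ->
  exists a b : R, [/\ a < b, S = `]a, b[%classic, closure S a & closure S b].
Proof.
move=> oS iS [M SM] [x0 Sx0].
have lS : has_lbound S by exists (- M) => x /SM; rewrite ler_norml => /andP[].
have uS : has_ubound S by exists M => x /SM; rewrite ler_norml => /andP[].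
have SE : S = `]inf S, sup S[%classic.
  have {1}-> : S = S° by apply/esym; apply/interior_id.
  by rewrite interval_bounded_interior.
have Sab : inf S < sup S.
  by move: Sx0; rewrite {1}SE /= in_itv /= => /andP[]; exact: lt_trans.
exists (inf S), (sup S); split => //.
- move=> B /nbhs_ballP[e /= e0 eB].
  have [x Sx xe] := inf_adherent e0 (conj (ex_intro _ x0 Sx0) lS).
  exists x; split => //; apply: eB; rewrite /ball /= distrC ger0_norm ?subr_ge0; last exact: ge_inf.
  by rewrite ltrBlDl.
- move=> B /nbhs_ballP[e /= e0 eB].
  have [x Sx xe] := sup_adherent e0 (conj (ex_intro _ x0 Sx0) uS).
  exists x; split => //; apply: eB; rewrite /ball /= ger0_norm ?subr_ge0; last exact: ub_le_sup.
  by rewrite ltrBlDl -ltrBlDr.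
Qed.

Lemma continuous_slice i (f : P -> R) y : continuous f -> continuous (fun x => f (pt i x y)).
Proof. by move=> cf x; apply: continuous_comp; [exact: continuous_pt|exact: cf]. Qed.

(* Convexity along the coordinate directions only: all that integration by parts
   on slices requires. *)
Definition line_convex (O : set P) := forall i y, is_interval [set x | O (pt i x y)].

Lemma bounded_slice i (O : set P) y : bounded_plane O ->
  exists M : R, forall x, O (pt i x y) -> `|x| <= M.
Proof.
move=> [M OM]; exists M => x /OM; rewrite ler_norml.
by case: (ord2P i) => -> [].
Qed.

(** Each slice is an open interval whose ends lie in the closure of [O] but not in [O]; there [h]
    vanishes, so the fundamental theorem of calculus makes every inner integral zero. *)
Lemma integral_partial0 i (O : set P) (h dh : P -> R) :
  open O -> bounded_plane O -> line_convex O -> continuous dh ->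
  (forall x, is_derive x (dir i) h (dh x)) ->
  (forall x, closure O x -> ~ O x -> h x = 0) ->
  \int[mu]_(x in O) dh x = 0.
Proof.
move=> oO bO cO cdh Dh h0; rewrite /Rintegral.
have mO := measurable_open oO.
rewrite (iterated_integral i) //; last exact: continuous_integrable.
rewrite integral0_eq// => y _.
set S := [set x | O (pt i x y)].
have [->|/set0P S0] := eqVneq S set0; first by rewrite integral_set0.
have oS : open S by apply: open_comp oO => x _; exact: continuous_pt.
have [a [b [ab SE ca cb]]] := open_interval_oo oS (cO i y) (bounded_slice i y bO) S0.
have nS z : z = a \/ z = b -> ~ S z.
  by move=> [] ->; rewrite SE /= in_itv /= ltxx ?andbF.
have dS x : is_derive (x : R) (1 : R) (fun t => h (pt i t y)) (dh (pt i x y)).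
  by apply/is_derive_ptP.
have := ftc_oo ab (continuous_slice (i := i) (y := y) cdh) dS; rewrite -SE => ->.
rewrite (h0 (pt i a y)) ?(h0 (pt i b y)) ?subr0 //.
- exact: closure_pt.
- by apply: nS; right.
- exact: closure_pt.
- by apply: nS; left.
Qed.

End Green.

(** * Smooth bump functions *)

Section Bump.
Context {R : realType}.
Local Notation P := (plane R).

(** Carrying the derivative as a witness, instead of iterating a derivation operator, lets closure
    under sums, products and affine substitution be proved by induction on [k]. *)
Fixpoint smooth1 (k : nat) (f : R -> R) : Prop :=
  if k is k'.+1 then
    exists2 f' : R -> R, (forall x : R, is_derive x (1 : R) f (f' x)) & smooth1 k' f'
  else continuous f.

Definition smoothoo (f : R -> R) := forall k, smooth1 k f.

Lemma is_derive1_continuous (f f' : R -> R) :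
  (forall x : R, is_derive x (1 : R) f (f' x)) -> continuous f.
Proof. by move=> df x; apply/differentiable_continuous/derivable1_diffP; case: (df x). Qed.

Lemma smooth1S k (f : R -> R) : smooth1 k.+1 f -> smooth1 k f.
Proof.
elim: k f => [f [f' df _]|k IH f [f' df sf']]; first exact: is_derive1_continuous df.
by exists f' => //; exact: IH.
Qed.

Lemma smooth1D k (f g : R -> R) : smooth1 k f -> smooth1 k g -> smooth1 k (f \+ g).
Proof.
elim: k f g => [f g cf cg x|k IH f g [f' df sf'] [g' dg sg']].
  by apply: continuousD; [exact: cf|exact: cg].
by exists (f' \+ g') => [x|]; [exact: (is_deriveD (df x) (dg x))|exact: IH].
Qed.

Lemma smooth1M k (f g : R -> R) : smooth1 k f -> smooth1 k g -> smooth1 k (f \* g).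
Proof.
elim: k f g => [f g cf cg x|k IH f g sf sg].
  by apply: continuousM; [exact: cf|exact: cg].
have [f' df sf'] := sf; have [g' dg sg'] := sg.
exists ((f \* g') \+ (g \* f')) => [x|].
  exact: (is_derive_eq (is_deriveM (df x) (dg x))).
by apply: smooth1D; apply: IH => //; exact: smooth1S.
Qed.

Lemma smooth1Z k (c : R) (f : R -> R) : smooth1 k f -> smooth1 k (fun x => c * f x).
Proof.
elim: k f => [f cf x|k IH f [f' df sf']].
  by apply: continuousM; [exact: cvg_cst|exact: cf].
by exists (fun x => c * f' x) => [x|]; [exact: (is_deriveZ c (df x))|exact: IH].
Qed.

Lemma smooth1_affine k (a b : R) (f : R -> R) : smooth1 k f ->
  smooth1 k (fun x => f (a * x + b)).
Proof.
have daff (x : R) : is_derive x (1 : R) (fun y => a * y + b) a.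
  have := is_deriveD (is_deriveZ a (is_derive_id x (1 : R))) (is_derive_cst b x (1 : R)).
  by rewrite addr0 scaleRE mulr1.
elim: k f => [f cf x|k IH f [f' df sf']].
  by apply: (continuous_comp (is_derive1_continuous daff (x := x))); exact: cf.
exists (fun x => a * f' (a * x + b)) => [x|]; last exact/smooth1Z/IH.
have := @is_derive1_comp R f (fun y => a * y + b) x _ _ (df _) (daff x).
by rewrite mulrC.
Qed.

(* The derivatives of exp (-1/x) are combinations of these functions. *)
Definition flat (n : nat) (x : R) : R := if 0 < x then x^-1 ^+ n * expR (- x^-1) else 0.

Lemma flat_decay n (x : R) : 0 < x -> x^-1 ^+ n.+1 * expR (- x^-1) <= n.+2`!%:R * x.
Proof.
move=> x0; have u0 : 0 < x^-1 by rewrite invr_gt0.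
have := expR_ge1Dxn n.+1 (ltW u0).
rewrite expRN; set e := expR _ => he.
have e0 : 0 < e by exact: expR_gt0.
have f0 : (0 : R) < n.+2`!%:R by rewrite ltr0n fact_gt0.
rewrite ler_pdivrMr // -[x in _ * x * _]invrK mulrAC ler_pdivlMr // -exprSr -ler_pdivrMl // mulrC.
by apply: le_trans he; rewrite lerDr.
Qed.

Lemma near_gt (x a : R) : a < x -> \forall y \near x, a < y.
Proof. by move=> ax; exact: lt_nbhsr. Qed.

Lemma near_lt (x a : R) : x < a -> \forall y \near x, y < a.
Proof. by move=> ax; exact: lt_nbhsl. Qed.

(** Differentiation stays within the family [flat], which is why smoothness of all orders follows by
    induction. Only the point 0 needs an estimate. *)
Lemma is_derive_flat n (x : R) :
  is_derive x (1 : R) (flat n) (- n%:R * flat n.+1 x + flat n.+2 x).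
Proof.
have [x0|x0|x0] := ltgtP 0 x.
- apply: (@near_eq_is_derive R _ _ (fun y : R => y^-1 ^+ n * expR (- y^-1)) (flat n)).
    by near=> y; rewrite /flat ifT //; near: y; exact: near_gt.
  have dV : is_derive x (1 : R) (fun y : R => y^-1) (- x^-1 ^+ 2).
    have := is_deriveV (f := id) (lt0r_neq0 x0) (is_derive_id x (1 : R)).
    by rewrite scaleRE mulr1 exprVn.
  have dN : is_derive x (1 : R) (fun y : R => - y^-1) (x^-1 ^+ 2).
    by have := is_deriveN dV; rewrite opprK.
  have dE := @is_derive1_comp R expR (fun y => - y^-1) x _ _ (is_derive_expR _) dN.
  have := is_deriveM (is_deriveX n dV) dE; rewrite exprfctE => dM.
  apply: (is_derive_eq dM) => {dM}.
  rewrite /flat x0 !scaleRE /=; case: n => [|n] /=; rewrite !exprS ?expr0; ring.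
- apply: (@near_eq_is_derive R _ _ (cst (0 : R)) (flat n)).
    by near=> y; rewrite /flat ifF //; apply/negbTE; rewrite -leNgt ltW //; near: y; exact: near_lt.
  by rewrite /flat !ltNge (ltW x0) /= mulr0 addr0; exact: is_derive_cst.
- rewrite -x0 {x x0}.
  have F0 m : flat m 0 = 0 by rewrite /flat ltxx.
  rewrite !F0 mulr0 addr0.
  (* For [h > 0] the quotient is [flat n.+1 h], bounded by a multiple of [h]; otherwise it is
     zero. *)
  have c0 : h^-1 *: ((flat n \o shift 0) (h *: (1:R)) - flat n 0) @[h --> 0^'] --> (0 : R).
    rewrite F0; apply/cvgr0Pnorm_le => e e0.
    have f0 : (0 : R) < n.+2`!%:R by rewrite ltr0n fact_gt0.
    have d0 : 0 < e / n.+2`!%:R by rewrite divr_gt0.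
    near=> h.
    rewrite /= subr0 addr0 !scaleRE mulr1 /flat; case: ifPn => [h0|_]; last by rewrite mulr0 normr0 ltW.
    rewrite mulrA -exprS ger0_norm; last by rewrite mulr_ge0 ?expR_ge0 ?exprn_ge0 ?invr_ge0 ?ltW.
    apply: le_trans (flat_decay n h0) _.
    rewrite mulrC -ler_pdivlMr // ltW //; near: h; apply: nbhs_dnbhs.
    exact: near_lt.
  by split; [apply/cvg_ex; exists 0|exact/cvg_lim].
Unshelve. all: by end_near. Qed.

Lemma smoothoo_flat n : smoothoo (flat n).
Proof.
move=> k; elim: k n => [n|k IH n]; first exact: (is_derive1_continuous (is_derive_flat n)).
exists (fun x => - n%:R * flat n.+1 x + flat n.+2 x); first exact: is_derive_flat.
by apply: smooth1D; [exact: smooth1Z|].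
Qed.

(** Positive exactly on []a, b[], with values in [[0, 1]]. The dilation by [n.+1] makes the sequence
    tend pointwise to the indicator of that interval. *)
Definition bump1 (n : nat) (a b x : R) : R :=
  flat 0 (n.+1%:R * (x - a)) * flat 0 (n.+1%:R * (b - x)).

Lemma flat0_itv (x : R) : 0 <= flat 0 x <= 1.
Proof.
rewrite /flat expr0 mul1r; case: ifPn => [x0|_]; last by rewrite lexx ler01.
by rewrite expR_ge0 /= expR_le1 oppr_le0 invr_ge0 ltW.
Qed.

Lemma flat0_gt0 (x : R) : 0 < x -> 0 < flat 0 x.
Proof. by rewrite /flat => ->; rewrite expr0 mul1r expR_gt0. Qed.

Lemma flat0_le0 (x : R) : x <= 0 -> flat 0 x = 0.
Proof. by rewrite /flat ltNge => ->. Qed.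

Lemma bump1_itv n a b x : 0 <= bump1 n a b x <= 1.
Proof.
have /andP[u0 u1] := flat0_itv (n.+1%:R * (x - a)).
have /andP[v0 v1] := flat0_itv (n.+1%:R * (b - x)).
by rewrite /bump1 mulr_ge0 //= mulr_ile1.
Qed.

Lemma bump1_gt0 n a b x : a < x < b -> 0 < bump1 n a b x.
Proof. by case/andP => ax xb; rewrite mulr_gt0 // flat0_gt0 // mulr_gt0 // subr_gt0. Qed.

Lemma bump1_out n a b x : ~~ (a < x < b) -> bump1 n a b x = 0.
Proof.
rewrite negb_and -!leNgt => /orP[h|h]; rewrite /bump1.
  by rewrite [flat 0 _]flat0_le0 ?mul0r // pmulr_rle0 // subr_le0.
by rewrite [X in _ * X]flat0_le0 ?mulr0 // pmulr_rle0 // subr_le0.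
Qed.

Lemma flat0_cvg (x : R) : 0 < x -> flat 0 (n.+1%:R * x) @[n --> \oo] --> (1 : R).
Proof.
move=> x0.
have -> : (fun n => flat 0 (n.+1%:R * x)) = (fun n => expR (- (n.+1%:R^-1 * x^-1))).
  by apply/funext => n; rewrite /flat mulr_gt0 // expr0 mul1r invfM.
rewrite -[X in _ --> X](@expR0 R) -[X in expR X]oppr0 -[X in - X](mul0r x^-1).
apply: continuous_cvg; first exact: continuous_expR.
by apply: cvgN; apply: cvgMr_tmp; exact: cvg_harmonic.
Qed.

Lemma bump1_cvg a b x : a < x < b -> bump1 n a b x @[n --> \oo] --> (1 : R).
Proof.
case/andP => ax xb; rewrite -[X in _ --> X](mulr1 1).
by apply: cvgM; apply: flat0_cvg; rewrite subr_gt0.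
Qed.

Lemma smoothoo_bump1 n a b : smoothoo (bump1 n a b).
Proof.
move=> k; apply: smooth1M.
  rewrite (_ : (fun x => _) = (fun x => flat 0 (n.+1%:R * x + - (n.+1%:R * a)))); last first.
    by apply/funext => x; rewrite mulrBr.
  exact/smooth1_affine/smoothoo_flat.
rewrite (_ : (fun x => _) = (fun x => flat 0 (- n.+1%:R * x + n.+1%:R * b))); last first.
  by apply/funext => x; congr flat; ring.
exact/smooth1_affine/smoothoo_flat.
Qed.

End Bump.

(** * Products of one-variable bumps as test functions *)

Section TestFunctions.
Context {R : realType}.
Local Notation P := (plane R).

Lemma partialP i (h dh : P -> R) :
  (forall x, is_derive x (dir i) h (dh x)) -> partial i h = dh.
Proof. by move=> D; apply/funext => x; case: (D x). Qed.

Lemma smoothoo_derive (f : R -> R) : smoothoo f ->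
  smoothoo (derive1 f) /\ forall x : R, is_derive x (1 : R) f ((derive1 f) x).
Proof.
move=> sf; have df x : is_derive x (1 : R) f ((derive1 f) x).
  have [f' df _] := sf 1%N; split; first by case: (df x).
  by rewrite derive1E.
split=> // k; have [f' df' sf'] := sf k.+1.
by rewrite (_ : (derive1 f) = f') //; apply/funext => x; rewrite derive1E; case: (df' x).
Qed.

Definition tensor (f g : R -> R) : P -> R := fun x => f x.1 * g x.2.

Lemma is_derive_tensor i (f g : R -> R) (x : P) : smoothoo f -> smoothoo g ->
  is_derive x (dir i) (tensor f g)
    (if i == 0 then tensor (derive1 f) g x else tensor f (derive1 g) x).
Proof.
move=> /smoothoo_derive[_ df] /smoothoo_derive[_ dg].
case: x => a b; case: (ord2P i) => -> /=.
  apply/(is_derive_ptP 0 _ _ a b); rewrite /tensor /=.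
  rewrite mulrC (_ : (fun t => _) = (fun t => g b * f t)); first exact: (is_deriveZ (g b) (df a)).
  by apply/funext => t; rewrite mulrC.
by apply/(is_derive_ptP 1 _ _ b a); exact: (is_deriveZ (f a) (dg b)).
Qed.

Lemma continuous_tensor (f g : R -> R) : continuous f -> continuous g -> continuous (tensor f g).
Proof.
move=> cf cg x; apply: continuousM.
  by apply: continuous_comp; [exact: cvg_fst|exact: cf].
by apply: continuous_comp; [exact: cvg_snd|exact: cg].
Qed.

Lemma partials_tensor s (f g : R -> R) : smoothoo f -> smoothoo g ->
  exists f' g', [/\ smoothoo f', smoothoo g' & partials s (tensor f g) = tensor f' g'].
Proof.
move=> sf sg; elim: s => [|i s [f' [g' [sf' sg' E]]]]; first by exists f, g.
rewrite /= E; have [sdf _] := smoothoo_derive sf'; have [sdg _] := smoothoo_derive sg'.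
have := partialP (fun x => is_derive_tensor i x sf' sg').
by case: (ord2P i) => -> /= ->; [exists (derive1 f'), g'|exists f', (derive1 g')].
Qed.

Lemma smooth_tensor (f g : R -> R) : smoothoo f -> smoothoo g -> smooth (tensor f g).
Proof.
move=> sf sg s; have [f' [g' [sf' sg' ->]]] := partials_tensor s sf sg.
split; first exact: (continuous_tensor (sf' 0%N) (sg' 0%N)).
by move=> x i; case: (is_derive_tensor i x sf' sg').
Qed.

Definition bump n (a b c d : R) : P -> R := tensor (bump1 n a b) (bump1 n c d).

Lemma bump_itv n a b c d x : 0 <= bump n a b c d x <= 1.
Proof.
have /andP[u0 u1] := bump1_itv n a b x.1; have /andP[v0 v1] := bump1_itv n c d x.2.
by rewrite /bump /tensor mulr_ge0 //= mulr_ile1.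
Qed.

Lemma bump_gt0 n a b c d x : box a b c d x -> 0 < bump n a b c d x.
Proof. by move=> [? ?]; rewrite /bump /tensor mulr_gt0 ?bump1_gt0. Qed.

Lemma bump_out n a b c d x : ~ box a b c d x -> bump n a b c d x = 0.
Proof.
move=> nb; rewrite /bump /tensor.
have [h|h] := boolP (a < x.1 < b); last by rewrite bump1_out ?mul0r.
have [h'|h'] := boolP (c < x.2 < d); last by rewrite [X in _ * X]bump1_out ?mulr0.
by case: nb.
Qed.

Lemma bump_cvg a b c d x : box a b c d x -> bump n a b c d x @[n --> \oo] --> (1 : R).
Proof. by move=> [? ?]; rewrite -[X in _ --> X](mulr1 1); apply: cvgM; exact: bump1_cvg. Qed.

Lemma test_function_bump n a b c d (O : set P) : cbox a b c d `<=` O ->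
  test_function O (bump n a b c d).
Proof.
move=> bO; split; first by apply: smooth_tensor; exact: smoothoo_bump1.
exists (cbox a b c d); split => //; first exact: compact_cbox.
by move=> x nx; apply: bump_out => /box_sub_cbox.
Qed.

Lemma test_functionS (O O' : set P) (phi : P -> R) : O `<=` O' ->
  test_function O phi -> test_function O' phi.
Proof. by move=> OO' [sphi [K [cK KO K0]]]; split => //; exists K; split => // x /KO /OO'. Qed.

Section Fixed.
Variables (O : set P) (phi : P -> R).
Hypothesis tphi : test_function O phi.

Lemma test_continuous : continuous phi.
Proof. by case: tphi => /(_ [::])[]. Qed.

Lemma test_partial_continuous i : continuous (partial i phi).
Proof. by case: tphi => /(_ [:: i])[]. Qed.

Lemma test_is_derive i x : is_derive x (dir i) phi (partial i phi x).
Proof. by split => //; case: tphi => /(_ [::])[_ /(_ x i)]. Qed.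

Lemma test_out x : ~ O x -> phi x = 0.
Proof. by case: tphi => _ [K [_ KO K0]] nO; apply: K0 => /KO. Qed.

(** The complement of the compact set [K] is an open neighbourhood of [x] on which [phi] vanishes;
    this covers the boundary points of [O] as well. *)
Lemma test_partial_out i x : ~ O x -> partial i phi x = 0.
Proof.
case: tphi => _ [K [cK KO K0]] nO.
have oKC : open (~` K) by apply: closed_openC; apply: compact_closed => //; exact: norm_hausdorff.
have nx : nbhs x (~` K) by apply: open_nbhs_nbhs; split => // /KO.
rewrite /partial.
suff : is_derive x (dir i) phi 0 by case.
apply: (@near_eq_is_derive R _ _ (cst (0 : R)) phi).
by near=> y; rewrite /= K0 //; near: y.
Unshelve. all: by end_near. Qed.

End Fixed.
End TestFunctions.

(** * The fundamental lemma of the calculus of variations *)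

Section FundamentalLemma.
Context {R : realType}.
Local Notation P := (plane R).
Local Notation mu := (@lebesgue2 R).

Lemma negligible_bigcup_countType (I : countType) (F : I -> set P) :
  (forall i, mu.-negligible (F i)) -> mu.-negligible (\bigcup_i F i).
Proof.
move=> nF; have : mu.-negligible (\bigcup_n (if unpickle n is Some i then F i else set0)).
  by apply: negligible_bigcup => n; case: unpickle => // ; exact: negligible_set0.
by apply: negligibleS => x [i _ Fx]; exists (pickle i) => //; rewrite pickleK.
Qed.

(** Quadrants are stable under intersection, generate the measurable sets of the plane, and cut an
    open box in an open box. *)
Definition quadrant (a c : R) : set P := [set x | a < x.1 /\ c < x.2].
Definition quadrants : set (set P) := [set A | exists a c, A = quadrant a c].

Lemma measurable_quadrants : @measurable _ P = <<s quadrants >>.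
Proof.
apply/seteqP; split; last first.
  apply: smallest_sub; first exact: sigma_algebra_measurable.
  move=> _ [a [c ->]]; rewrite (_ : quadrant a c = `]a, +oo[%classic `*` `]c, +oo[%classic).
    exact: measurableX.
  by apply/seteqP; split => -[x y]; rewrite /quadrant /= !in_itv /= !andbT.
have sG := smallest_sigma_algebra [set: P] quadrants.
have half (f : P -> R) : (forall a, <<s quadrants >> (f @^-1` `]a, +oo[%classic)) ->
    forall A : set R, measurable A -> <<s quadrants >> (f @^-1` A).
  move=> Hf A mA.
  have : <<s [set A | exists x, A = `]x, +oo[%classic] >> `<=` image_set_system setT f <<s quadrants >>.
    apply: smallest_sub; first exact: sigma_algebra_image.
    by move=> _ [a ->]; rewrite /image_set_system /= setTI.
  move=> /(_ A); rewrite /image_set_system /= setTI; apply.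
  have mA' : @measurable _ (measurableTypeR R) A by [].
  by move: mA'; rewrite RGenOInfty.measurableE.
apply: smallest_sub; first exact: sG.
rewrite subUset; split => _ [A mA <-]; rewrite setTI;
  apply: half => // a.
(* An open half-plane is the union of the quadrants whose other bound runs through the negative
   integers. *)
- rewrite (_ : _ @^-1` _ = \bigcup_(n : nat) quadrant a (- n%:R)).
    by apply: sigma_algebra_bigcup => n; apply: sub_sigma_algebra; exists a, (- n%:R).
  apply/seteqP; split => [[x y]|[x y] [n _ []]]; rewrite /= in_itv /= andbT // => ax.
  by exists (Num.Def.archi_bound y) => //; split => //=; rewrite ltrNl; exact: unstable.ltrNbound.
- rewrite (_ : _ @^-1` _ = \bigcup_(n : nat) quadrant (- n%:R) a).
    by apply: sigma_algebra_bigcup => n; apply: sub_sigma_algebra; exists (- n%:R), a.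
  apply/seteqP; split => [[x y]|[x y] [n _ []]]; rewrite /= in_itv /= andbT // => ax.
  by exists (Num.Def.archi_bound x) => //; split => //=; rewrite ltrNl; exact: unstable.ltrNbound.
Qed.

(** Dynkin's theorem: the indefinite integral of [f] is a charge, so the sets on which it vanishes
    are closed under disjoint unions, and under complements because the total integral is zero. *)
Lemma integral0_quadrants (f : P -> \bar R) : mu.-integrable setT f ->
  (\int[mu]_x f x = 0)%E -> (forall a c, \int[mu]_(x in quadrant a c) f x = 0)%E ->
  forall A, measurable A -> (\int[mu]_(x in A) f x = 0)%E.
Proof.
move=> intf fT fq A mA; pose nu := induced_charge intf.
have nuE B : nu B = (\int[mu]_(x in B) f x)%E by [].
rewrite -nuE; have : <<s quadrants >> A by rewrite -measurable_quadrants.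
apply: (dynkin_induction (P := fun A => nu A = 0%E) measurable_quadrants) => //.
- move=> _ _ [a [c ->]] [a' [c' ->]]; exists (Num.max a a'), (Num.max c c').
  apply/seteqP; split => x; rewrite /quadrant /= !gt_max.
    by move=> [[-> ->] [-> ->]].
  by move=> [/andP[? ?] /andP[? ?]].
- by move=> _ [a [c ->]]; exact: fq.
- move=> S mS nS; rewrite -setTD.
  have -> : nu (setT `\` S) = (nu setT - nu (setT `&` S))%E.
    exact: (@chargeD _ _ _ (induced_charge intf) setT S measurableT mS).
  by rewrite setTI nS sube0; exact: fT.
- move=> F mF tF nF.
  have := @charge_semi_sigma_additive _ _ _ (induced_charge intf) F mF tF (bigcupT_measurable _ mF).
  rewrite (_ : (fun n => _) = (fun=> 0%E)); last first.
    by apply/funext => n; rewrite big1.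
  move=> /(cvg_unique (@ereal_hausdorff R)) h; apply: h; exact: cvg_cst.
Qed.

Variables (O : set P) (psi : P -> R).
Hypothesis oO : open O.
Hypothesis intpsi : mu.-integrable O (EFin \o psi).
Hypothesis psi0 : forall phi, test_function O phi -> \int[mu]_(x in O) (psi x * phi x) = 0.

Lemma bump_integrable n a b c d :
  mu.-integrable O (fun x => (psi x * bump n a b c d x)%:E).
Proof.
have mO := measurable_open oO.
apply: le_integrable intpsi => //.
  apply/measurable_EFinP; apply: measurable_funM.
    by apply/measurable_EFinP; case/integrableP: intpsi.
  by apply: continuous_measurable; apply: continuous_tensor; exact: (smoothoo_bump1 _ _ _ 0%N).
move=> x _; rewrite /= lee_fin normrM -[leRHS]mulr1 ler_wpM2l //.
by have /andP[u0 u1] := bump_itv n a b c d x; rewrite ger0_norm.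
Qed.

(** The bumps on the box are test functions that tend pointwise to its indicator, and [|psi|]
    dominates the products: dominated convergence. *)
Lemma integral_box0 a b c d : cbox a b c d `<=` O ->
  (\int[mu]_(x in box a b c d) (psi x)%:E = 0)%E.
Proof.
move=> bO; have mO := measurable_open oO.
have dc := @dominated_cvg _ _ R mu O mO (fun n x => (psi x * bump n a b c d x)%:E)
  ((EFin \o psi) \_ (box a b c d)) (fun x => (`|psi x|)%:E).
have {}dc := dc _ _ _ _ _.
have {dc} : (\int[mu]_(x in O) (psi x * bump n a b c d x)%:E)%E @[n --> \oo] -->
    (\int[mu]_(x in O) ((EFin \o psi) \_ (box a b c d)) x)%E.
  apply: dc => //.
  - by move=> n; case/integrableP: (bump_integrable n a b c d).
  - move=> x _; rewrite /patch; case: ifPn; rewrite ?inE ?notin_setE => bx /=.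
      apply: cvg_EFin; first by near=> n.
      rewrite -[X in _ --> X]mulr1; apply: cvgM; first exact: cvg_cst.
      exact: bump_cvg.
    rewrite (_ : (fun n => _) = (fun=> 0%E)); last by apply/funext => n; rewrite bump_out ?mulr0.
    exact: cvg_cst.
  - by have := integrable_abse intpsi.
  - move=> n x _; rewrite /= lee_fin normrM -[leRHS]mulr1 ler_wpM2l //.
    by have /andP[u0 u1] := bump_itv n a b c d x; rewrite ger0_norm.
rewrite (_ : (fun n => _) = (fun=> 0%E)); last first.
  apply/funext => n; have := psi0 (test_function_bump n bO); rewrite /Rintegral => /eqP.
  rewrite fine_eq0; last by apply: integrable_fin_num => //; exact: bump_integrable.
  by move=> /eqP.
rewrite -integral_mkcondr setIidr; last by move=> x /box_sub_cbox /bO.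
move=> /(cvg_unique (@ereal_hausdorff R)) h; apply: h; exact: cvg_cst.
Unshelve. all: by end_near. Qed.

(** Locally, on a rational box compactly contained in [O], the extension of [psi] by zero integrates
    to zero over every quadrant, since quadrant and box meet in a box. It is then zero almost
    everywhere, and countably many such boxes cover [O]. *)
Lemma fundamental_lemma : ae_eq_in O psi (cst 0).
Proof.
have mO := measurable_open oO.
have loc q : crbox q `<=` O -> mu.-negligible [set x | rbox q x /\ psi x != 0].
  move=> qO; have mB := @measurable_rbox R q.
  have qO' : rbox q `<=` O by move=> x /box_sub_cbox /qO.
  have intq : mu.-integrable (rbox q) (EFin \o psi) by exact: integrableS intpsi.
  have intf : mu.-integrable setT ((EFin \o psi) \_ (rbox q)).
    by apply: (proj1 (integrable_mkcond _ _)).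
  have sub a b c d : ratr q.1.1.1 <= a -> b <= ratr q.1.1.2 -> ratr q.1.2 <= c -> d <= ratr q.2 ->
      (\int[mu]_(x in box a b c d) (psi x)%:E = 0)%E.
    move=> ha hb hc hd; apply: integral_box0 => x [/andP[? ?] /andP[? ?]]; apply: qO.
    by split; apply/andP; split; lra.
  have f0 : forall A, measurable A -> (\int[mu]_(x in A) ((EFin \o psi) \_ (rbox q)) x = 0)%E.
    apply: integral0_quadrants => //.
      by rewrite -integral_mkcond; exact: integral_box0.
    move=> a c; rewrite -integral_mkcondr.
    rewrite (_ : _ `&` _ = box (Num.max a (ratr q.1.1.1)) (ratr q.1.1.2) (Num.max c (ratr q.1.2)) (ratr q.2)).
      by apply: sub; rewrite ?le_max ?lexx ?orbT.
    apply/seteqP; split => x; rewrite /rbox /box /quadrant /= !gt_max.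
      by move=> [[-> ->] [/andP[-> ->] /andP[-> ->]]].
    by move=> [/andP[/andP[-> ->] ->] /andP[/andP[-> ->] ->]].
  have : ae_eq mu setT ((EFin \o psi) \_ (rbox q)) (cst 0%E).
    apply: integral_ae_eq => // B _ mB'.
    by rewrite f0 // integral_cst // mul0e.
  apply: negligibleS => x [qx /eqP px]; rewrite /= => /(_ I).
  by rewrite patchE mem_set // => -[].
have : mu.-negligible (\bigcup_(q in [set q | crbox q `<=` O]) [set x | rbox q x /\ psi x != 0]).
  rewrite bigcup_mkcond; apply: negligible_bigcup_countType => q.
  by case: ifPn => [/set_mem/loc //|_]; exact: negligible_set0.
apply: negligibleS => x /= /not_implyP[Ox /eqP px].
have [q [qx qO]] := open_rbox oO Ox.
by exists q.
Qed.

End FundamentalLemma.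

(** * Polynomial functions *)

Section Polynomials.
Context {R : realType}.
Local Notation P := (plane R).
Implicit Types (p q : P -> R) (j : nat).

Lemma eq_polyfun j p q : p =1 q -> polyfun j p -> polyfun j q.
Proof. by move=> pq [c cE]; exists c => x; rewrite -pq. Qed.

Lemma polyfun0 j : polyfun j (fun _ : P => 0 : R).
Proof.
by exists (fun _ _ => 0) => x; rewrite big1 // => a _; rewrite big1 // => b _; rewrite !mul0r.
Qed.

Lemma polyfunD j p q : polyfun j p -> polyfun j q -> polyfun j (fun x => p x + q x).
Proof.
move=> [c cE] [d dE]; exists (fun a b => c a b + d a b) => x.
rewrite cE dE -big_split; apply: eq_bigr => a _; rewrite -big_split; apply: eq_bigr => b _.
by rewrite /= !mulrDl.
Qed.

Lemma polyfunZ j k p : polyfun j p -> polyfun j (fun x => k * p x).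
Proof.
move=> [c cE]; exists (fun a b => k * c a b) => x.
rewrite cE big_distrr; apply: eq_bigr => a _; rewrite big_distrr; apply: eq_bigr => b _.
by rewrite /= !mulrA.
Qed.

Lemma polyfunB j p q : polyfun j p -> polyfun j q -> polyfun j (fun x => p x - q x).
Proof.
move=> pp pq; apply: (@eq_polyfun _ (fun x => p x + (-1) * q x)) => [x|]; first by rewrite mulN1r.
by apply: polyfunD => //; exact: polyfunZ.
Qed.

Lemma polyfun_monomial j a b : (a + b <= j)%N -> polyfun j (fun x : P => x.1 ^+ a * x.2 ^+ b).
Proof.
move=> abj; exists (fun a' b' => ((a' == a) && (b' == b))%:R) => x.
have aj : (a < j.+1)%N by rewrite ltnS (leq_trans _ abj) ?leq_addr.
have bj : (b < j.+1)%N by rewrite ltnS (leq_trans _ abj) ?leq_addl.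
rewrite (bigD1 (Ordinal aj)) //= (bigD1 (Ordinal bj)) //= !eqxx mul1r.
rewrite big1 ?addr0 => [|i /andP[_ ni]]; last first.
  by rewrite -(inj_eq val_inj) /= in ni; rewrite (negbTE ni) !mul0r.
rewrite big1 ?addr0 // => i ni; rewrite big1 // => k _.
by rewrite -(inj_eq val_inj) /= in ni; rewrite (negbTE ni) !mul0r.
Qed.

(** Reduces any property stable under linear combinations to monomials, so that proofs need not
    handle the double sum of the definition. *)
Lemma polyfun_ind j (Q : (P -> R) -> Prop) :
  Q (fun=> 0) -> (forall p q, Q p -> Q q -> Q (fun x => p x + q x)) ->
  (forall k p, Q p -> Q (fun x => k * p x)) ->
  (forall a b, (a + b <= j)%N -> Q (fun x => x.1 ^+ a * x.2 ^+ b)) ->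
  forall p, polyfun j p -> Q p.
Proof.
move=> Q0 QD QZ Qm p [c cE].
rewrite (_ : p = fun x => \sum_(a < j.+1) \sum_(b < j.+1 | (a + b <= j)%N)
             c a b * x.1 ^+ a * x.2 ^+ b); last exact/funext.
have Qsum n (A : pred 'I_n) (f : 'I_n -> P -> R) : (forall i, A i -> Q (f i)) ->
    Q (fun x => \sum_(i < n | A i) f i x).
  move=> Qf; rewrite (_ : (fun x => _) = \sum_(i < n | A i) f i); last first.
    by apply/funext => x; rewrite fct_sumE.
  by apply: (big_ind Q).
apply: (@Qsum) => a _; apply: (@Qsum) => b ab.
rewrite (_ : (fun x => _) = (fun x => c a b * (x.1 ^+ a * x.2 ^+ b))); last first.
  by apply/funext => x; rewrite mulrA.
exact/QZ/Qm.
Qed.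

Lemma polyfun_leq i j p : (i <= j)%N -> polyfun i p -> polyfun j p.
Proof.
move=> ij; apply: polyfun_ind; [exact: polyfun0|by move=> ? ?; exact: polyfunD|by move=> ? ?; exact: polyfunZ|].
by move=> a b ab; apply: polyfun_monomial; exact: leq_trans ij.
Qed.

Lemma polyfunM i j p q : polyfun i p -> polyfun j q -> polyfun (i + j) (fun x => p x * q x).
Proof.
move=> pp pq; move: p pp; apply: polyfun_ind.
- by apply: (eq_polyfun _ (polyfun0 _)) => x; rewrite mul0r.
- move=> p1 p2 h1 h2; apply: (eq_polyfun _ (polyfunD h1 h2)) => x; by rewrite mulrDl.
- move=> k p h; apply: (eq_polyfun _ (polyfunZ k h)) => x; by rewrite mulrA.
move=> a b ab; move: q pq; apply: polyfun_ind.
- by apply: (eq_polyfun _ (polyfun0 _)) => x; rewrite mulr0.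
- move=> p1 p2 h1 h2; apply: (eq_polyfun _ (polyfunD h1 h2)) => x; by rewrite mulrDr.
- move=> k p h; apply: (eq_polyfun _ (polyfunZ k h)) => x; by rewrite mulrCA.
move=> a' b' ab'; apply: (@eq_polyfun _ (fun x => x.1 ^+ (a + a') * x.2 ^+ (b + b'))).
  by move=> x; rewrite !exprD mulrACA.
by apply: polyfun_monomial; rewrite addnACA leq_add.
Qed.

Lemma polyfun_cst j k : polyfun j (fun _ : P => k : R).
Proof.
apply: (@eq_polyfun _ (fun x => k * (x.1 ^+ 0 * x.2 ^+ 0))) => [x|]; first by rewrite !expr0 !mulr1.
by apply: polyfunZ; exact: polyfun_monomial.
Qed.

Lemma polyfunX n p : polyfun 1 p -> polyfun n (fun x => p x ^+ n).
Proof.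
move=> pp; elim: n => [|n IH]; first by apply: (eq_polyfun _ (polyfun_cst 0 1)) => x.
by apply: (eq_polyfun _ (polyfunM pp IH)) => x; rewrite exprS.
Qed.

Definition affine_fun (l : P -> R) :=
  exists a b c : R, forall x, l x = a * x.1 + b * x.2 + c.

Lemma polyfun_affine l : affine_fun l -> polyfun 1 l.
Proof.
move=> [a [b [c lE]]].
apply: (@eq_polyfun _ (fun x => (a * (x.1 ^+ 1 * x.2 ^+ 0) + b * (x.1 ^+ 0 * x.2 ^+ 1)) + c)).
  by move=> x; rewrite lE !expr0 !expr1 mulr1 mul1r.
apply: polyfunD; last exact: polyfun_cst.
by apply: polyfunD; apply: polyfunZ; exact: polyfun_monomial.
Qed.

Lemma polyfun_monomial_comp j a b (l m : P -> R) : affine_fun l -> affine_fun m ->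
  (a + b <= j)%N -> polyfun j (fun x => l x ^+ a * m x ^+ b).
Proof.
by move=> al am ab; apply: (polyfun_leq ab); apply: polyfunM; apply: polyfunX; exact: polyfun_affine.
Qed.

Lemma polyfun_comp j p (l m : P -> R) : affine_fun l -> affine_fun m ->
  polyfun j p -> polyfun j (fun x => p (l x, m x)).
Proof.
move=> al am; apply: (polyfun_ind (Q := fun p => polyfun j (fun x => p (l x, m x)))).
- exact: polyfun0.
- by move=> ? ?; exact: polyfunD.
- by move=> ? ?; exact: polyfunZ.
- by move=> a b ab; exact: polyfun_monomial_comp.
Qed.

Lemma is_derive_fst (x v : P) : is_derive x v (fun y : P => y.1) v.1.
Proof.
have c : h^-1 *: (((fun y : P => y.1) \o shift x) (h *: v) - x.1) @[h --> (0 : R)^'] --> v.1.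
  apply: cvg_near_cst; near=> h; rewrite /= addrK scalerA mulVf ?scale1r //.
  by near: h; exact: nbhs_dnbhs_neq.
by split; [apply/cvg_ex; exists v.1|exact/cvg_lim].
Unshelve. all: by end_near. Qed.

Lemma is_derive_snd (x v : P) : is_derive x v (fun y : P => y.2) v.2.
Proof.
have c : h^-1 *: (((fun y : P => y.2) \o shift x) (h *: v) - x.2) @[h --> (0 : R)^'] --> v.2.
  apply: cvg_near_cst; near=> h; rewrite /= addrK scalerA mulVf ?scale1r //.
  by near: h; exact: nbhs_dnbhs_neq.
by split; [apply/cvg_ex; exists v.2|exact/cvg_lim].
Unshelve. all: by end_near. Qed.

Lemma is_derive_powM (f g : P -> R) (df dg : R) (x v : P) a b :
  is_derive x v f df -> is_derive x v g dg ->
  is_derive x v (fun y => f y ^+ a * g y ^+ b)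
    (df * (a%:R * f x ^+ a.-1 * g x ^+ b) + dg * (b%:R * (f x ^+ a * g x ^+ b.-1))).
Proof.
move=> Df Dg; have := is_deriveM (is_deriveX a Df) (is_deriveX b Dg).
rewrite !exprfctE => D; apply: (is_derive_eq D); rewrite !scaleRE; ring.
Qed.

Lemma polyfun_gradient j p : polyfun j.+1 p ->
  exists d0 d1 : P -> R, [/\ polyfun j d0, polyfun j d1 &
    forall x v : P, is_derive x v p (v.1 * d0 x + v.2 * d1 x)].
Proof.
move: p; apply: polyfun_ind.
- exists (fun=> 0), (fun=> 0); split; [exact: polyfun0|exact: polyfun0|] => x v.
  by rewrite !mulr0 addr0; exact: is_derive_cst.
- move=> p q [d0 [d1 [p0 p1 D]]] [e0 [e1 [q0 q1 E]]].
  exists (fun x => d0 x + e0 x), (fun x => d1 x + e1 x); split; [exact: polyfunD|exact: polyfunD|].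
  by move=> x v; apply: (is_derive_eq (is_deriveD (D x v) (E x v))); ring.
- move=> k p [d0 [d1 [p0 p1 D]]].
  exists (fun x => k * d0 x), (fun x => k * d1 x); split; [exact: polyfunZ|exact: polyfunZ|].
  by move=> x v; apply: (is_derive_eq (is_deriveZ k (D x v))); rewrite scaleRE; ring.
move=> a b ab.
exists (fun x => a%:R * (x.1 ^+ a.-1 * x.2 ^+ b)), (fun x => b%:R * (x.1 ^+ a * x.2 ^+ b.-1)); split.
- case: a ab => [_|a ab]; first by apply: (eq_polyfun _ (polyfun0 _)) => x; rewrite mul0r.
  by apply: polyfunZ; apply: polyfun_monomial; rewrite -ltnS.
- case: b ab => [_|b ab]; first by apply: (eq_polyfun _ (polyfun0 _)) => x; rewrite mul0r.
  by apply: polyfunZ; apply: polyfun_monomial; rewrite -ltnS -addnS.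
- move=> x v; apply: (is_derive_eq (is_derive_powM a b (is_derive_fst x v) (is_derive_snd x v))).
  by rewrite !mulrA.
Qed.

Lemma polyfun_derive j p : polyfun j.+1 p -> forall x v : P,
  is_derive x v p (v.1 * partial 0 p x + v.2 * partial 1 p x).
Proof.
move=> /polyfun_gradient[d0 [d1 [_ _ D]]] x v.
have -> : partial 0 p x = d0 x.
  by case: (D x (dir 0)) => _; rewrite /partial => ->; rewrite /dir /= mul1r mul0r addr0.
have -> : partial 1 p x = d1 x.
  by case: (D x (dir 1)) => _; rewrite /partial => ->; rewrite /dir /= mul1r mul0r add0r.
exact: D.
Qed.

Lemma polyfun_partial j p i : polyfun j.+1 p -> polyfun j (partial i p).
Proof.
move=> /polyfun_gradient[d0 [d1 [p0 p1 D]]].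
case: (ord2P i) => ->.
  rewrite (_ : partial 0 p = d0) //; apply/funext => x.
  by case: (D x (dir 0)) => _; rewrite /partial => ->; rewrite /dir /= mul1r mul0r addr0.
rewrite (_ : partial 1 p = d1) //; apply/funext => x.
by case: (D x (dir 1)) => _; rewrite /partial => ->; rewrite /dir /= mul1r mul0r add0r.
Qed.

Lemma polyfun_is_derive j p i : polyfun j p -> forall x, is_derive x (dir i) p (partial i p x).
Proof.
by move=> /(polyfun_leq (leqnSn j)) /polyfun_derive D x; split => //; case: (D x (dir i)).
Qed.

Lemma polyfun_continuous j p : polyfun j p -> continuous p.
Proof.
move: p; apply: polyfun_ind.
- by move=> x; exact: cvg_cst.
- by move=> p q cp cq x; apply: continuousD; [exact: cp|exact: cq].
- by move=> k p cp x; apply: continuousM; [exact: cvg_cst|exact: cp].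
move=> a b _ x.
apply: (@cvgM _ _ (nbhs x) _ (fun y : P => y.1 ^+ a) (fun y : P => y.2 ^+ b)).
  have h : {for x, continuous (fst : P -> R)} by exact: cvg_fst.
  exact: (continuous_comp h (@exprn_continuous R a _)).
have h : {for x, continuous (snd : P -> R)} by exact: cvg_snd.
exact: (continuous_comp h (@exprn_continuous R b _)).
Qed.

Lemma polyfun_line j p (z e : P) : polyfun j p ->
  exists q : {poly R}, forall u : R, p (z + u *: e) = q.[u].
Proof.
move: p; apply: polyfun_ind.
- by exists 0 => u; rewrite horner0.
- by move=> p q [f fE] [g gE]; exists (f + g) => u; rewrite fE gE hornerD.
- by move=> k p [f fE]; exists (k *: f) => u; rewrite fE hornerZ.
move=> a b _; exists (('X * e.1%:P + z.1%:P) ^+ a * ('X * e.2%:P + z.2%:P) ^+ b) => u.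
by rewrite !hornerE /= ![z.1 + _]addrC ![z.2 + _]addrC.
Qed.

Lemma poly_zero_itv (q : {poly R}) (a b : R) : a < b ->
  (forall u, a < u < b -> q.[u] = 0) -> q = 0.
Proof.
move=> ab q0; apply/eqP/negPn/negP => qn0.
(* These are [size q] distinct points strictly inside []a, b[], whereas a nonzero [q] has fewer than
   [size q] roots. *)
pose s := [seq a + (b - a) * (k.+1%:R / (size q).+1%:R) | k <- iota 0 (size q)].
have us : uniq s.
  rewrite map_inj_uniq ?iota_uniq // => k l /addrI /mulfI; rewrite subr_eq0 gt_eqF // => /(_ isT).
  by move=> /mulIf; rewrite invr_eq0 pnatr_eq0 => /(_ isT) /eqP; rewrite eqr_nat eqSS => /eqP.
have rs : all (root q) s.
  apply/allP => w /mapP[k]; rewrite mem_iota add0n => /andP[_ kq] ->; apply/rootP/q0.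
  have d0 : 0 < b - a by rewrite subr_gt0.
  have r0 : 0 < k.+1%:R / (size q).+1%:R :> R by rewrite divr_gt0.
  have r1 : k.+1%:R / (size q).+1%:R < 1 :> R by rewrite ltr_pdivrMr // mul1r ltr_nat ltnS.
  rewrite ltrDl mulr_gt0 //= -ltrBrDl -[ltRHS]mulr1 ltr_pM2l //.
have := max_poly_roots qn0 rs us.
by rewrite size_map size_iota ltnn.
Qed.

(** Extends an identity known only on a short piece of a half-diagonal to the whole line carrying
    it. *)
Lemma polyfun_zero_line j p (z e : P) (a b : R) : polyfun j p -> a < b ->
  (forall u, a < u < b -> p (z + u *: e) = 0) -> forall u, p (z + u *: e) = 0.
Proof.
move=> /(polyfun_line z e)[q qE] ab p0 u; rewrite qE (@poly_zero_itv q a b) ?horner0 // => w /p0.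
by rewrite qE.
Qed.

End Polynomials.

(** * Polynomial right inverses of the divergence *)

Section Frame.
Context {R : realType}.
Local Notation P := (plane R).
Implicit Types (p q : P -> R) (j : nat).

Definition fld_div (E : 'I_2 -> P -> R) (x : P) : R := \sum_i partial i (E i) x.

Lemma fld_divE E x : fld_div E x = partial 0 (E 0) x + partial 1 (E 1) x.
Proof.
rewrite /fld_div big_ord_recl big_ord1.
by congr (partial _ (E _) _ + partial _ (E _) _); apply/val_inj.
Qed.

Lemma affine_fun_derive (l : P -> R) a b c (x v : P) :
  (forall y, l y = a * y.1 + b * y.2 + c) -> is_derive x v l (a * v.1 + b * v.2).
Proof.
move=> lE; have := is_deriveD (is_deriveD (is_deriveZ a (is_derive_fst x v))
  (is_deriveZ b (is_derive_snd x v))) (is_derive_cst c x v).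
by rewrite addr0 (_ : _ + cst c = l) //; apply/funext => y; rewrite lE.
Qed.

Lemma affine_fun_continuous (l : P -> R) : affine_fun l -> continuous l.
Proof. by move=> /polyfun_affine; exact: polyfun_continuous. Qed.

Variables (z e1 e2 : P).
Hypothesis De : cross e1 e2 != 0.

(** Cramer's rule: [crd_s] and [crd_t] are the coordinates of [x] in the affine frame with origin
    [z] and axes [e1], [e2]. *)
Definition crd_s (x : P) : R := cross (x - z) e2 / cross e1 e2.
Definition crd_t (x : P) : R := cross e1 (x - z) / cross e1 e2.

Lemma crd_sE x : crd_s x =
  (e2.2 / cross e1 e2) * x.1 + (- e2.1 / cross e1 e2) * x.2 + - (cross z e2 / cross e1 e2).
Proof. by rewrite /crd_s /cross /=; ring. Qed.

Lemma crd_tE x : crd_t x =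
  (- e1.2 / cross e1 e2) * x.1 + (e1.1 / cross e1 e2) * x.2 + - (cross e1 z / cross e1 e2).
Proof. by rewrite /crd_t /cross /=; ring. Qed.

Lemma affine_crd_s : affine_fun crd_s.
Proof. by do 3!eexists; exact: crd_sE. Qed.

Lemma affine_crd_t : affine_fun crd_t.
Proof. by do 3!eexists; exact: crd_tE. Qed.

Lemma crd_stK x : z + crd_s x *: e1 + crd_t x *: e2 = x.
Proof.
move: De; rewrite /crd_s /crd_t /cross; case: x z e1 e2 => [x1 x2] [z1 z2] [a1 a2] [b1 b2] /= D.
by apply: plane_eq; rewrite /= !scaleRE; field.
Qed.

Lemma crd_sP a b : crd_s (z + a *: e1 + b *: e2) = a.
Proof.
move: De; rewrite /crd_s /cross; case: z e1 e2 => [z1 z2] [a1 a2] [b1 b2] /= D.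
by rewrite !scaleRE; field.
Qed.

Lemma crd_tP a b : crd_t (z + a *: e1 + b *: e2) = b.
Proof.
move: De; rewrite /crd_t /cross; case: z e1 e2 => [z1 z2] [a1 a2] [b1 b2] /= D.
by rewrite !scaleRE; field.
Qed.

Lemma derive_crd_s1 x : is_derive x e1 crd_s 1.
Proof.
apply: (is_derive_eq (affine_fun_derive x e1 crd_sE)).
by move: De; rewrite /cross => D; field.
Qed.

Lemma derive_crd_s2 x : is_derive x e2 crd_s 0.
Proof.
apply: (is_derive_eq (affine_fun_derive x e2 crd_sE)).
by move: De; rewrite /cross => D; field.
Qed.

Lemma derive_crd_t1 x : is_derive x e1 crd_t 0.
Proof.
apply: (is_derive_eq (affine_fun_derive x e1 crd_tE)).
by move: De; rewrite /cross => D; field.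
Qed.

Lemma derive_crd_t2 x : is_derive x e2 crd_t 1.
Proof.
apply: (is_derive_eq (affine_fun_derive x e2 crd_tE)).
by move: De; rewrite /cross => D; field.
Qed.

(** An affine change of variables preserves the degree bound, so a polynomial is also a combination
    of monomials in the frame coordinates. *)
Lemma polyfun_frame_ind j (Q : (P -> R) -> Prop) :
  Q (fun=> 0) -> (forall p q, Q p -> Q q -> Q (fun x => p x + q x)) ->
  (forall k p, Q p -> Q (fun x => k * p x)) ->
  (forall a b, (a + b <= j)%N -> Q (fun x => crd_s x ^+ a * crd_t x ^+ b)) ->
  forall p, polyfun j p -> Q p.
Proof.
move=> Q0 QD QZ Qm p pp.
pose pst := fun y : P => p (z + y.1 *: e1 + y.2 *: e2).
have -> : p = fun x => pst (crd_s x, crd_t x).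
  by apply/funext => x; rewrite /pst /= crd_stK.
have pp' : polyfun j pst.
  pose l (y : P) := e1.1 * y.1 + e2.1 * y.2 + z.1.
  pose m (y : P) := e1.2 * y.1 + e2.2 * y.2 + z.2.
  have al : affine_fun l by do 3!eexists.
  have am : affine_fun m by do 3!eexists.
  apply: (eq_polyfun _ (polyfun_comp al am pp)) => y.
  rewrite /pst; congr p; apply: plane_eq; rewrite /= /l /m !scaleRE; ring.
move: pst pp' {pp}; apply: polyfun_ind => //.
- by move=> f g; exact: QD.
- by move=> k f; exact: QZ.
Qed.

(** The field pointing along the fixed vector [e] with amplitude [f]. Its divergence is the
    derivative of [f] along [e], so prescribing a divergence amounts to finding a primitive in that
    direction. *)
Definition frame_fld (e : P) (f : P -> R) : 'I_2 -> P -> R := fun i x => crd i e * f x.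

Lemma polyfun_frame_fld j e f i : polyfun j f -> polyfun j (frame_fld e f i).
Proof. exact: polyfunZ. Qed.

Lemma fld_div_frame j (e : P) (f g : P -> R) : polyfun j f ->
  (forall x, is_derive x e f (g x)) -> fld_div (frame_fld e f) =1 g.
Proof.
move=> /(polyfun_leq (leqnSn j)) pf Df x; rewrite fld_divE.
have pE i : partial i (frame_fld e f i) x = crd i e * partial i f x.
  by case: (is_deriveZ (crd i e) (polyfun_is_derive i pf x)).
rewrite !pE /crd /=; case: (polyfun_derive pf x e) => _ <-.
by case: (Df x).
Qed.

Lemma fld_divD j E F : (forall i, polyfun j (E i)) -> (forall i, polyfun j (F i)) ->
  fld_div (fun i x => E i x + F i x) =1 (fun x => fld_div E x + fld_div F x).
Proof.
move=> pE pF x; rewrite !fld_divE addrACA; congr (_ + _).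
  by case: (is_deriveD (polyfun_is_derive 0 (pE 0) x) (polyfun_is_derive 0 (pF 0) x)).
by case: (is_deriveD (polyfun_is_derive 1 (pE 1) x) (polyfun_is_derive 1 (pF 1) x)).
Qed.

Lemma fld_divZ j k E : (forall i, polyfun j (E i)) ->
  fld_div (fun i x => k * E i x) =1 (fun x => k * fld_div E x).
Proof.
move=> pE x; rewrite !fld_divE mulrDr; congr (_ + _).
  by case: (is_deriveZ k (polyfun_is_derive 0 (pE 0) x)).
by case: (is_deriveZ k (polyfun_is_derive 1 (pE 1) x)).
Qed.

Lemma fld_div0 : fld_div (fun _ _ => 0) =1 (fun=> 0).
Proof.
by move=> x; rewrite fld_divE; case: (is_derive_cst (0 : R) x (dir 0)) => _;
  rewrite /partial => ->; case: (is_derive_cst (0 : R) x (dir 1)) => _ ->; rewrite addr0.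
Qed.

(* A field E vanishing on V can be cut off along V without leaving H1. *)
Definition has_div j (V : P -> Prop) (q : P -> R) := exists E : 'I_2 -> P -> R,
  [/\ forall i, polyfun j.+1 (E i), forall i x, V x -> E i x = 0 & fld_div E =1 q].

Lemma has_div0 j V : has_div j V (fun=> 0).
Proof.
exists (fun _ _ => 0); split=> //; last exact: fld_div0.
by move=> i; exact: polyfun0.
Qed.

Lemma has_divD j V p q : has_div j V p -> has_div j V q -> has_div j V (fun x => p x + q x).
Proof.
move=> [E [pE VE dE]] [F [pF VF dF]]; exists (fun i x => E i x + F i x); split.
- by move=> i; exact: polyfunD.
- by move=> i x Vx; rewrite VE // VF // addr0.
- by move=> x; rewrite (fld_divD pE pF) dE dF.
Qed.

Lemma has_divZ j V k p : has_div j V p -> has_div j V (fun x => k * p x).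
Proof.
move=> [E [pE VE dE]]; exists (fun i x => k * E i x); split.
- by move=> i; exact: polyfunZ.
- by move=> i x Vx; rewrite VE // mulr0.
- by move=> x; rewrite (fld_divZ k pE) dE.
Qed.

Lemma eq_has_div j V p q : p =1 q -> has_div j V p -> has_div j V q.
Proof. by move=> pq; rewrite (_ : p = q) //; apply/funext. Qed.

(** The primitive along [e1] is [s^(a+1) t^b / (a+1)]. It always vanishes on [s = 0], and on [t = 0]
    as soon as [b > 0]. *)
Lemma has_div_monomial1 j (V : P -> Prop) a b : (a + b <= j)%N ->
  (forall x, V x -> crd_s x = 0 \/ crd_t x = 0 /\ (0 < b)%N) ->
  has_div j V (fun x => crd_s x ^+ a * crd_t x ^+ b).
Proof.
move=> ab V0; pose f x := a.+1%:R^-1 * (crd_s x ^+ a.+1 * crd_t x ^+ b).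
have pf : polyfun j.+1 f.
  apply: polyfunZ; apply: polyfun_monomial_comp; [exact: affine_crd_s|exact: affine_crd_t|].
  by rewrite addSn ltnS.
have a0 : a.+1%:R != 0 :> R by rewrite pnatr_eq0.
exists (frame_fld e1 f); split.
- by move=> i; exact: polyfun_frame_fld.
- move=> i x /V0; rewrite /frame_fld /f => -[->|[-> b0]].
    by rewrite exprS !mul0r !mulr0.
  by rewrite expr0n eqn0Ngt b0 !mulr0.
- apply: (fld_div_frame pf) => x.
  apply: (is_derive_eq (is_deriveZ a.+1%:R^-1 (is_derive_powM a.+1 b (derive_crd_s1 x) (derive_crd_t1 x)))).
  by rewrite scaleRE mul0r addr0 mul1r /= -mulrA mulKf.
Qed.

Lemma has_div_s j p : polyfun j p -> has_div j (fun x => crd_s x = 0) p.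
Proof.
move: p; apply: polyfun_frame_ind.
- exact: has_div0.
- by move=> ? ?; exact: has_divD.
- by move=> ? ?; exact: has_divZ.
- by move=> a b ab; apply: has_div_monomial1 => // x; left.
Qed.

Lemma crd_s_center : crd_s z = 0. Proof. by rewrite /crd_s subrr /cross /= !mul0r subrr mul0r. Qed.
Lemma crd_t_center : crd_t z = 0. Proof. by rewrite /crd_t subrr /cross /= !mulr0 subrr mul0r. Qed.

(** Monomials containing [t] are integrated along [e1], positive powers of [s] alone along [e2];
    each primitive then has both factors [s] and [t]. Only the constant monomial is left over, and
    subtracting [p z] removes it. *)
Lemma has_div_st j p : polyfun j p ->
  has_div j (fun x => crd_s x = 0 \/ crd_t x = 0) (fun x => p x - p z).
Proof.
set V := (fun x => _); move: p.
apply: (polyfun_frame_ind (Q := fun p => has_div j V (fun x => p x - p z))).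
- by apply: (eq_has_div _ (has_div0 _ _)) => x; rewrite subrr.
- move=> p q hp hq; apply: (eq_has_div _ (has_divD hp hq)) => x; by rewrite opprD addrACA.
- move=> k p hp; apply: (eq_has_div _ (has_divZ k hp)) => x; by rewrite mulrBr.
move=> a [|b] ab; last first.
  apply: (@eq_has_div _ _ (fun x => crd_s x ^+ a * crd_t x ^+ b.+1)).
    by move=> x; rewrite crd_t_center [0 ^+ _]expr0n /= mulr0 subr0.
  by apply: has_div_monomial1 => // x; rewrite /V; case; [left|right].
case: a ab => [|a] ab.
  by apply: (eq_has_div _ (has_div0 _ _)) => x; rewrite !expr0 subrr.
(* The primitive along [e2], because a primitive of this power along [e1] would lack the factor
   [t]. *)
pose f x := crd_s x ^+ a.+1 * crd_t x ^+ 1.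
have pf : polyfun j.+1 f.
  apply: polyfun_monomial_comp; [exact: affine_crd_s|exact: affine_crd_t|].
  by rewrite addn1 ltnS -[a.+1]addn0.
exists (frame_fld e2 f); split.
- by move=> i; exact: polyfun_frame_fld.
- move=> i x; rewrite /V /frame_fld /f expr1 exprS => -[->|->].
    by rewrite !mul0r !mulr0.
  by rewrite !mulr0.
- move=> x; rewrite crd_s_center [0 ^+ _]expr0n /= mul0r subr0 expr0 mulr1; move: x.
  apply: (fld_div_frame pf) => x.
  apply: (is_derive_eq (is_derive_powM a.+1 1 (derive_crd_s2 x) (derive_crd_t2 x))).
  by rewrite mul0r add0r !mul1r /= mulr1.
Qed.

End Frame.

Section FrameSwap.
Context {R : realType}.
Local Notation P := (plane R).

Lemma crossC (a b : P) : cross a b = - cross b a.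
Proof. by rewrite /cross; ring. Qed.

Lemma crd_s_swap (z e1 e2 : P) x : crd_s z e2 e1 x = crd_t z e1 e2 x.
Proof. by rewrite /crd_s /crd_t (crossC e2) (crossC _ e1) invrN mulrNN. Qed.

Lemma has_div_t j (z e1 e2 : P) p : cross e1 e2 != 0 -> polyfun j p ->
  has_div j (fun x => crd_t z e1 e2 x = 0) p.
Proof.
move=> De pp; have De' : cross e2 e1 != 0 by rewrite crossC oppr_eq0.
have [E [pE VE dE]] := has_div_s z De' pp.
by exists E; split => // i x; rewrite -crd_s_swap; exact: VE.
Qed.

End FrameSwap.

(** * Weak derivatives of piecewise polynomials *)

Section WeakPartials.
Context {R : realType}.
Local Notation P := (plane R).
Local Notation mu := (@lebesgue2 R).
Local Notation LP := (measurableTypeR R * measurableTypeR R)%type.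
Implicit Types (Q O : set P) (f g u p : P -> R).

Definition domain Q := [/\ open Q, bounded_plane Q & line_convex Q].

Lemma domain_measurable Q : domain Q -> @measurable _ LP Q.
Proof. by case=> oQ _ _; exact: measurable_open. Qed.

Lemma domain_fin Q : domain Q -> (mu Q < +oo)%E.
Proof. by move=> dQ; apply: bounded_plane_fin; [exact: domain_measurable|case: dQ]. Qed.

Lemma domainI Q O : domain Q -> open O -> line_convex O -> domain (Q `&` O).
Proof.
move=> [oQ [M QM] cQ] oO cO; split; first exact: openI.
  by exists M => x [/QM].
move=> i y a b [Qa Oa] [Qb Ob] c ab.
by split; [exact: (cQ i y a b)|exact: (cO i y a b)].
Qed.

Lemma Rintegral_sub Q O f : measurable Q -> measurable O -> O `<=` Q ->
  (forall x, Q x -> ~ O x -> f x = 0) ->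
  \int[mu]_(x in Q) f x = \int[mu]_(x in O) f x.
Proof.
move=> mQ mO OQ f0; rewrite -[in RHS](setIidr OQ) Rintegral_mkcondr.
apply: eq_Rintegral => x; rewrite inE => Qx; rewrite /patch.
by case: ifPn => //; rewrite notin_setE => /(f0 _ Qx).
Qed.

Lemma Rintegral_ae O f g : measurable O -> measurable_fun O f -> measurable_fun O g ->
  ae_eq_in O f g -> \int[mu]_(x in O) f x = \int[mu]_(x in O) g x.
Proof.
move=> mO mf mg fg; rewrite /Rintegral; congr fine.
apply: ae_eq_integral => //; [exact/measurable_EFinP|exact/measurable_EFinP|].
by apply: negligibleS fg => x /=; apply: contra_not => h Ox; rewrite h.
Qed.

Lemma ae_eq_in_sym O f g : ae_eq_in O f g -> ae_eq_in O g f.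
Proof. by apply: negligibleS => x /=; apply: contra_not => h Ox; rewrite h. Qed.

Lemma ae_eq_in_trans O f g h : ae_eq_in O f g -> ae_eq_in O g h -> ae_eq_in O f h.
Proof.
move=> fg gh; apply: negligibleS (negligibleU fg gh) => x /= nfh.
apply: contrapT => /not_orP[/contrapT e1 /contrapT e2]; apply: nfh => Ox.
by rewrite e1 // e2.
Qed.

Lemma ae_eq_in_refl O f g : (forall x, O x -> f x = g x) -> ae_eq_in O f g.
Proof.
move=> fg; apply: (negligibleS (A := set0)); last exact: negligible_set0.
by move=> x /=; apply => /fg.
Qed.

Lemma ae_eq_in_op2 O f g f' g' (op : R -> R -> R) : ae_eq_in O f g -> ae_eq_in O f' g' ->
  ae_eq_in O (fun x => op (f x) (f' x)) (fun x => op (g x) (g' x)).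
Proof.
move=> fg gh; apply: negligibleS (negligibleU fg gh) => x /= nfh.
apply: contrapT => /not_orP[/contrapT e1 /contrapT e2]; apply: nfh => Ox.
by rewrite e1 // e2.
Qed.

(** No boundary term appears: at a boundary point of [O] inside [Q] the polynomial vanishes by
    hypothesis, and outside [Q] the test function vanishes. *)
Lemma integral_partialM Q i O p phi j : domain O -> polyfun j p -> test_function Q phi ->
  (forall x, Q x -> closure O x -> ~ O x -> p x = 0) ->
  \int[mu]_(x in O) (p x * partial i phi x) = - \int[mu]_(x in O) (partial i p x * phi x).
Proof.
move=> [oO bO cO] pp tphi p0; have mO : @measurable _ LP O := measurable_open oO.
have cp := polyfun_continuous pp; have cphi := test_continuous tphi.
have cdphi := test_partial_continuous tphi (i := i).
have cdp : continuous (partial i p).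
  exact: (polyfun_continuous (polyfun_partial i (polyfun_leq (leqnSn j) pp))).
have c1 : continuous (fun x => p x * partial i phi x).
  by move=> x; apply: continuousM; [exact: cp|exact: cdphi].
have c2 : continuous (fun x => partial i p x * phi x).
  by move=> x; apply: continuousM; [exact: cdp|exact: cphi].
apply/eqP; rewrite -subr_eq0 opprK -RintegralD //; try exact: continuous_integrable.
apply/eqP; apply: (integral_partial0 (i := i) (h := fun x => p x * phi x)) => //.
- by move=> x; exact: (cvgD (c1 x) (c2 x)).
- move=> x; have D := is_deriveM (polyfun_is_derive i pp x) (test_is_derive tphi i x).
  by apply: (is_derive_eq D); rewrite !scaleRE; congr (_ + _); rewrite mulrC.
- move=> x cx nx; have [Qx|nQ] := pselect (Q x); first by rewrite p0 ?mul0r.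
  by rewrite (test_out tphi nQ) mulr0.
Qed.

Section Dom.
Variable Q : set P.
Hypothesis dQ : domain Q.
Let mQ : @measurable _ LP Q := domain_measurable dQ.

Lemma L2_integrable f : L2 Q f -> mu.-integrable Q (EFin \o f).
Proof.
move=> [mf if2].
have i1 : mu.-integrable Q (EFin \o (fun=> 1 : R)).
  by apply: (integrable_bounded (M := 1)) => //; [exact: domain_fin|move=> x _; rewrite normr1].
have isum := integrableD mQ i1 if2.
apply: le_integrable isum => //; first exact/measurable_EFinP.
move=> x Qx /=; rewrite lee_fin.
have h : `|f x| <= 1 + f x ^+ 2 by rewrite -[f x ^+ 2]real_normK ?num_real //; nra.
by apply: (le_trans h); exact: ler_norm.
Qed.

Lemma integrable_mulr f phi : mu.-integrable Q (EFin \o f) -> continuous phi ->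
  mu.-integrable Q (EFin \o (fun x => f x * phi x)).
Proof.
move=> intf cphi; have [M bM] := continuous_bounded (let: And3 _ b _ := dQ in b) cphi.
have := @integrableMl _ _ R mu Q mQ (EFin \o f) phi intf (continuous_measurable (D := Q) cphi).
apply; exists M; split; first exact: num_real.
by move=> N MN x Qx; apply: le_trans (bM x Qx) (ltW MN).
Qed.

Lemma L2_ae_bounded f (M : R) : measurable_fun Q f ->
  {ae mu, forall x, Q x -> `|f x| <= M} -> L2 Q f.
Proof.
move=> mf bf; split=> //; apply/integrableP; split.
  by apply/measurable_EFinP; exact: measurable_funX.
have : (\int[mu]_(x in Q) `|(f x ^+ 2)%:E| <= \int[mu]_(x in Q) (M ^+ 2)%:E)%E.
  apply: ae_ge0_le_integral => //.
  - by apply/measurable_EFinP; apply: measurableT_comp => //; exact: measurable_funX.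
  - by move=> x _; rewrite lee_fin sqr_ge0.
  - apply: negligibleS bf => x /=; apply: contra_not => h Qx; rewrite lee_fin.
    have M0 : 0 <= M by apply: le_trans (h Qx).
    by rewrite normrX ler_sqr ?nnegrE // h.
move=> /le_lt_trans; apply; rewrite integral_cst //.
by apply: lte_mul_pinfty; rewrite ?lee_fin ?sqr_ge0 //; exact: domain_fin.
Qed.

Lemma L2D f g : L2 Q f -> L2 Q g -> L2 Q (fun x => f x + g x).
Proof.
move=> [mf if2] [mg ig2]; split; first exact: measurable_funD.
have isum := integrableD mQ (integrableZl mQ 2%R if2) (integrableZl mQ 2%R ig2).
apply: le_integrable isum => //.
  by apply/measurable_EFinP; apply: measurable_funX; exact: measurable_funD.
move=> x Qx /=; rewrite lee_fin ger0_norm ?sqr_ge0 //.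
have h : (f x + g x) ^+ 2 <= 2 * f x ^+ 2 + 2 * g x ^+ 2.
  by have := sqr_ge0 (f x - g x); rewrite !expr2; nra.
by apply: (le_trans h); exact: ler_norm.
Qed.

Lemma L2N f : L2 Q f -> L2 Q (fun x => - f x).
Proof.
move=> [mf if2]; split; first exact: measurable_funN.
by rewrite (_ : (fun x => _) = (fun x => (f x ^+ 2)%:E)) //; apply/funext => x; rewrite sqrrN.
Qed.

Lemma weak_partialD i u u' g g' : L2 Q u -> L2 Q u' ->
  weak_partial Q i u g -> weak_partial Q i u' g' ->
  weak_partial Q i (fun x => u x + u' x) (fun x => g x + g' x).
Proof.
move=> Lu Lu' [Lg wg] [Lg' wg']; split; first exact: L2D.
move=> phi tphi; have cphi := test_continuous tphi; have cdphi := test_partial_continuous tphi (i := i).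
under eq_Rintegral do rewrite mulrDl; rewrite RintegralD //;
  [|by apply: integrable_mulr => //; exact: L2_integrable..].
under [in RHS]eq_Rintegral do rewrite mulrDl; rewrite RintegralD //;
  [|by apply: integrable_mulr => //; exact: L2_integrable..].
by rewrite wg // wg' // opprD.
Qed.

Lemma weak_partial_ae i u g g' : L2 Q g' -> ae_eq_in Q g g' ->
  weak_partial Q i u g -> weak_partial Q i u g'.
Proof.
move=> Lg' gg' [[mg _] wg]; split => // phi tphi; rewrite wg //; congr (- _).
have mphi : measurable_fun Q phi by apply: continuous_measurable; exact: test_continuous tphi.
apply: Rintegral_ae => //; [exact: measurable_funM|apply: measurable_funM => //; by case: Lg'|].
by apply: (ae_eq_in_op2 (fun a b => a * b) gg'); exact: ae_eq_in_refl.
Qed.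

Definition piece O p : P -> R := fun x => p x * \1_O x.

Lemma measurable_piece O j p : measurable O -> polyfun j p -> measurable_fun Q (piece O p).
Proof.
move=> mO pp; apply: measurable_funM; last exact: measurable_indic.
by apply: continuous_measurable; exact: polyfun_continuous pp.
Qed.

Lemma L2_piece O j p : measurable O -> polyfun j p -> L2 Q (piece O p).
Proof.
move=> mO pp; have [M bM] := continuous_bounded (let: And3 _ b _ := dQ in b) (polyfun_continuous pp).
apply: (L2_ae_bounded (M := M)); first exact: measurable_piece pp.
apply: (negligibleS (A := set0)); last exact: negligible_set0.
move=> x /=; apply => Qx; rewrite normrM indicE.
by case: (_ \in _); rewrite ?normr1 ?normr0 ?mulr1 ?mulr0 ?bM //; apply: le_trans (bM x Qx).
Qed.

(** Since [p] is zero on the part of the boundary of [O] interior to [Q], cutting it off there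
    creates no jump and hence no singular part in the derivative. *)
Lemma weak_partial_piece i O p j : domain O -> O `<=` Q -> polyfun j p ->
  (forall x, Q x -> closure O x -> ~ O x -> p x = 0) ->
  weak_partial Q i (piece O p) (piece O (partial i p)).
Proof.
move=> dO OQ pp p0; have mO := domain_measurable dO.
have pp' := polyfun_partial i (polyfun_leq (leqnSn j) pp).
split; first exact: L2_piece pp'.
have restr f phi : \int[mu]_(x in Q) (piece O f x * phi x) = \int[mu]_(x in O) (f x * phi x).
  rewrite (Rintegral_sub mQ mO OQ) => [|x _ nO].
    by apply: eq_Rintegral => x; rewrite inE /piece indicE => Ox; rewrite mem_set // mulr1.
  by rewrite /piece indicE memNset // mulr0 mul0r.
by move=> phi tphi; rewrite !restr; exact: (integral_partialM i dO pp tphi p0).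
Qed.

End Dom.

(** Test functions of [O] are test functions of [Q]. Classical integration by parts for [p] on [O]
    then shows that [g - partial i p] is orthogonal to all of them. *)
Lemma weak_partial_local Q i O u g p j : domain Q -> domain O -> O `<=` Q -> polyfun j p ->
  L2 Q u -> weak_partial Q i u g -> ae_eq_in O u p -> ae_eq_in O g (partial i p).
Proof.
move=> dQ dO OQ pp Lu [Lg wg] up.
have mQ := domain_measurable dQ; have mO := domain_measurable dO.
have [oO bO _] := dO.
have pp' := polyfun_partial i (polyfun_leq (leqnSn j) pp).
have cdp := polyfun_continuous pp'.
have ig : mu.-integrable O (EFin \o g).
  by apply: integrableS (L2_integrable dQ Lg).
have idp : mu.-integrable O (EFin \o partial i p) by exact: continuous_integrable.
have : ae_eq_in O (fun x => g x - partial i p x) (cst 0).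
  apply: fundamental_lemma => //.
    by have := integrableB mO ig idp.
  move=> phi tphi; have tphi' := test_functionS OQ tphi.
  have cphi := test_continuous tphi; have cdphi := test_partial_continuous tphi (i := i).
  have E1 : \int[mu]_(x in O) (g x * phi x) = - \int[mu]_(x in O) (p x * partial i phi x).
    apply: (canRL (@opprK R)).
    rewrite -(Rintegral_sub mQ mO OQ) => [|x _ nO]; last by rewrite (test_out tphi nO) mulr0.
    rewrite -wg // (Rintegral_sub mQ mO OQ) => [|x _ nO]; last first.
      by rewrite (test_partial_out tphi i nO) mulr0.
    have mphi : measurable_fun O (partial i phi) by exact: continuous_measurable.
    apply: Rintegral_ae => //.
    - by apply: measurable_funM => //; case: Lu => + _; exact: measurable_funS.
    - by apply: measurable_funM => //; apply: continuous_measurable; exact: polyfun_continuous pp.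
    - by apply: (ae_eq_in_op2 (fun a b => a * b) up); exact: ae_eq_in_refl.
  have E2 : \int[mu]_(x in O) (p x * partial i phi x) = - \int[mu]_(x in O) (partial i p x * phi x).
    by apply: (integral_partialM i dO pp tphi) => x Ox _ /(_ Ox).
  under eq_Rintegral do rewrite mulrBl.
  rewrite RintegralB //; [|exact: integrable_mulr..].
  by rewrite E1 E2 opprK subrr.
move=> h; apply: negligibleS h => x /=; apply: contra_not => h Ox.
by apply/eqP; rewrite -subr_eq0; apply/eqP; exact: h.
Qed.

End WeakPartials.

(** * Null sets and affine maps *)

Section NullSets.
Context {R : realType}.
Local Notation P := (plane R).
Local Notation lam := (@lebesgue_measure R).
Local Notation mu := (@lebesgue2 R).
Local Notation LP := (measurableTypeR R * measurableTypeR R)%type.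

Lemma measurable_affine (a b : R) :
  measurable_fun setT ((fun x => a * x + b) : measurableTypeR R -> measurableTypeR R).
Proof.
apply: continuous_measurable_fun => x; apply: cvgD; last exact: cvg_cst.
by apply: cvgM; [exact: cvg_cst|exact: cvg_id].
Qed.

Lemma affine_preimage_oc (a b c d : R) : a != 0 ->
  (`|a|%:E * lam ((fun x => a * x + b)%R @^-1` `]c, d]) = lam `]c, d])%E.
Proof.
move=> a0; rewrite lebesgue_measure_itv /= lte_fin.
have [ap|an|/eqP] := ltgtP 0 a; last by rewrite eq_sym (negbTE a0).
- rewrite (_ : _ @^-1` _ = `](c - b) / a, (d - b) / a]%classic); last first.
    by apply/seteqP; split => x; rewrite /= !in_itv /= ltr_pdivrMr // ler_pdivlMr // mulrC
      ltrBlDr lerBrDr.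
  rewrite lebesgue_measure_itv /= lte_fin ltr_pM2r ?invr_gt0 // ltrBlDr subrK.
  case: ifP => _; last by rewrite mule0.
  by rewrite -!EFinB -EFinM gtr0_norm //; congr (_%:E); field.
- rewrite (_ : _ @^-1` _ = `[(d - b) / a, (c - b) / a[%classic); last first.
    by apply/seteqP; split => x; rewrite /= !in_itv /= ltr_ndivlMr // ler_ndivrMr // mulrC
      ltrBlDr lerBrDr andbC.
  rewrite lebesgue_measure_itv /= lte_fin ltr_nM2r ?invr_lt0 // ltrBlDr subrK.
  case: ifP => _; last by rewrite mule0.
  by rewrite -!EFinB -EFinM ltr0_norm //; congr (_%:E); field.
Qed.

(** The pushforward of Lebesgue measure, rescaled by [|a|], agrees with it on half-open intervals,
    hence everywhere by uniqueness. *)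
Lemma null_affine1 (a b : R) (N : set R) : a != 0 -> measurable N -> lam N = 0%E ->
  lam ((fun x => a * x + b) @^-1` N) = 0%E.
Proof.
move=> a0 mN N0.
pose f : measurableTypeR R -> measurableTypeR R := fun x => a * x + b.
have mf : measurable_fun setT f by exact: measurable_affine.
have E : lam N = mscale (NngNum (normr_ge0 a)) (pushforward lam f) N.
  move=> m; apply: lebesgue_measure_unique => // X [[c d] _ <-].
  exact: (esym (affine_preimage_oc b c d a0)).
move: (E mf); rewrite N0 /mscale /pushforward /= => /esym/eqP.
by rewrite mule_eq0 eqe normr_eq0 (negbTE a0) /= => /eqP.
Qed.

Lemma measurable_slice i (N : set P) y : measurable N -> measurable [set x | N (pt i x y)].
Proof.
move=> mN; have mpt : measurable_fun setT (fun x : R => pt i x y).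
  case: (ord2P i) => ->; rewrite /pt /=; exact: measurable_fun_pair.
by rewrite -[X in measurable X]setTI; exact: mpt.
Qed.

Lemma lebesgue2_slice i (N : set P) : measurable N ->
  mu N = (\int[lam]_y lam [set x | N (pt i x y)])%E.
Proof.
move=> mN; have mN' : @measurable _ LP N by [].
have E1 : mu N = (\int[lam]_y lam [set x | N (pt (1 : 'I_2)%R x y)])%E.
  by apply: eq_integral => y _; congr (lam _); apply/seteqP; split => x; rewrite /xsection /= inE.
case: (ord2P i) => -> //; rewrite E1.
have := @indic_fubini_tonelli _ _ _ _ R lam lam N mN'.
rewrite indic_fubini_tonelli_FE // indic_fubini_tonelli_GE //= => F.
transitivity (\int[lam]_x lam (xsection N x))%E.
  by apply: eq_integral => y _; congr (lam _); apply/seteqP; split => x; rewrite /xsection /= inE.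
by rewrite F; apply: eq_integral => y _; congr (lam _); apply/seteqP; split => x;
  rewrite /ysection /= inE.
Qed.

Lemma measurable_fun_slice i (N : set P) : measurable N ->
  measurable_fun setT (fun y : measurableTypeR R => lam [set x | N (pt i x y)]).
Proof.
move=> mN; have mN' : @measurable _ LP N by [].
case: (ord2P i) => ->.
  rewrite (_ : (fun y => _) = lam \o ysection N); first exact: measurable_fun_ysection.
  by apply/funext => y; congr (lam _); apply/seteqP; split => x; rewrite /ysection /= inE.
rewrite (_ : (fun y => _) = lam \o xsection N); first exact: measurable_fun_xsection.
by apply/funext => y; congr (lam _); apply/seteqP; split => x; rewrite /xsection /= inE.
Qed.

(** By Tonelli the measure of [N] is the integral of the nonnegative function measuring its
    slices. *)
Lemma null_sliceP i (N : set P) : measurable N ->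
  mu N = 0%E <-> {ae lam, forall y, lam [set x | N (pt i x y)] = 0%E}.
Proof.
move=> mN; rewrite (lebesgue2_slice i mN).
have /(ae_eq_integral_abs _ _) := measurable_fun_slice i mN; move=> /(_ lam measurableT) E.
rewrite (_ : (\int[lam]_y _ = \int[lam]_y `|lam [set x | N (pt i x y)]|)%E); last first.
  by apply: eq_integral => y _; rewrite gee0_abs.
rewrite E; split; apply: negligibleS => y /=; apply: contra_not => h; first exact: h.
by move=> _; exact: h.
Qed.

Lemma measurable_preim (T : P -> P) (N : set P) :
  continuous (fun x => (T x).1) -> continuous (fun x => (T x).2) ->
  measurable N -> measurable (T @^-1` N).
Proof.
move=> c1 c2 mN; have mT : measurable_fun setT T.
  by apply/measurable_fun_pairP; split; exact: continuous_measurable.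
by rewrite -[X in measurable X]setTI; exact: mT.
Qed.

(** The exact property needed to pull almost-everywhere identities back along [T]. *)
Definition null_map (T : P -> P) := forall N, mu.-negligible N -> mu.-negligible (T @^-1` N).

(** Such a map preserves every slice in direction [i] and acts on it as an invertible affine map of
    the line, so the one-dimensional result applies slice by slice. *)
Lemma null_map_shear i (a b c : R) (T : P -> P) : a != 0 ->
  (forall x y, T (pt i x y) = pt i (a * x + (b * y + c)) y) ->
  affine_fun (fun x => (T x).1) -> affine_fun (fun x => (T x).2) -> null_map T.
Proof.
move=> a0 TE a1 a2 N [A [mA A0 NA]].
have mTA : measurable (T @^-1` A).
  by apply: measurable_preim => //; exact: affine_fun_continuous.
exists (T @^-1` A); split => //; last by move=> x /NA.
apply/(null_sliceP i mTA); move/(null_sliceP i mA): A0.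
apply: negligibleS => y /=; apply: contra_not => h.
rewrite (_ : [set x | _] = (fun x => a * x + (b * y + c)) @^-1` [set x | A (pt i x y)]).
  by apply: null_affine1 => //; exact: measurable_slice.
by apply/seteqP; split => x; rewrite /= TE.
Qed.

Lemma null_map_comp T T' : null_map T -> null_map T' -> null_map (T \o T').
Proof. by move=> nT nT' N /nT /nT'. Qed.

Lemma null_map_swap : null_map (fun x => (x.2, x.1)).
Proof.
move=> N [A [mA A0 NA]]; pose T (x : P) : P := (x.2, x.1).
have mTA : measurable (T @^-1` A).
  apply: measurable_preim => // x; [exact: cvg_snd|exact: cvg_fst].
exists (T @^-1` A); split => //; last by move=> x /NA.
by apply/(null_sliceP 0 mTA); move/(null_sliceP 1 mA): A0.
Qed.

Lemma affine_funE (a b c : R) : affine_fun (fun x => a * x.1 + b * x.2 + c).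
Proof. by exists a, b, c. Qed.

(** A matrix with nonzero upper left entry factors into two maps that each change a single
    coordinate; exchanging the coordinates first reduces a zero entry to that case. *)
Lemma null_map_affine (a b c d e f : R) : a * d - b * c != 0 ->
  null_map (fun x => (a * x.1 + b * x.2 + e, c * x.1 + d * x.2 + f)).
Proof.
have main (a' b' c' d' e' f' : R) : a' != 0 -> a' * d' - b' * c' != 0 ->
    null_map (fun x => (a' * x.1 + b' * x.2 + e', c' * x.1 + d' * x.2 + f')).
  move=> a0 D0.
  (* Triangular factorisation with pivot [a']: [T1] alters the first coordinate only, [T2] the
     second only, and the new diagonal entry of [T2] is the determinant divided by [a']. *)
  pose T1 (x : P) : P := (a' * x.1 + b' * x.2 + e', x.2).
  pose T2 (x : P) : P := (x.1, (c' / a') * x.1 + (d' - b' * c' / a') * x.2 + (f' - c' / a' * e')).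
  have n1 : null_map T1.
    apply: (@null_map_shear 0 a' b' e') => //; first by move=> x y; rewrite /T1 /pt /= addrA.
      exact: affine_funE.
    by exists 0, 1, 0 => x; rewrite mul0r mul1r add0r addr0.
  have n2 : null_map T2.
    apply: (@null_map_shear 1 (d' - b' * c' / a') (c' / a') (f' - c' / a' * e')).
    - by move: D0; apply: contra => /eqP h; apply/eqP; rewrite -[LHS](mulfK a0) -(mul0r a') -h; field.
    - by move=> x y; rewrite /T2 /pt /=; congr (_, _); ring.
    - by exists 1, 0, 0 => x; rewrite mul0r mul1r !addr0.
    - exact: affine_funE.
  rewrite (_ : (fun x : P => _) = T2 \o T1); first exact: null_map_comp.
  by apply/funext => x; apply: plane_eq => //=; field.
move=> D0; have [a0|a0] := eqVneq a 0; last exact: main.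
have b0 : b != 0 by move: D0; apply: contra => /eqP ->; rewrite a0; apply/eqP; ring.
have D1 : b * c - a * d != 0.
  by move: D0; apply: contra => /eqP h; apply/eqP; rewrite -[RHS]oppr0 -h; ring.
rewrite (_ : (fun x : P => _) =
  (fun x : P => (b * x.1 + a * x.2 + e, d * x.1 + c * x.2 + f)) \o (fun x : P => (x.2, x.1))).
  exact: (null_map_comp (main b a d c e f b0 D1) null_map_swap).
by apply/funext => x /=; congr (_, _); ring.
Qed.

Lemma null_line (a b c : R) : (a, b) != 0 -> mu.-negligible [set x | a * x.1 + b * x.2 + c = 0].
Proof.
move=> ab; have mL : measurable [set x : P | a * x.1 + b * x.2 + c = 0].
  rewrite (_ : [set x | _] = (fun x : P => a * x.1 + b * x.2 + c) @^-1` [set 0]) //.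
  rewrite -[X in measurable X]setTI; apply: continuous_measurable => //.
  exact/affine_fun_continuous/affine_funE.
exists [set x | a * x.1 + b * x.2 + c = 0]; split => //.
(* A coordinate direction transversal to the line: every slice in that direction meets the line in a
   single point. *)
have [i [k [k0 kE]]] : exists i k, k != 0 /\ forall y, exists m, forall x,
    a * (pt i x y).1 + b * (pt i x y).2 + c = k * x + m.
  have [a0|a0] := eqVneq a 0.
    exists 1, b; split; first by move: ab; apply: contra => /eqP ->; rewrite a0.
    by move=> y; exists (a * y + c) => x; rewrite pt1 /=; ring.
  by exists 0, a; split => // y; exists (b * y + c) => x; rewrite pt0 /=; ring.
apply/(null_sliceP i mL); apply: aeW => y; have [m mE] := kE y.
rewrite (_ : [set x | _] = [set - m / k]); first exact: lebesgue_measure_set1.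
apply/seteqP; split => x /=; rewrite mE.
  by move=> /eqP; rewrite addr_eq0 => /eqP <-; rewrite mulrC mulKf.
by move=> ->; field.
Qed.

End NullSets.

(** * Continuity across a line *)

Section Jump.
Context {R : realType}.
Local Notation P := (plane R).
Local Notation lam := (@lebesgue_measure R).
Local Notation mu := (@lebesgue2 R).
Local Notation LP := (measurableTypeR R * measurableTypeR R)%type.

Lemma open_fst (A : set R) : open A -> open [set x : P | A x.1].
Proof. by move=> oA; apply: (@open_comp _ _ fst A) => // x _; exact: cvg_fst. Qed.

Lemma open_snd (A : set R) : open A -> open [set x : P | A x.2].
Proof. by move=> oA; apply: (@open_comp _ _ snd A) => // x _; exact: cvg_snd. Qed.

Lemma domain_box (a b c d : R) : domain (box a b c d).
Proof.
split.
- rewrite (_ : box a b c d = [set x | `]a, b[%classic x.1] `&` [set x | `]c, d[%classic x.2]).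
    by apply: openI; [apply: open_fst|apply: open_snd]; exact: interval_open.
  by apply/seteqP; split => x; rewrite /box /= !in_itv.
- exists (`|a| + `|b| + `|c| + `|d|) => x [/andP[h1 h2] /andP[h3 h4]].
  have := ler_norm b; have := ler_norm d; have := ler_norm (- a); have := ler_norm (- c).
  rewrite !normrN => *; have := normr_ge0 a; have := normr_ge0 b; have := normr_ge0 c.
  by have := normr_ge0 d; split; apply/andP; split; lra.
- move=> i y u v; case: (ord2P i) => -> /= [/andP[h1 h2] /andP[h3 h4]] [/andP[g1 g2] /andP[g3 g4]] w /andP[uw wv];
  by move: h1 h2 h3 h4 g1 g2 g3 g4; rewrite /box /pt /= => *; split; apply/andP; split; lra.
Qed.

Lemma open_halfplane (l : P -> R) : affine_fun l -> open [set x | 0 < l x].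
Proof.
move=> al; have cl := affine_fun_continuous al.
by apply: (@open_comp _ _ l [set t | 0 < t]) => [x _|]; [exact: cl|exact: open_gt].
Qed.

Lemma affine_fun_pt i (l : P -> R) a b c : (forall x, l x = a * x.1 + b * x.2 + c) ->
  forall x y, l (pt i x y) = (if i == 0 then a else b) * x + ((if i == 0 then b else a) * y + c).
Proof. by move=> lE x y; rewrite lE; case: (ord2P i) => ->; rewrite /pt /=; ring. Qed.

Lemma line_convex_halfplane (l : P -> R) : affine_fun l -> line_convex [set x | 0 < l x].
Proof.
move=> [a [b [c lE]]] i y u v /=; rewrite !(affine_fun_pt i lE).
set k := if _ then _ else _; set m := _ + c => hu hv w /andP[uw wv] /=.
rewrite (affine_fun_pt i lE) -/k -/m.
have [k0|k0] := leP 0 k.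
  by apply: lt_le_trans hu _; rewrite lerD2r ler_wpM2l.
by apply: lt_le_trans hv _; rewrite lerD2r ler_wnM2l // ltW.
Qed.

(** Only the end of the interval where [al * x + de] changes sign contributes, as [H] vanishes at
    the other one. That end is the left one for [al > 0] and the right one for [al < 0], whence the
    sign. *)
Lemma jump_slice (al de a b : R) (H dH : R -> R) : al != 0 -> continuous dH ->
  (forall x : R, is_derive x (1 : R) H (dH x)) -> (forall x, ~~ (a < x < b) -> H x = 0) ->
  (\int[lam]_(x in [set x | (a < x < b)%R /\ (0 < al * x + de)%R]) (dH x)%:E =
   (- Num.sg al * H (- de / al))%:E)%E.
Proof.
move=> al0 cdH DH H0; set c := - de / al.
have empty : forall S : set R, (forall x, ~ S x) -> H c = 0 ->
    (\int[lam]_(x in S) (dH x)%:E = (- Num.sg al * H c)%:E)%E.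
  move=> S S0 ->; rewrite mulr0 (_ : S = set0) ?integral_set0 //.
  by apply/seteqP; split => x // /S0.
have [alp|aln|/eqP] := ltgtP 0 al; last by rewrite eq_sym (negbTE al0).
- have lt_c x : (0 < al * x + de) = (c < x).
    by rewrite /c ltr_pdivrMr //; apply/idP/idP => ?; lra.
  (* Clipping the crossing point to [a] is harmless: [H] is zero at [a] and at every [c] to its
     left. *)
  have Hmax : H (Num.max a c) = H c.
    by case: (leP a c) => // ca; rewrite !H0 // ?ltxx // negb_and -!leNgt (ltW ca).
  have [mb|bm] := ltP (Num.max a c) b.
    rewrite (_ : [set x | _] = `]Num.max a c, b[%classic); last first.
      apply/seteqP; split => x; rewrite /= in_itv /= gt_max lt_c.
        by move=> [/andP[-> ->] ->].
      by move=> /andP[/andP[-> ->] ->].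
    rewrite (ftc_oo mb cdH DH) Hmax gtr0_sg // (H0 b) ?ltxx ?andbF //.
    by congr (_%:E); ring.
  apply: empty.
    move=> x [/andP[ax xb]]; rewrite lt_c => cx; move: bm; rewrite leNgt => /negP; apply.
    by rewrite gt_max (lt_trans ax xb) (lt_trans cx xb).
  by rewrite -Hmax H0 // negb_and -!leNgt bm orbT.
- have lt_c x : (0 < al * x + de) = (x < c).
    by rewrite /c ltr_ndivlMr //; apply/idP/idP => ?; lra.
  have Hmin : H (Num.min c b) = H c.
    by case: (leP c b) => // bc; rewrite !H0 // ?ltxx ?andbF // negb_and -!leNgt (ltW bc) orbT.
  have [am|ma] := ltP a (Num.min c b).
    rewrite (_ : [set x | _] = `]a, Num.min c b[%classic); last first.
      apply/seteqP; split => x; rewrite /= in_itv /= lt_min lt_c.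
        by move=> [/andP[-> ->] ->].
      by move=> /andP[-> /andP[-> ->]].
    rewrite (ftc_oo am cdH DH) Hmin ltr0_sg // (H0 a) ?ltxx //.
    by congr (_%:E); ring.
  apply: empty.
    move=> x [/andP[ax xb]]; rewrite lt_c => cx; move: ma; rewrite leNgt => /negP; apply.
    by rewrite lt_min (lt_trans ax cx) (lt_trans ax xb).
  by rewrite -Hmin H0 // negb_and -!leNgt ma.
Qed.

Lemma integral0_continuous (K : R -> R) : continuous K -> (forall y, 0 <= K y) ->
  (\int[lam]_y (K y)%:E = 0)%E -> forall y, K y = 0.
Proof.
move=> cK K0 IK y; apply/eqP/negPn/negP => Ky.
have mK : measurable_fun setT (EFin \o K).
  by apply/measurable_EFinP; exact: continuous_measurable_fun.
have : ae_eq lam setT (EFin \o K) (cst 0%E).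
  apply: (proj1 (@ae_eq_integral_abs _ _ R lam setT measurableT _ mK)).
  by rewrite -[RHS]IK; apply: eq_integral => x _; rewrite /= ger0_norm.
have oK : open [set t | 0 < K t].
  by apply: (@open_comp _ _ K [set t | 0 < t]) => [x _|]; [exact: cK|exact: open_gt].
have /(_ y) : [set t | 0 < K t] `<=` ([set t | 0 < K t])° by move: oK; rewrite openE.
rewrite /= lt_def Ky K0 => /(_ isT) /nbhs_ballP[e /= e0 eK].
move=> [A [mA A0 sA]].
have : (lam (ball y e) <= lam A)%E.
  apply: le_measure; rewrite ?inE //; first exact: measurable_ball.
  move=> t /eK /= Kt; apply: sA => /= h; have := h I; rewrite /= => -[] Kt0.
  by move: Kt; rewrite Kt0 ltxx.
rewrite A0 (lebesgue_measure_ball y (ltW e0)) lee_fin leNgt => /negP; apply.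
by rewrite pmulrn_lgt0.
Qed.

(* If p and p' differ at z0, integrating by parts against a bump supported where
   p - p' has constant sign leaves a nonzero integral of (p - p') phi over the line. *)
Lemma jump_zero Q i (u g l p p' : P -> R) (a b c : R) j (B : set P) :
  domain Q -> L2 Q u -> weak_partial Q i u g ->
  (forall x, l x = a * x.1 + b * x.2 + c) -> (if i == 0 then a else b) != 0 ->
  open B -> B `<=` Q -> polyfun j p -> polyfun j p' ->
  ae_eq_in (B `&` [set x | 0 < l x]) u p ->
  ae_eq_in (B `&` [set x | l x < 0]) u p' ->
  ae_eq_in (B `&` [set x | 0 < l x]) g (partial i p) ->
  ae_eq_in (B `&` [set x | l x < 0]) g (partial i p') ->
  forall z0, B z0 -> l z0 = 0 -> p z0 = p' z0.
Proof.
move=> dQ Lu [Lg wg] lE; set al := (if _ then _ else _) => al0 oB BQ pp pp' up up' gp gp' z0 Bz0 lz0.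
have al_l : affine_fun l by exists a, b, c.
apply/eqP; rewrite -subr_eq0; apply/negPn/negP => rz0.
pose r x := p x - p' x; have pr : polyfun j r by exact: polyfunB.
have pdr := polyfun_partial i (polyfun_leq (leqnSn j) pr).
have pdp' := polyfun_partial i (polyfun_leq (leqnSn j) pp').
have cr := polyfun_continuous pr.
have drE x : partial i r x = partial i p x - partial i p' x.
  by case: (is_deriveB (polyfun_is_derive i pp x) (polyfun_is_derive i pp' x)).
(* The part of [B] where [r] has the sign it takes at [z0]. *)
have oU : open (B `&` [set x | 0 < Num.sg (r z0) * r x]).
  apply: openI => //; apply: (@open_comp _ _ (fun x => Num.sg (r z0) * r x) [set t | 0 < t]); last exact: open_gt.
  by move=> x _; apply: cvgM; [exact: cvg_cst|exact: cr].
have Uz0 : (B `&` [set x | 0 < Num.sg (r z0) * r x]) z0.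
  by split => //=; rewrite -normrEsg normr_gt0.
have [e e0 eU] := open_box_nbhs oU Uz0.
pose bx (t : R) := box (z0.1 - t) (z0.1 + t) (z0.2 - t) (z0.2 + t).
pose B1 := bx e; have dB1 : domain B1 by exact: domain_box.
have B1U x : B1 x -> B x /\ 0 < Num.sg (r z0) * r x.
  by move=> [/andP[? ?] /andP[? ?]]; apply: eU; rewrite ltr_norml; apply/andP; split; lra.
have B1Q : B1 `<=` Q by move=> x /B1U[/BQ].
have mB1 := domain_measurable dB1; have mQ := domain_measurable dQ.
pose Op := B1 `&` [set x | 0 < l x].
have dOp : domain Op by apply: domainI => //; [exact: open_halfplane|exact: line_convex_halfplane].
have mOp := domain_measurable dOp.
have OpB1 : Op `<=` B1 by move=> x [].
(* Half the side length puts the closed box supporting [phi] inside the open box [B1]. *)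
pose phi := bump 0 (z0.1 - e/2) (z0.1 + e/2) (z0.2 - e/2) (z0.2 + e/2).
have tphi : test_function B1 phi.
  by apply: test_function_bump => x [/andP[? ?] /andP[? ?]]; split; apply/andP; split; lra.
have cphi := test_continuous tphi; have cdphi := test_partial_continuous tphi (i := i).
have cover : mu.-negligible [set x | l x = 0].
  rewrite (_ : [set x | _] = [set x | a * x.1 + b * x.2 + c = 0]); last first.
    by apply/seteqP; split => x /=; rewrite lE.
  apply: null_line; move: al0; rewrite /al; apply: contraTneq => -[-> ->].
  by rewrite if_same negbK.
(* Off the null line [l = 0], [f] is [q'] plus the difference [q - q'] cut off to the side
   [0 < l]. *)
have glue f q q' : ae_eq_in (B `&` [set x | 0 < l x]) f q -> ae_eq_in (B `&` [set x | l x < 0]) f q' ->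
    ae_eq_in B1 f (fun x => q' x + piece Op (fun x => q x - q' x) x).
  move=> fq fq'; apply: negligibleS (negligibleU cover (negligibleU fq fq')) => x /= nfx.
  apply: contrapT => /not_orP[lx /not_orP[/contrapT e1 /contrapT e2]]; apply: nfx => B1x.
  have [Bx _] := B1U x B1x; rewrite /piece indicE.
  have [lt0|gt0|eq0] := ltgtP (l x) 0; last by case: lx.
    by rewrite e2 // memNset ?mulr0 ?addr0 // => -[_ /=]; rewrite ltNge (ltW lt0).
  by rewrite e1 // mem_set // mulr1 addrC subrK.
have split_int f q q' psi : measurable_fun Q f -> polyfun j q -> polyfun j q' ->
    ae_eq_in B1 f (fun x => q' x + piece Op q x) -> continuous psi ->
    (forall x, ~ B1 x -> psi x = 0) ->
    \int[mu]_(x in Q) (f x * psi x) =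
    \int[mu]_(x in B1) (q' x * psi x) + \int[mu]_(x in Op) (q x * psi x).
  move=> mf pq pq' fE cpsi psi0.
  rewrite (Rintegral_sub mQ mB1 B1Q) => [|x _ nB]; last by rewrite psi0 ?mulr0.
  have mpsi : measurable_fun B1 psi by exact: continuous_measurable.
  have mq' : measurable_fun B1 q' by apply: continuous_measurable; exact: polyfun_continuous pq'.
  have mpc : measurable_fun B1 (piece Op q) by exact: measurable_piece pq.
  have Lq' : L2 B1 q'.
    have [M bM] := continuous_bounded (let: And3 _ h _ := dB1 in h) (polyfun_continuous pq').
    by apply: (L2_ae_bounded dB1 (M := M)) => //; apply: aeW.
  have Lpc : L2 B1 (piece Op q) by exact: L2_piece pq.
  rewrite (@Rintegral_ae _ B1 _ (fun x => q' x * psi x + piece Op q x * psi x)) //.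
  - rewrite RintegralD //; [|by apply: integrable_mulr => //; exact: L2_integrable..].
    congr (_ + _); rewrite (Rintegral_sub mB1 mOp OpB1) => [|x _ nO].
      by apply: eq_Rintegral => x; rewrite inE /piece indicE => Ox; rewrite mem_set // mulr1.
    by rewrite /piece indicE memNset // mulr0 mul0r.
  - by apply: measurable_funM => //; exact: measurable_funS mf.
  - by apply: measurable_funD; exact: measurable_funM.
  - apply: (ae_eq_in_trans (ae_eq_in_op2 (fun a b => a * b) fE (ae_eq_in_refl (fun x _ => erefl (psi x))))).
    by apply: ae_eq_in_refl => x _; rewrite mulrDl.
(* The terms in [p'] cancel by integration by parts over the whole box, which leaves only the jump
   on one side of the line. *)
have main : \int[mu]_(x in Op) (r x * partial i phi x) + \int[mu]_(x in Op) (partial i r x * phi x) = 0.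
  have [mu_ _] := Lu; have [mg_ _] := Lg.
  have h1 := split_int u r p' (partial i phi) mu_ pr pp' (glue u p p' up up') cdphi (test_partial_out tphi i).
  have gE : ae_eq_in B1 g (fun x => partial i p' x + piece Op (partial i r) x).
    apply: (ae_eq_in_trans (glue g _ _ gp gp')); apply: ae_eq_in_refl => x _.
    by rewrite /piece drE.
  have h2 := split_int g _ _ phi mg_ pdr pdp' gE cphi (test_out tphi).
  have := wg phi (test_functionS B1Q tphi); rewrite h1 h2.
  rewrite (integral_partialM i dB1 pp' tphi) => [h|x Ox _ /(_ Ox) //].
  by move: h; set A := \int[mu]_(x in B1) _; set C := \int[mu]_(x in Op) _;
    set D := \int[mu]_(x in Op) _; lra.
(* The first factor cancels the sign coming from [jump_slice]; the second makes [K] below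
   nonnegative. *)
pose k : R := - Num.sg al * Num.sg (r z0).
pose H x : R := k * (r x * phi x); pose dH x : R := k * (r x * partial i phi x + partial i r x * phi x).
have c1 : continuous (fun x => r x * partial i phi x).
  by move=> x; apply: continuousM; [exact: cr|exact: cdphi].
have c2 : continuous (fun x => partial i r x * phi x).
  by move=> x; apply: continuousM; [exact: (polyfun_continuous pdr)|exact: cphi].
have [_ bOp _] := dOp.
have c3 : continuous (fun x => r x * partial i phi x + partial i r x * phi x).
  by move=> x; exact: (cvgD (c1 x) (c2 x)).
have cdH : continuous dH by move=> x; apply: cvgMl_tmp; exact: c3.
have DH x : is_derive x (dir i) H (dH x).
  have D := is_deriveM (polyfun_is_derive i pr x) (test_is_derive tphi i x).
  apply: (is_derive_eq (is_deriveZ k D)); rewrite !scaleRE /dH.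
  by congr (_ * (_ + _)); rewrite mulrC.
have IdH : \int[mu]_(x in Op) dH x = 0.
  rewrite RintegralZl //; last exact: continuous_integrable.
  by rewrite RintegralD //; [rewrite main mulr0|exact: continuous_integrable..].
pose m := if i == 0 then b else a.
pose de y := m * y + c.
(* The signed jump times [phi] at the point where the slice with transversal coordinate [y] meets
   the line. By Fubini its integral is that of [dH] over [Op], hence zero. *)
pose K y : R := Num.sg (r z0) * (r (pt i (- de y / al) y) * phi (pt i (- de y / al) y)).
pose zi := crd i z0; pose zo := crd (1 - i) z0.
have bx_pt t x y : bx t (pt i x y) <-> zi - t < x < zi + t /\ zo - t < y < zo + t.
  by rewrite /bx /box /zi /zo; case: (ord2P i) => ->; rewrite /pt /crd /=; split => -[].
have bxS : bx (e / 2) `<=` bx e.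
  by move=> x [/andP[? ?] /andP[? ?]]; split; apply/andP; split; lra.
have lpt x y : l (pt i x y) = al * x + de y by exact: (affine_fun_pt i lE).
have K0 y : 0 <= K y.
  rewrite /K mulrA; set w := pt i _ _.
  have [Bw|nB] := pselect (bx (e/2) w); last by rewrite /phi bump_out ?mulr0.
  have [_ w0] := B1U w (bxS w Bw).
  by rewrite mulr_ge0 ?(ltW w0) //; case/andP: (bump_itv 0 (z0.1 - e/2) (z0.1 + e/2) (z0.2 - e/2) (z0.2 + e/2) w).
have cK : continuous K.
  have cpt : continuous (fun y : R => pt i (- de y / al) y).
    have cde : continuous (fun y : R => - de y / al).
      by move=> y; apply: cvgMr_tmp; apply: cvgN; apply: cvgD; [apply: cvgMl_tmp; exact: cvg_id|exact: cvg_cst].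
    move=> y; case: (ord2P i) => E; rewrite /pt E /=.
      by apply: (@cvg_pair _ _ _ _ (nbhs (- de y / al)) (nbhs y) _ _ _ (fun y => - de y / al) id); [exact: cde|exact: cvg_id].
    by apply: (@cvg_pair _ _ _ _ (nbhs y) (nbhs (- de y / al)) _ _ _ id (fun y => - de y / al)); [exact: cvg_id|exact: cde].
  move=> y; apply: cvgMl_tmp; apply: cvgM.
    by apply: (continuous_comp (cpt y)); exact: cr.
  by apply: (continuous_comp (cpt y)); exact: cphi.
have IK : (\int[lam]_y (K y)%:E = 0)%E.
  have iO : mu.-integrable Op (EFin \o dH) by exact: continuous_integrable.
  have : (\int[mu]_(x in Op) (dH x)%:E = 0)%E.
    apply/eqP; rewrite -fine_eq0; last exact: integrable_fin_num.
    by apply/eqP.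
  rewrite (iterated_integral i) // => h; rewrite -[RHS]h; apply: eq_integral => y _.
  have KE : K y = - Num.sg al * H (pt i (- de y / al) y).
    have sg2 : Num.sg al * Num.sg al = 1 by rewrite -expr2 sqr_sg al0.
    rewrite /K /H /k; set X := (_ * phi _).
    transitivity ((Num.sg al * Num.sg al) * (Num.sg (r z0) * X)); last ring.
    by rewrite sg2 mul1r.
  have [yin|yout] := boolP (zo - e < y < zo + e); last first.
    rewrite (_ : [set x | _] = set0); last first.
      by apply/seteqP; split => x // [/bx_pt[_ h']]; rewrite h' in yout.
    rewrite integral_set0 KE /H /phi bump_out ?mulr0 // => /bxS/bx_pt[_ h'].
    by rewrite h' in yout.
  have DHy (x : R) : is_derive x (1 : R) (fun t => H (pt i t y)) (dH (pt i x y)).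
    by apply/is_derive_ptP.
  have Hout x : ~~ (zi - e < x < zi + e) -> H (pt i x y) = 0.
    by move=> hx; rewrite /H /phi bump_out ?mulr0 // => /bxS/bx_pt[h' _]; rewrite h' in hx.
  have := jump_slice (de y) al0 (continuous_slice (i := i) (y := y) cdH) DHy Hout.
  rewrite -KE => <-; rewrite (_ : [set x | Op (pt i x y)] =
    [set x | (zi - e < x < zi + e)%R /\ (0 < al * x + de y)%R]) //.
  apply/seteqP; split => x; first by move=> [/bx_pt[hx _]]; rewrite /= lpt.
  by move=> [hx lx]; split; [apply/bx_pt|rewrite /= lpt].
(* The slice through [z0] meets the line at [z0] itself, where [K] has the positive value
   [|r z0| * phi z0]: a contradiction. *)
have := integral0_continuous cK K0 IK zo.
have -> : K zo = `|r z0| * phi z0.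
  have zE : - de zo / al = zi.
    have := lpt zi zo; rewrite ptK lz0 => /esym/eqP; rewrite addr_eq0 => /eqP E.
    by rewrite -E mulrC mulKf.
  by rewrite /K zE ptK mulrA -normrEsg.
move=> /eqP; rewrite mulf_eq0 normr_eq0 (negbTE rz0) /= gt_eqF //.
by apply: bump_gt0; split; apply/andP; split; lra.
Qed.

End Jump.

(** * Geometry of convex quadrilaterals *)

Section QuadGeometry.
Context {R : realType}.
Local Notation P := (plane R).
Implicit Types (v : 'I_4 -> P).

Lemma ord4P (m : 'I_4) : [\/ m = 0, m = 1, m = 2 | m = 3].
Proof.
by case: m => -[|[|[|[|//]]]] ?; [constructor 1|constructor 2|constructor 3|constructor 4];
  exact: val_inj.
Qed.

Lemma ord4_11 : 1 + 1 = 2 :> 'I_4. Proof. exact: val_inj. Qed.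
Lemma ord4_21 : 2 + 1 = 3 :> 'I_4. Proof. exact: val_inj. Qed.
Lemma ord4_31 : 3 + 1 = 0 :> 'I_4. Proof. exact: val_inj. Qed.
Lemma ord4_12 : 1 + 2 = 3 :> 'I_4. Proof. exact: val_inj. Qed.
Lemma ord4_13 : 1 + 3 = 0 :> 'I_4. Proof. exact: val_inj. Qed.
Definition ord4E := (ord4_11, ord4_21, ord4_31, ord4_12, ord4_13, add0r).

Lemma sum_ord4 (V : nmodType) (F : 'I_4 -> V) : \sum_i F i = F 0 + F 1 + F 2 + F 3.
Proof.
rewrite !big_ord_recl big_ord0 addr0 !addrA.
by congr (F _ + F _ + F _ + F _); exact: val_inj.
Qed.

(** The diagonals serve as axes: [e1] and [e2] are the half-diagonals towards [v 0] and [v 1], and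
    positivity of [lam] and [mu] says that [z] lies strictly between opposite vertices. *)
Record quad_frame v (z e1 e2 : P) (lam mu : R) : Prop := QuadFrame {
  frame_det : cross e1 e2 != 0;
  frame_lam : 0 < lam;
  frame_mu : 0 < mu;
  frame_v0 : v 0 = z + e1;
  frame_v1 : v 1 = z + e2;
  frame_v2 : v 2 = z - lam *: e1;
  frame_v3 : v 3 = z - mu *: e2 }.

Lemma diagonal_vertex (A C z : P) (a : R) : z = (1 - a) *: A + a *: C -> a != 0 ->
  A = z + (A - z) /\ C = z - ((1 - a) / a) *: (A - z).
Proof.
move=> zE a0; split; first by rewrite addrC subrK.
by rewrite zE; case: A C zE => [A1 A2] [C1 C2] _; apply: plane_eq; rewrite /= !scaleRE; field.
Qed.

Lemma cross_diagonal (A C z : P) (a : R) : z = (1 - a) *: A + a *: C -> cross (A - z) (C - z) = 0.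
Proof.
by move=> ->; case: A C => [A1 A2] [C1 C2]; rewrite /cross /= !scaleRE; ring.
Qed.

(** If [z = (1 - a) v 0 + a v 2], the ratio of the half-diagonals is [(1 - a) / a]. The values 0 and
    1 of [a] and [b] are excluded because [z] would be a vertex lying on the other diagonal, making
    three vertices collinear. *)
Lemma convex_quad_frame v : convex_quad v ->
  exists lam mu, quad_frame v (quad_center v) (v 0 - quad_center v) (v 1 - quad_center v) lam mu.
Proof.
move=> cv; have [[a]] := center_diagonals cv; rewrite /= in_itv /= => /andP[a0 a1] aE.
move=> [b]; rewrite /= in_itv /= => /andP[b0 b1] bE.
move: aE bE; set z := quad_center v => aE bE.
have n0 i : cross (v (i + 1) - v i) (v (i + 2) - v i) != 0 /\
            cross (v (i + 1) - v i) (v (i + 3) - v i) != 0.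
  by have := cv i; split; apply/eqP => h; have := cv i; rewrite h ?mul0r ?mulr0 ltxx.
have [n012 n013] := n0 0; have [n123 _] := n0 1; rewrite !ord4E in n012 n013 n123.
have c02 := cross_diagonal (esym aE); have c13 := cross_diagonal (esym bE).
have crossN (x y w : P) : cross (x - w) (y - w) = cross (y - x) (w - x).
  by case: x y w => [? ?] [? ?] [? ?]; rewrite /cross /=; ring.
have za : a != 0.
  apply: contra n013 => /eqP a00; move: c13.
  have -> : z = v 0 by rewrite -aE a00 subr0 scale1r scale0r addr0.
  by move=> ->.
have za1 : a != 1.
  apply: contra n123 => /eqP a00; move: c13.
  have -> : z = v 2 by rewrite -aE a00 subrr scale0r scale1r add0r.
  by move=> h; apply/eqP; rewrite -[RHS]oppr0 -h /cross /=; ring.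
have zb : b != 0.
  apply: contra n012 => /eqP a00; move: c02.
  have -> : z = v 1 by rewrite -bE a00 subr0 scale1r scale0r addr0.
  by move=> h; apply/eqP; rewrite -[RHS]oppr0 -h /cross /=; ring.
have zb1 : b != 1.
  have n023 : cross (v 2 - v 0) (v 3 - v 0) != 0.
    have [_ h] := n0 2; move: h; rewrite (_ : 2 + 3 = 1 :> 'I_4) ?ord4E; last exact: val_inj.
    have [h' _] := n0 2; move: h'; rewrite (_ : 2 + 2 = 0 :> 'I_4) ?ord4E; last exact: val_inj.
    by move=> h _; apply: contra h => /eqP h; apply/eqP; rewrite -h /cross /=; ring.
  apply: contra n023 => /eqP a00; move: c02.
  have -> : z = v 3 by rewrite -bE a00 subrr scale0r scale1r add0r.
  by move=> h; apply/eqP; rewrite -h /cross /=; ring.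
have [v0E v2E] := diagonal_vertex (esym aE) za; have [v1E v3E] := diagonal_vertex (esym bE) zb.
exists ((1 - a) / a), ((1 - b) / b); split => //.
- apply: contra n012 => /eqP h.
  have -> : cross (v 1 - v 0) (v 2 - v 0) = (1 + (1 - a) / a) * cross (v 0 - z) (v 1 - z).
    by rewrite v2E /cross /= !scaleRE; ring.
  by rewrite h mulr0.
- by rewrite divr_gt0 // ?subr_gt0 lt_neqAle ?za1 // eq_sym za.
- by rewrite divr_gt0 // ?subr_gt0 lt_neqAle ?zb1 // eq_sym zb.
Qed.

Lemma convex_vref : convex_quad (@vref R).
Proof. by case=> -[|[|[|[|//]]]] ? ; rewrite /vref /cross /=; lra. Qed.

Lemma triE v (m : 'I_4) : tri v m = [set x | exists a b : R,
  [/\ 0 < a, 0 < b, a + b < 1 &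
      x = quad_center v + a *: (v m - quad_center v) + b *: (v (m + 1) - quad_center v)]].
Proof.
apply/seteqP; split => x /=.
  move=> [l [l0]]; rewrite !big_ord_recl !big_ord0 /= => l1 ->.
  exists (l (lift ord0 ord0)), (l (lift ord0 (lift ord0 ord0))).
  move: (l0 ord0) (l0 (lift ord0 ord0)) (l0 (lift ord0 (lift ord0 ord0))) l1 => p0 p1 p2 l1.
  split => //; first lra.
  have -> : l ord0 = 1 - l (lift ord0 ord0) - l (lift ord0 (lift ord0 ord0)) by lra.
  by apply: plane_eq; rewrite /= !scaleRE; ring.
move=> [a [b [a0 b0 ab ->]]].
exists (fun i => nth 0 [:: 1 - a - b; a; b] i); split.
- by case=> -[|[|[|//]]] ? //=; lra.
- by rewrite !big_ord_recl !big_ord0 /=; lra.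
- by rewrite !big_ord_recl !big_ord0 /=; apply: plane_eq; rewrite /= !scaleRE; ring.
Qed.

(** With [a = s / lam] and [b = t / mu] in mind: under the sign conditions the left side is the sum
    of max(s, -a) and max(t, -b), which is below 1 iff all four choices of arguments give a sum
    below 1. *)
Lemma four_halfplanes (s t a b : R) :
  (0 <= s /\ 0 <= a) \/ (s < 0 /\ a < 0) -> (0 <= t /\ 0 <= b) \/ (t < 0 /\ b < 0) ->
  (if 0 <= s then s else - a) + (if 0 <= t then t else - b) < 1 <->
  [/\ 0 < 1 - s - t, 0 < 1 + a - t, 0 < 1 + a + b & 0 < 1 - s + b].
Proof.
move=> [[s0 a0]|[s0 a0]] [[t0 b0]|[t0 b0]]; rewrite ?s0 ?t0 ?(lt_geF s0) ?(lt_geF t0);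
by split=> [?|[*]]; [split; lra|lra].
Qed.

Section Framed.
Variables (v : 'I_4 -> P) (z e1 e2 : P) (lam mu : R).
Hypothesis fr : quad_frame v z e1 e2 lam mu.
Hypothesis zE : quad_center v = z.
Let De := frame_det fr.
Let l0 := frame_lam fr.
Let m0 := frame_mu fr.
Local Notation s := (crd_s z e1 e2).
Local Notation t := (crd_t z e1 e2).

Definition pos_part (x : R) : R := Num.max 0 x.

Lemma pos_partK (x : R) : 0 <= x -> pos_part x = x.
Proof. by move=> x0; exact/max_idPr. Qed.

Lemma pos_part0 (x : R) : x <= 0 -> pos_part x = 0.
Proof. by move=> x0; exact/max_idPl. Qed.

Lemma pos_part_ge0 (x : R) : 0 <= pos_part x.
Proof. by rewrite le_max lexx. Qed.

(* Coordinates of x with respect to the four half-diagonals, nonnegative and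
   with at most two consecutive ones nonzero. *)
Definition cone_crd (m : 'I_4) (x : P) : R :=
  nth 0 [:: pos_part (s x); pos_part (t x); pos_part (- s x) / lam; pos_part (- t x) / mu] m.

Lemma cone_crd_ge0 m x : 0 <= cone_crd m x.
Proof.
by case: (ord4P m) => ->; rewrite /cone_crd /= ?divr_ge0 ?pos_part_ge0 // ltW.
Qed.

Lemma cone_crdK x : z + \sum_m cone_crd m x *: (v m - z) = x.
Proof.
have pp (y : R) : pos_part y - pos_part (- y) = y.
  have [y0|y0] := leP 0 y; first by rewrite pos_partK // pos_part0 ?subr0 // oppr_le0.
  by rewrite pos_part0 ?(ltW y0) // pos_partK ?oppr_ge0 ?(ltW y0) // sub0r opprK.
rewrite sum_ord4 (frame_v0 fr) (frame_v1 fr) (frame_v2 fr) (frame_v3 fr) /cone_crd /=.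
rewrite -[RHS](crd_stK z De) -{3}(pp (s x)) -{3}(pp (t x)).
have ln0 : lam != 0 by rewrite gt_eqF. have mn0 : mu != 0 by rewrite gt_eqF.
by apply: plane_eq; rewrite /= !scaleRE; field; rewrite ln0 mn0.
Qed.

(** The oblique coordinates of the point are [r 0 - lam * r 2] and [r 1 - mu * r 3]. When one term
    of each difference is zero, the positive and negative parts recover all four numbers. *)
Lemma cone_crd_unique (r : 'I_4 -> R) : (forall m, 0 <= r m) -> r 0 * r 2 = 0 -> r 1 * r 3 = 0 ->
  forall m, cone_crd m (z + \sum_m r m *: (v m - z)) = r m.
Proof.
move=> r0 r02 r13.
have ln0 : lam != 0 by rewrite gt_eqF. have mn0 : mu != 0 by rewrite gt_eqF.
have -> : z + \sum_m r m *: (v m - z) = z + (r 0 - lam * r 2) *: e1 + (r 1 - mu * r 3) *: e2.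
  rewrite sum_ord4 (frame_v0 fr) (frame_v1 fr) (frame_v2 fr) (frame_v3 fr).
  by apply: plane_eq; rewrite /= !scaleRE; ring.
have pp (a b k : R) : 0 < k -> 0 <= a -> 0 <= b -> a * b = 0 ->
    pos_part (a - k * b) = a /\ pos_part (- (a - k * b)) / k = b.
  move=> k0 a0 b0 /eqP; rewrite mulf_eq0 => /orP[/eqP ->|/eqP ->].
    rewrite sub0r opprK pos_part0 ?oppr_le0 ?mulr_ge0 ?(ltW k0) // pos_partK ?mulr_ge0 ?(ltW k0) //.
    by rewrite mulrC mulKf ?gt_eqF.
  by rewrite mulr0 subr0 pos_partK // pos_part0 ?oppr_le0 // mul0r.
have [h0 h2] := pp _ _ _ l0 (r0 0) (r0 2) r02; have [h1 h3] := pp _ _ _ m0 (r0 1) (r0 3) r13.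
set X := z + _ + _.
have sX : s X = r 0 - lam * r 2 by exact: crd_sP.
have tX : t X = r 1 - mu * r 3 by exact: crd_tP.
by move=> m; case: (ord4P m) => ->; rewrite /cone_crd /= ?sX ?tX.
Qed.

Lemma cone_crd02 x : cone_crd 0 x * cone_crd 2 x = 0.
Proof.
rewrite /cone_crd /=; have [y0|y0] := leP 0 (s x); last by rewrite pos_part0 ?mul0r ?(ltW y0).
by rewrite [X in _ * (X / _)]pos_part0 ?mul0r ?mulr0 // oppr_le0.
Qed.

Lemma cone_crd13 x : cone_crd 1 x * cone_crd 3 x = 0.
Proof.
rewrite /cone_crd /=; have [y0|y0] := leP 0 (t x); last by rewrite pos_part0 ?mul0r ?(ltW y0).
by rewrite [X in _ * (X / _)]pos_part0 ?mul0r ?mulr0 // oppr_le0.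
Qed.

Lemma sum_cone_crd x : \sum_m cone_crd m x =
  (if 0 <= s x then s x else - (s x / lam)) + (if 0 <= t x then t x else - (t x / mu)).
Proof.
rewrite sum_ord4 /cone_crd /= addrAC -[RHS]addr0 -addrA addrACA -addrA.
have pc (y k : R) : pos_part y + pos_part (- y) / k = if 0 <= y then y else - (y / k).
  have [y0|y0] := leP 0 y; first by rewrite pos_partK // pos_part0 ?oppr_le0 // mul0r addr0.
  by rewrite pos_part0 ?(ltW y0) // pos_partK ?oppr_ge0 ?(ltW y0) // add0r mulNr.
by rewrite -!pc addr0; ring.
Qed.

Lemma cone_halfplanes x : \sum_m cone_crd m x < 1 <-> [/\ 0 < 1 - s x - t x,
  0 < 1 + s x / lam - t x, 0 < 1 + s x / lam + t x / mu & 0 < 1 - s x + t x / mu].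
Proof.
have sgn (y k : R) : 0 < k -> (0 <= y /\ 0 <= y / k) \/ (y < 0 /\ y / k < 0).
  move=> k0; have [y0|y0] := leP 0 y; [left|right]; split => //.
    by rewrite divr_ge0 // ltW.
  by rewrite pmulr_llt0 ?invr_gt0.
by rewrite sum_cone_crd; apply: four_halfplanes; exact: sgn.
Qed.

(** The sum of the cone coordinates is the gauge of the quadrilateral about [z]. In the reverse
    direction these coordinates give nonnegative weights of total less than 1, and the slack is used
    to make all vertex weights positive. *)
Lemma quad_halfplanes : quad v = [set x | [/\ 0 < 1 - s x - t x, 0 < 1 + s x / lam - t x,
  0 < 1 + s x / lam + t x / mu & 0 < 1 - s x + t x / mu]].
Proof.
have ln0 : lam != 0 by rewrite gt_eqF. have mn0 : mu != 0 by rewrite gt_eqF.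
apply/seteqP; split => x /=.
  move=> [l [lp]]; rewrite !sum_ord4 => l1 xE.
  have := lp 0; have := lp 1; have := lp 2; have := lp 3; move: l1 xE.
  move: (l 0) (l 1) (l 2) (l 3) => a b c d abcd xE d0 c0 b0 a0.
  have {}xE : x = z + (a - lam * c) *: e1 + (b - mu * d) *: e2.
    have dE : d = 1 - a - b - c by lra.
    rewrite xE (frame_v0 fr) (frame_v1 fr) (frame_v2 fr) (frame_v3 fr) dE.
    by apply: plane_eq; rewrite /= !scaleRE; ring.
  have lc := mulr_gt0 l0 c0; have md := mulr_gt0 m0 d0.
  have al := divr_gt0 a0 l0; have bm := divr_gt0 b0 m0.
  have sX : s x = a - lam * c by rewrite xE crd_sP.
  have tX : t x = b - mu * d by rewrite xE crd_tP.
  have sl : s x / lam = a / lam - c by rewrite sX; field.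
  have tm : t x / mu = b / mu - d by rewrite tX; field.
  by rewrite sl tm sX tX; split; lra.
move=> /cone_halfplanes; set N := \sum_m _ => N1.
(* Half of the slack goes to each pair of opposite vertices, in the proportions [lam : 1] and
   [mu : 1]. Within a pair the displacements from [z] cancel, so the point does not move. *)
pose d1 := (1 - N) / 2 / (1 + lam); pose d2 := (1 - N) / 2 / (1 + mu).
have N0 : 0 < (1 - N) / 2 by lra.
have d1p : 0 < d1 by rewrite divr_gt0 // addr_gt0.
have d2p : 0 < d2 by rewrite divr_gt0 // addr_gt0.
have e1' : d1 + lam * d1 = (1 - N) / 2 by rewrite /d1; field; rewrite gt_eqF // addr_gt0.
have e2' : d2 + mu * d2 = (1 - N) / 2 by rewrite /d2; field; rewrite gt_eqF // addr_gt0.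
exists (fun m => cone_crd m x + nth 0 [:: lam * d1; mu * d2; d1; d2] m); split.
- move=> m; apply: ltr_wpDl; first exact: cone_crd_ge0.
  by case: (ord4P m) => -> //=; rewrite mulr_gt0.
- by rewrite big_split /= -/N sum_ord4 /=; lra.
- rewrite -[LHS]cone_crdK !sum_ord4 /=.
  have N1' : cone_crd 0 x = 1 - cone_crd 1 x - cone_crd 2 x - cone_crd 3 x - d1 - lam * d1 - d2 - mu * d2.
    have NE : N = cone_crd 0 x + cone_crd 1 x + cone_crd 2 x + cone_crd 3 x by exact: sum_ord4.
    have -> : cone_crd 0 x = N - cone_crd 1 x - cone_crd 2 x - cone_crd 3 x by rewrite NE; ring.
    have N1E : N = 1 - (d1 + lam * d1) - (d2 + mu * d2) by rewrite e1' e2'; field.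
    by rewrite {1}N1E; ring.
  rewrite (frame_v0 fr) (frame_v1 fr) (frame_v2 fr) (frame_v3 fr) N1'.
  by apply: plane_eq; rewrite /= !scaleRE; ring.
Qed.

Lemma quad_cone_crd x : quad v x <-> \sum_m cone_crd m x < 1.
Proof. by rewrite quad_halfplanes cone_halfplanes. Qed.

Lemma domain_quad : domain (quad v).
Proof.
have as_ := affine_crd_s z e1 e2; have at_ := affine_crd_t z e1 e2.
have aff a b : affine_fun (fun x => 1 + a * s x + b * t x).
  have [a1 [b1 [c1 E1]]] := as_; have [a2 [b2 [c2 E2]]] := at_.
  exists (a * a1 + b * a2), (a * b1 + b * b2), (1 + a * c1 + b * c2) => x.
  by rewrite E1 E2; ring.
pose H a b := [set x | 0 < 1 + a * s x + b * t x].
have HE : quad v = H (-1) (-1) `&` (H lam^-1 (-1) `&` (H lam^-1 mu^-1 `&` H (-1) mu^-1)).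
  rewrite quad_halfplanes; apply/seteqP; split => x; rewrite /H /= !mulN1r ![_^-1 * _]mulrC.
    by move=> [].
  by move=> [? [? [? ?]]].
have oH a b : open (H a b) by exact: open_halfplane.
have cH a b : line_convex (H a b) by exact: line_convex_halfplane.
have lcI (A B : set P) : line_convex A -> line_convex B -> line_convex (A `&` B).
  by move=> cA cB i y p q [Ap Bp] [Aq Bq] w pwq; split; [exact: (cA i y p q)|exact: (cB i y p q)].
split.
- by rewrite HE; do !apply: openI.
- exists (\sum_i (`|(v i).1| + `|(v i).2|)) => x [l [lp l1 ->]].
  have lle i : 0 <= l i <= 1.
    rewrite ltW //= -l1 (bigD1 i) //= lerDl; apply: sumr_ge0 => j _; exact: ltW.
  have b1 : `|(\sum_i l i *: v i).1| <= \sum_i (`|(v i).1| + `|(v i).2|).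
    rewrite sum_ord4 /= !scaleRE sum_ord4.
    have h i : `|l i * (v i).1| <= `|(v i).1| + `|(v i).2|.
      rewrite normrM; case/andP: (lle i) => li0 li1; rewrite ger0_norm //.
      by apply: le_trans (_ : `|(v i).1| <= _); [rewrite ler_piMl|rewrite lerDl].
    by do 3!(apply: le_trans (ler_normD _ _) _; apply: lerD => //).
  have b2 : `|(\sum_i l i *: v i).2| <= \sum_i (`|(v i).1| + `|(v i).2|).
    rewrite sum_ord4 /= !scaleRE sum_ord4.
    have h i : `|l i * (v i).2| <= `|(v i).1| + `|(v i).2|.
      rewrite normrM; case/andP: (lle i) => li0 li1; rewrite ger0_norm //.
      by apply: le_trans (_ : `|(v i).2| <= _); [rewrite ler_piMl|rewrite lerDr].
    by do 3!(apply: le_trans (ler_normD _ _) _; apply: lerD => //).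
  by split; rewrite -ler_norml.
- by rewrite HE; exact: (lcI _ _ (cH _ _) (lcI _ _ (cH _ _) (lcI _ _ (cH _ _) (cH _ _)))).
Qed.

Definition sgn_s (m : 'I_4) : R := nth 0 [:: 1; -1; -1; 1] m.
Definition sgn_t (m : 'I_4) : R := nth 0 [:: 1; 1; -1; -1] m.

Lemma tri_cone_crd m x : tri v m x <-> [/\ 0 < cone_crd m x, 0 < cone_crd (m + 1) x & quad v x].
Proof.
rewrite triE zE; split.
  move=> [a [b [a0 b0 ab xE]]].
  pose r i := if i == m then a else if i == m + 1 then b else 0.
  have rE : x = z + \sum_i r i *: (v i - z).
    rewrite xE -addrA; congr (z + _); rewrite sum_ord4 /r.
    by case: (ord4P m) => ->; rewrite ?ord4E /= ?scale0r ?addr0 ?add0r // addrC.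
  have r0 i : 0 <= r i by rewrite /r; case: ifP => _; [exact: ltW|case: ifP => _ //; exact: ltW].
  have r02 : r 0 * r 2 = 0 by rewrite /r; case: (ord4P m) => ->; rewrite ?ord4E /= ?mulr0 ?mul0r.
  have r13 : r 1 * r 3 = 0 by rewrite /r; case: (ord4P m) => ->; rewrite ?ord4E /= ?mulr0 ?mul0r.
  have cE i : cone_crd i x = r i by rewrite rE cone_crd_unique.
  rewrite !cE /r eqxx; have -> : (m + 1 == m) = false by case: (ord4P m) => ->; rewrite ?ord4E.
  rewrite eqxx; split=> //; apply/quad_cone_crd; rewrite sum_ord4 !cE /r.
  by case: (ord4P m) => ->; rewrite ?ord4E /= ?addr0 ?add0r // addrC.
move=> [a0 b0 /quad_cone_crd N1]; exists (cone_crd m x), (cone_crd (m + 1) x).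
have c02 := cone_crd02 x; have c13 := cone_crd13 x.
have key : \sum_i cone_crd i x = cone_crd m x + cone_crd (m + 1) x /\
    \sum_i cone_crd i x *: (v i - z) = cone_crd m x *: (v m - z) + cone_crd (m + 1) x *: (v (m + 1) - z).
  rewrite !sum_ord4; move: a0 b0; case: (ord4P m) => ->; rewrite ?ord4E => a0 b0.
  - move: c02 c13 => /eqP; rewrite mulf_eq0 gt_eqF //= => /eqP -> /eqP.
    by rewrite mulf_eq0 gt_eqF //= => /eqP ->; rewrite !scale0r !addr0.
  - move: c02 c13 => /eqP; rewrite mulf_eq0 orbC gt_eqF //= => /eqP -> /eqP.
    by rewrite mulf_eq0 gt_eqF //= => /eqP ->; rewrite !scale0r !addr0 !add0r.
  - move: c02 c13 => /eqP; rewrite mulf_eq0 orbC gt_eqF //= => /eqP -> /eqP.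
    by rewrite mulf_eq0 orbC gt_eqF //= => /eqP ->; rewrite !scale0r !add0r.
  - move: c02 c13 => /eqP; rewrite mulf_eq0 gt_eqF //= => /eqP -> /eqP.
    by rewrite mulf_eq0 orbC gt_eqF //= => /eqP ->; rewrite !scale0r !addr0; split; rewrite addrC.
by case: key N1 => -> E N1; split => //; rewrite -addrA -E cone_crdK.
Qed.

Lemma tri_sector m : tri v m = quad v `&` [set x | 0 < sgn_s m * s x /\ 0 < sgn_t m * t x].
Proof.
have pp (y : R) : (0 < pos_part y) = (0 < y) by rewrite lt_max ltxx.
have pl (y : R) : (0 < pos_part y / lam) = (0 < y) by rewrite pmulr_lgt0 ?invr_gt0 // pp.
have pm (y : R) : (0 < pos_part y / mu) = (0 < y) by rewrite pmulr_lgt0 ?invr_gt0 // pp.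
apply/seteqP; split => x.
  move=> /tri_cone_crd; case: (ord4P m) => ->; rewrite ?ord4E /cone_crd /sgn_s /sgn_t /=
    ?pl ?pm ?pp ?mul1r ?mulN1r; by case.
move=> [qx []] h1 h2; apply/tri_cone_crd; move: h1 h2.
by case: (ord4P m) => ->; rewrite ?ord4E /cone_crd /sgn_s /sgn_t /=
  ?pl ?pm ?pp ?mul1r ?mulN1r.
Qed.

End Framed.
End QuadGeometry.

(** * Piecewise polynomial characterization of the divergence space *)

Section DivergenceSpace.
Context {R : realType}.
Local Notation P := (plane R).
Local Notation mu := (@lebesgue2 R).
Local Notation LP := (measurableTypeR R * measurableTypeR R)%type.

Lemma affine_funZ k (l : P -> R) : affine_fun l -> affine_fun (fun x => k * l x).
Proof. by move=> [a [b [c lE]]]; exists (k * a), (k * b), (k * c) => x; rewrite lE; ring. Qed.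

(* The compatibility condition at the singular vertex. *)
Definition alternating (v : 'I_4 -> P) (p : 'I_4 -> P -> R) :=
  p 0 (quad_center v) - p 1 (quad_center v) + p 2 (quad_center v) - p 3 (quad_center v) = 0.

Definition piecewise_poly (v : 'I_4 -> P) j (q : P -> R) (p : 'I_4 -> P -> R) :=
  (forall m, polyfun j (p m)) /\ (forall m, ae_eq_in (tri v m) q (p m)).

Section Quad.
Variable v : 'I_4 -> P.
Hypothesis cv : convex_quad v.
Local Notation Q := (quad v).
Local Notation z := (quad_center v).
Local Notation e1 := (v 0 - quad_center v).
Local Notation e2 := (v 1 - quad_center v).
Local Notation s := (crd_s (quad_center v) (v 0 - quad_center v) (v 1 - quad_center v)).
Local Notation t := (crd_t (quad_center v) (v 0 - quad_center v) (v 1 - quad_center v)).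

Lemma quad_domain : domain Q.
Proof. by have [lam [nu fr]] := convex_quad_frame cv; exact: domain_quad fr. Qed.

Lemma quad_det : cross e1 e2 != 0.
Proof. by have [lam [nu fr]] := convex_quad_frame cv; exact: frame_det fr. Qed.

Lemma tri_sectorE m : tri v m = Q `&` [set x | 0 < sgn_s m * s x /\ 0 < sgn_t m * t x].
Proof. by have [lam [nu fr]] := convex_quad_frame cv; exact: (tri_sector fr erefl m). Qed.

Lemma tri_sub m : tri v m `<=` Q.
Proof. by rewrite tri_sectorE => x []. Qed.

Lemma domain_tri m : domain (tri v m).
Proof.
rewrite tri_sectorE (_ : Q `&` _ = (Q `&` [set x | 0 < sgn_s m * s x]) `&` [set x | 0 < sgn_t m * t x]); last first.
  by apply/seteqP; split => x /=; [move=> [? []]|move=> [[]]].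
have a1 : affine_fun (fun x => sgn_s m * s x) by apply: affine_funZ; exact: affine_crd_s.
have a2 : affine_fun (fun x => sgn_t m * t x) by apply: affine_funZ; exact: affine_crd_t.
apply: domainI; [apply: domainI => //|exact: open_halfplane|exact: line_convex_halfplane].
- exact: quad_domain.
- exact: open_halfplane.
- exact: line_convex_halfplane.
Qed.

Lemma quad_center_in : Q z.
Proof.
have [lam [nu fr]] := convex_quad_frame cv.
rewrite (quad_halfplanes fr); have s0 := crd_s_center z e1 e2; have t0 := crd_t_center z e1 e2.
by rewrite /= s0 t0 !mul0r; split; rewrite ?subr0 ?addr0.
Qed.

Lemma null_s : mu.-negligible [set x | s x = 0].
Proof.
have D := quad_det.
have nz : (e2.2 / cross e1 e2, - e2.1 / cross e1 e2) != 0.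
  apply: contra D => /eqP [/eqP h1 /eqP h2]; move: h1 h2.
  rewrite !mulf_eq0 invr_eq0 oppr_eq0; case/orP => [/eqP b|-> //].
  by case/orP => [/eqP b'|-> //]; rewrite /cross /= b b' !mulr0 subrr.
by apply: negligibleS (null_line (- (cross z e2 / cross e1 e2)) nz) => x /=; rewrite crd_sE.
Qed.

Lemma null_t : mu.-negligible [set x | t x = 0].
Proof.
have D := quad_det.
have nz : (- e1.2 / cross e1 e2, e1.1 / cross e1 e2) != 0.
  apply: contra D => /eqP [/eqP h1 /eqP h2]; move: h1 h2.
  rewrite !mulf_eq0 invr_eq0 oppr_eq0; case/orP => [/eqP b|-> //].
  by case/orP => [/eqP b'|-> //]; rewrite /cross /= b b' !mul0r subrr.
by apply: negligibleS (null_line (- (cross e1 z / cross e1 e2)) nz) => x /=; rewrite crd_tE.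
Qed.

Lemma tri_cover x : Q x -> s x != 0 -> t x != 0 -> exists m, tri v m x.
Proof.
move=> Qx s0 t0.
have [sn|sp|/eqP] := ltgtP (s x) 0; last by rewrite (negbTE s0).
  have [tn|tp|/eqP] := ltgtP (t x) 0; last by rewrite (negbTE t0).
    by exists 2; rewrite tri_sectorE /sgn_s /sgn_t /= !mulN1r !oppr_gt0.
  by exists 1; rewrite tri_sectorE /sgn_s /sgn_t /= mulN1r mul1r oppr_gt0.
have [tn|tp|/eqP] := ltgtP (t x) 0; last by rewrite (negbTE t0).
  by exists 3; rewrite tri_sectorE /sgn_s /sgn_t /= mulN1r mul1r oppr_gt0.
by exists 0; rewrite tri_sectorE /sgn_s /sgn_t /= !mul1r.
Qed.

(** The triangles cover the quadrilateral up to its diagonals, which are null. *)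
Lemma ae_quad (A : P -> Prop) : (forall m, {ae mu, forall x, tri v m x -> A x}) ->
  {ae mu, forall x, Q x -> A x}.
Proof.
move=> Am; apply: negligibleS (negligibleU (negligibleU null_s null_t)
  (negligibleU (negligibleU (Am 0) (Am 1)) (negligibleU (Am 2) (Am 3)))) => x /= nA.
apply: contrapT => /not_orP[/not_orP[/eqP s0 /eqP t0] /not_orP[/not_orP[h0 h1] /not_orP[h2 h3]]].
apply: nA => Qx; have [m mx] := tri_cover Qx s0 t0.
by move: mx; case: (ord4P m) => -> mx;
  [move/contrapT: h0|move/contrapT: h1|move/contrapT: h2|move/contrapT: h3]; apply.
Qed.

Lemma ae_eq_quad (f g : P -> R) : (forall m, ae_eq_in (tri v m) f g) -> ae_eq_in Q f g.
Proof. exact: ae_quad. Qed.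

Lemma piecewise_L2 j q p : measurable_fun Q q -> piecewise_poly v j q p -> L2 Q q.
Proof.
move=> mq [pp qp]; have [_ bQ _] := quad_domain.
have /choice[M Mb] m : exists M, forall x, Q x -> `|p m x| <= M.
  exact: continuous_bounded bQ (polyfun_continuous (pp m)).
have M0 m : 0 <= M m by apply: le_trans (Mb m _ quad_center_in).
apply: (L2_ae_bounded quad_domain (M := \sum_m M m)) => //; apply: ae_quad => m.
apply: negligibleS (qp m) => x /=; apply: contra_not => h mx; rewrite h //.
apply: le_trans (Mb m x (tri_sub mx)) _.
by rewrite (bigD1 m) //= lerDl sumr_ge0.
Qed.

Lemma closure_half (l : P -> R) x : affine_fun l ->
  closure (Q `&` [set y | 0 < l y]) x -> 0 <= l x.
Proof.
move=> al cx; rewrite leNgt; apply/negP => lx.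
have oN : open [set y | 0 < (-1) * l y] by apply: open_halfplane; exact: affine_funZ.
have [|y [[_ /= ly]]] := cx [set y | 0 < (-1) * l y].
  by apply: open_nbhs_nbhs; split => //=; rewrite mulN1r oppr_gt0.
by rewrite /= mulN1r oppr_gt0 ltNge (ltW ly).
Qed.

(** Here [l = 0] carries one diagonal and [h > 0] selects one half of it, so that only two triangles
    meet there. Absence of a jump gives equality on a short segment issuing from [z]; counting roots
    extends it to the whole line. *)
Lemma edge_zero (u : P -> R) p p' j (l h : P -> R) (e : P) (sg : R) :
  H1 Q u -> affine_fun l -> (exists x, l x != l z) -> affine_fun h ->
  polyfun j p -> polyfun j p' ->
  (forall r, l (z + r *: e) = 0) -> (forall r, h (z + r *: e) = sg * r) -> sg != 0 ->
  domain (Q `&` [set x | 0 < h x] `&` [set x | 0 < l x]) ->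
  domain (Q `&` [set x | 0 < h x] `&` [set x | l x < 0]) ->
  ae_eq_in (Q `&` [set x | 0 < h x] `&` [set x | 0 < l x]) u p ->
  ae_eq_in (Q `&` [set x | 0 < h x] `&` [set x | l x < 0]) u p' ->
  forall r, p (z + r *: e) = p' (z + r *: e).
Proof.
move=> [Lu wu] [a [b [c lE]]] [x0 lx0] ah pp pp' le he sg0 dO dO' up up'.
set B := Q `&` [set x | 0 < h x].
(* A coordinate direction transversal to the line [l = 0]; the weak derivative in this direction
   detects the jump. *)
have [i i0] : exists i : 'I_2, (if i == 0 then a else b) != 0.
  have [a0|a0] := eqVneq a 0; last by exists 0.
  exists 1; move: lx0; apply: contra => /eqP /= b0; rewrite !lE a0 b0 !mul0r; exact/eqP.
have [g wg] := wu i.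
have [oQ bQ cQ] := quad_domain.
have BQ : B `<=` Q by move=> x [].
have oB : open B by apply: openI => //; exact: open_halfplane.
have gp := weak_partial_local quad_domain dO (subset_trans (@subIsetl _ _ _) BQ) pp Lu wg up.
have gp' := weak_partial_local quad_domain dO' (subset_trans (@subIsetl _ _ _) BQ) pp' Lu wg up'.
have J := jump_zero quad_domain Lu wg lE i0 oB BQ pp pp' up up' gp gp'.
have pd : polyfun j (fun x => p x - p' x) by exact: polyfunB.
have [d d0 dQ] := open_box_nbhs oQ quad_center_in.
(* A positive bound for both components of [e], so that [|r| < d / k] keeps [z + r *: e] within the
   box of size [d]. *)
pose k := `|e.1| + `|e.2| + 1.
have k0 : 0 < k by rewrite ltr_wpDl // addr_ge0.
have inQ r : `|r| < d / k -> Q (z + r *: e).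
  move=> rd; have rk : `|r| * k < d by rewrite -ltr_pdivlMr.
  have r0 := normr_ge0 r; have n1 := normr_ge0 e.1; have n2 := normr_ge0 e.2.
  apply: dQ => /=; rewrite addrAC subrr add0r scaleRE normrM.
    by apply: le_lt_trans rk; rewrite ler_wpM2l // /k -addrA lerDl addr_ge0.
  by apply: le_lt_trans rk; rewrite ler_wpM2l // /k addrAC lerDr addr_ge0.
have dk : 0 < d / k by rewrite divr_gt0.
have zero r : 0 < sg * r -> `|r| < d / k -> p (z + r *: e) - p' (z + r *: e) = 0.
  move=> sr rd; apply/eqP; rewrite subr_eq0; apply/eqP; apply: J => //.
  by split; [exact: inQ|rewrite /= he].
move=> r; apply/eqP; rewrite -subr_eq0; apply/eqP; move: r.
have [sgn|sgp|/eqP] := ltgtP sg 0; last by rewrite (negbTE sg0).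
- have h1 : - (d / k) < 0 by rewrite oppr_lt0.
  apply: (polyfun_zero_line pd h1) => r /andP[r1 r2]; apply: zero; first by rewrite nmulr_rgt0.
  by rewrite ltr0_norm // ltrNl.
- apply: (polyfun_zero_line pd dk) => r /andP[r1 r2]; apply: zero; first by rewrite mulr_gt0.
  by rewrite gtr0_norm.
Qed.

Lemma partial_zero_lines j (D : P -> R) : polyfun j D ->
  (forall r, D (z + r *: e1) = 0) -> (forall r, D (z + r *: e2) = 0) ->
  forall i, partial i D z = 0.
Proof.
move=> /(polyfun_leq (leqnSn j)) /polyfun_derive pD D1 D2.
have dz e : (forall r, D (z + r *: e) = 0) -> e.1 * partial 0 D z + e.2 * partial 1 D z = 0.
  move=> De; case: (pD z e) => _ <-.
  have Dz : D z = 0 by have := De 0; rewrite scale0r addr0.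
  rewrite /derive (_ : (fun h => _) = (fun=> 0)) ?lim_cst //.
  by apply/funext => h; rewrite /= [h *: e + _]addrC De Dz subrr scaler0.
suff [p0 p1] : partial 0 D z = 0 /\ partial 1 D z = 0 by move=> i; case: (ord2P i) => ->.
have h1 := dz _ D1; have h2 := dz _ D2; have De := quad_det.
move: h1 h2 De; rewrite /cross; move: (e1) (e2) (partial 0 D z) (partial 1 D z) => [a1 a2] [b1 b2] d0 d1 /= h1 h2 De.
have E0 : (a1 * b2 - a2 * b1) * d0 = 0.
  by rewrite (_ : _ * d0 = b2 * (a1 * d0 + a2 * d1) - a2 * (b1 * d0 + b2 * d1)); [rewrite h1 h2 !mulr0 subrr|ring].
have E1 : (a1 * b2 - a2 * b1) * d1 = 0.
  by rewrite (_ : _ * d1 = a1 * (b1 * d0 + b2 * d1) - b1 * (a1 * d0 + a2 * d1)); [rewrite h1 h2 !mulr0 subrr|ring].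
move/eqP: E0; move/eqP: E1; rewrite !mulf_eq0 (negbTE De) /= => /eqP d10 /eqP d00.
by split.
Qed.

Lemma tri_edge_zero u j (p : 'I_4 -> P -> R) (m m' : 'I_4) (l h : P -> R) (e : P) (sg : R) :
  H1 Q u -> piecewise_poly v j u p -> affine_fun l -> (exists x, l x != l z) -> affine_fun h ->
  (forall r, l (z + r *: e) = 0) -> (forall r, h (z + r *: e) = sg * r) -> sg != 0 ->
  Q `&` [set x | 0 < h x] `&` [set x | 0 < l x] = tri v m ->
  Q `&` [set x | 0 < h x] `&` [set x | l x < 0] = tri v m' ->
  forall r, p m (z + r *: e) = p m' (z + r *: e).
Proof.
move=> Hu [pp up] al lx ah le he sg0 E E'.
apply: (edge_zero Hu al lx ah (pp m) (pp m') le he sg0); rewrite ?E ?E' //; exact: domain_tri.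
Qed.

(* Continuity across the four half-diagonals makes the alternating sum vanish
   along both diagonals, so its gradient is zero where they meet. *)
Lemma piecewise_alternating u j (p : 'I_4 -> P -> R) i :
  H1 Q u -> piecewise_poly v j u p ->
  partial i (fun x => p 0 x - p 1 x + p 2 x - p 3 x) z = 0.
Proof.
move=> Hu up; have [pp _] := up; have De := quad_det.
have se1 r : s (z + r *: e1) = r by have := crd_sP z De r 0; rewrite scale0r addr0.
have se2 r : s (z + r *: e2) = 0 by have := crd_sP z De 0 r; rewrite scale0r addr0.
have te1 r : t (z + r *: e1) = 0 by have := crd_tP z De r 0; rewrite scale0r addr0.
have te2 r : t (z + r *: e2) = r by have := crd_tP z De 0 r; rewrite scale0r addr0.
have as_ : affine_fun s by exact: affine_crd_s.
have at_ : affine_fun t by exact: affine_crd_t.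
have ns : exists x, s x != s z.
  by exists (z + 1 *: e1); rewrite se1 crd_s_center oner_eq0.
have nt : exists x, t x != t z.
  by exists (z + 1 *: e2); rewrite te2 crd_t_center oner_eq0.
have one0 : (1 : R) != 0 by rewrite oner_eq0.
have mone0 : (-1 : R) != 0 by rewrite oppr_eq0 oner_eq0.
have a1 k (l : P -> R) : affine_fun l -> affine_fun (fun x => k * l x) by exact: affine_funZ.
have setE m (A B : P -> bool) : (forall x, (A x /\ B x) <-> (0 < sgn_s m * s x /\ 0 < sgn_t m * t x)) ->
    Q `&` [set x | A x] `&` [set x | B x] = tri v m.
  move=> AB; rewrite tri_sectorE; apply/seteqP; split => x /=.
    by move=> [[Qx Ax] Bx]; split => //; apply/AB.
  by move=> [Qx /AB[Ax Bx]].
(* One identity per half-diagonal: [l] is the coordinate vanishing on it, and [h] is the other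
   coordinate times the sign [sg] of the half considered. *)
have h01 : forall r, p 0 (z + r *: e2) = p 1 (z + r *: e2).
  apply: (tri_edge_zero Hu up as_ ns (a1 1 _ at_) se2 (sg := 1)) => // [r||].
  - by rewrite te2.
  - by apply: setE => x; rewrite /sgn_s /sgn_t /= !mul1r; tauto.
  - by apply: setE => x; rewrite /sgn_s /sgn_t /= !mul1r mulN1r oppr_gt0; tauto.
have h32 : forall r, p 3 (z + r *: e2) = p 2 (z + r *: e2).
  apply: (tri_edge_zero Hu up as_ ns (a1 (-1) _ at_) se2 (sg := -1)) => // [r||].
  - by rewrite te2.
  - by apply: setE => x; rewrite /sgn_s /sgn_t /= !mul1r; tauto.
  - by apply: setE => x; rewrite /sgn_s /sgn_t /= !mulN1r !oppr_gt0; tauto.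
have h03 : forall r, p 0 (z + r *: e1) = p 3 (z + r *: e1).
  apply: (tri_edge_zero Hu up at_ nt (a1 1 _ as_) te1 (sg := 1)) => // [r||].
  - by rewrite se1.
  - by apply: setE => x; rewrite /sgn_s /sgn_t /= !mul1r; tauto.
  - by apply: setE => x; rewrite /sgn_s /sgn_t /= !mul1r mulN1r oppr_gt0; tauto.
have h12 : forall r, p 1 (z + r *: e1) = p 2 (z + r *: e1).
  apply: (tri_edge_zero Hu up at_ nt (a1 (-1) _ as_) te1 (sg := -1)) => // [r||].
  - by rewrite se1.
  - by apply: setE => x; rewrite /sgn_s /sgn_t /= !mul1r; tauto.
  - by apply: setE => x; rewrite /sgn_s /sgn_t /= !mulN1r !oppr_gt0; tauto.
have pD : polyfun j (fun x => p 0 x - p 1 x + p 2 x - p 3 x).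
  by apply: polyfunB => //; apply: polyfunD => //; exact: polyfunB.
apply: (partial_zero_lines pD) => r.
  by rewrite h03 h12; ring.
by rewrite h01 h32; ring.
Qed.

Lemma partialsum4 j (p : 'I_4 -> P -> R) i : (forall m, polyfun j (p m)) -> forall x,
  partial i (fun x => p 0 x - p 1 x + p 2 x - p 3 x) x =
  partial i (p 0) x - partial i (p 1) x + partial i (p 2) x - partial i (p 3) x.
Proof.
move=> pp x; have D m := polyfun_is_derive i (pp m) x.
by case: (is_deriveB (is_deriveD (is_deriveB (D 0) (D 1)) (D 2)) (D 3)).
Qed.

(** Component [i] of the field contributes the [i]-th partial derivative of its own alternating sum
    at the centre. Each of the two is zero, and adding them gives the condition for the
    divergence. *)
Lemma Wh_piecewise j q : Wh v j q ->
  measurable_fun Q q /\ exists p, piecewise_poly v j q p /\ alternating v p.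
Proof.
move=> [u [g [uV wg ->]]].
have Lg i : L2 Q (g i) by case: (wg i).
have Lu i : L2 Q (u i) by case: (uV i) => -[].
split.
  rewrite (_ : \sum_i g i = fun x => g 0 x + g 1 x); last first.
    by rewrite big_ord_recl big_ord1; apply/funext => x; congr (g _ x + g _ x); exact: val_inj.
  by apply: measurable_funD; [case: (Lg 0)|case: (Lg 1)].
have /choice[p pE] i : exists p : 'I_4 -> P -> R, piecewise_poly v j.+1 (u i) p.
  have [_ h] := uV i.
  have /choice[p pE] m : exists p, polyfun j.+1 p /\ ae_eq_in (tri v m) (u i) p.
    by have [p pp up] := h m; exists p.
  by exists p; split => m; case: (pE m).
exists (fun m => fld_div (fun i => p i m)); split; first split.
- move=> m; apply: (@eq_polyfun _ _ (fun x => partial 0 (p 0 m) x + partial 1 (p 1 m) x)).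
    by move=> x; rewrite fld_divE.
  by apply: polyfunD; apply: polyfun_partial; case: (pE 0) => h _; case: (pE 1) => h' _.
- move=> m.
  have gi i : ae_eq_in (tri v m) (g i) (partial i (p i m)).
    have [pp up] := pE i.
    exact: (weak_partial_local quad_domain (domain_tri m) (@tri_sub m) (pp m) (Lu i) (wg i) (up m)).
  rewrite (_ : \sum_i g i = fun x => g 0 x + g 1 x); last first.
    by rewrite big_ord_recl big_ord1; apply/funext => x; congr (g _ x + g _ x); exact: val_inj.
  apply: (ae_eq_in_trans (ae_eq_in_op2 (fun a b => a + b) (gi 0) (gi 1))).
  by apply: ae_eq_in_refl => x _; rewrite fld_divE.
- rewrite /alternating !fld_divE.
  have h i : partial i (p i 0) z - partial i (p i 1) z + partial i (p i 2) z - partial i (p i 3) z = 0.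
    rewrite -(partialsum4 _ (j := j.+1)); last by case: (pE i).
    by apply: (piecewise_alternating _ _ (pE i)); case: (uV i).
  by move: (h 0) (h 1) => h0 h1; rewrite -[RHS]addr0 -{1}h0 -h1; ring.
Qed.

(* With d the alternating sum, q = p 2 + [s > 0] (p 3 - p 2) + [t > 0] (p 1 - p 2)
   + [s > 0, t > 0] d, and each term is the divergence of a polynomial field that
   vanishes on the lines s = 0 and t = 0 where it is cut off; for the last one
   this is possible because d z = 0. *)
Lemma piecewise_Wh j q p : measurable_fun Q q -> piecewise_poly v j q p -> alternating v p ->
  Wh v j q.
Proof.
move=> mq [pp qp] ap; have De := quad_det; have dQ := quad_domain.
have pB m m' : polyfun j (fun x => p m x - p m' x) by exact: polyfunB.
have [Ea [pEa _ dEa]] := has_div_s z De (pp 2).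
have [Eb [pEb zEb dEb]] := has_div_s z De (pB 3 2).
have [Ec [pEc zEc dEc]] := has_div_t z De (pB 1 2).
pose d x := p 0 x - p 1 x + p 2 x - p 3 x.
have pd : polyfun j d by apply: polyfunB => //; apply: polyfunD => //; exact: polyfunB.
have dz : d z = 0 by exact: ap.
have [Ed [pEd zEd dEd']] := has_div_st z De pd.
have dEd x : fld_div Ed x = d x by rewrite dEd' dz subr0.
have as_ : affine_fun s by exact: affine_crd_s.
have at_ : affine_fun t by exact: affine_crd_t.
pose Os := Q `&` [set x | 0 < s x]; pose Ot := Q `&` [set x | 0 < t x]; pose Ost := Os `&` [set x | 0 < t x].
have dOs : domain Os by apply: domainI => //; [exact: open_halfplane|exact: line_convex_halfplane].
have dOt : domain Ot by apply: domainI => //; [exact: open_halfplane|exact: line_convex_halfplane].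
have dOst : domain Ost by apply: domainI => //; [exact: open_halfplane|exact: line_convex_halfplane].
pose comb (A B C D : P -> R) x := ((piece Q A x + piece Os B x) + piece Ot C x) + piece Ost D x.
pose u i := comb (Ea i) (Eb i) (Ec i) (Ed i).
pose G i k := comb (partial k (Ea i)) (partial k (Eb i)) (partial k (Ec i)) (partial k (Ed i)).
have Lpc (O : set P) (k : nat) (E : P -> R) : domain O -> polyfun k E -> L2 Q (piece O E).
  by move=> dO; apply: L2_piece => //; exact: domain_measurable dO.
have Lcomb k A B C D : polyfun k A -> polyfun k B -> polyfun k C -> polyfun k D -> L2 Q (comb A B C D).
  move=> pA pB' pC pD; apply: L2D => //; last exact: Lpc pD.
  by apply: L2D => //; [apply: L2D => //; [exact: Lpc pA|exact: Lpc pB']|exact: Lpc pC].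
have Lu i : L2 Q (u i) by exact: Lcomb (pEa i) (pEb i) (pEc i) (pEd i).
have wu i k : weak_partial Q k (u i) (G i k).
  have la := Lpc Q _ _ dQ (pEa i); have lb := Lpc Os _ _ dOs (pEb i).
  have lc := Lpc Ot _ _ dOt (pEc i); have ld := Lpc Ost _ _ dOst (pEd i).
  have wa : weak_partial Q k (piece Q (Ea i)) (piece Q (partial k (Ea i))).
    by apply: (weak_partial_piece dQ k dQ _ (pEa i)) => // x Qx _ /(_ Qx).
  have wb : weak_partial Q k (piece Os (Eb i)) (piece Os (partial k (Eb i))).
    apply: (weak_partial_piece dQ k dOs _ (pEb i)) => [x []//|x Qx cx nx].
    apply: zEb; apply/eqP; rewrite eq_le (closure_half as_ cx) andbT leNgt.
    by apply/negP => sx; apply: nx.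
  have wc : weak_partial Q k (piece Ot (Ec i)) (piece Ot (partial k (Ec i))).
    apply: (weak_partial_piece dQ k dOt _ (pEc i)) => [x []//|x Qx cx nx].
    apply: zEc; apply/eqP; rewrite eq_le (closure_half at_ cx) andbT leNgt.
    by apply/negP => sx; apply: nx.
  (* A point of [Q] in the closure of [Ost] but outside it has [s = 0] or [t = 0], and [Ed] vanishes
     in both cases. *)
  have wd : weak_partial Q k (piece Ost (Ed i)) (piece Ost (partial k (Ed i))).
    apply: (weak_partial_piece dQ k dOst _ (pEd i)) => [x [[]]//|x Qx cx nx].
    have cs : 0 <= s x by apply: (closure_half as_); apply: closure_subset cx => y [].
    have ct : 0 <= t x by apply: (closure_half at_); apply: closure_subset cx => y [[]].
    apply: zEd; move: cs ct; rewrite !le_eqVlt => /orP[/eqP <-|sp]; first by left.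
    by move=> /orP[/eqP <-|tp]; [right|case: nx].
  have lab := L2D dQ la lb; have labc := L2D dQ lab lc.
  exact: (weak_partialD dQ labc ld (weak_partialD dQ lab lc (weak_partialD dQ la lb wa wb) wc) wd).
(* The values of [comb] on the four triangles, where the signs of [(s, t)] are (+,+), (-,+), (-,-),
   (+,-). *)
pose sel m (A B C D : P -> R) x := nth 0 [:: A x + B x + C x + D x; A x + C x; A x; A x + B x] (m : 'I_4).
have combE m A B C D x : tri v m x -> comb A B C D x = sel m A B C D x.
  move=> mx; have Qx := tri_sub mx.
  have pQ E : piece Q E x = E x by rewrite /piece indicE mem_set // mulr1.
  have pI (O : set P) E : O x -> piece O E x = E x by move=> Ox; rewrite /piece indicE mem_set // mulr1.
  have pO (O : set P) E : ~ O x -> piece O E x = 0 by move=> Ox; rewrite /piece indicE memNset // mulr0.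
  rewrite /comb pQ; move: mx; rewrite tri_sectorE => -[_ /=].
  have nsx : s x < 0 -> ~ Os x by move=> sx [_ /=]; rewrite ltNge (ltW sx).
  have ntx : t x < 0 -> ~ Ot x by move=> tx [_ /=]; rewrite ltNge (ltW tx).
  have nst1 : s x < 0 -> ~ Ost x by move=> sx [[_ /=]]; rewrite ltNge (ltW sx).
  have nst2 : t x < 0 -> ~ Ost x by move=> tx [_ /=]; rewrite ltNge (ltW tx).
  case: (ord4P m) => ->; rewrite /sgn_s /sgn_t /sel /= ?mul1r ?mulN1r ?oppr_gt0 => -[sx tx].
  - by rewrite !pI.
  - by rewrite (pO Os) ?(pI Ot) ?(pO Ost) ?addr0; auto.
  - by rewrite (pO Os) ?(pO Ot) ?(pO Ost) ?addr0; auto.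
  - by rewrite (pI Os) ?(pO Ot) ?(pO Ost) ?addr0; auto.
have psel k m A B C D : polyfun k A -> polyfun k B -> polyfun k C -> polyfun k D ->
    polyfun k (sel m A B C D).
  move=> pA pB' pC pD; case: (ord4P m) => ->; rewrite /sel //=; do ?apply: polyfunD => //.
have qG : ae_eq_in Q (fun x => G 0 0 x + G 1 1 x) q.
  apply: ae_eq_quad => m; apply: ae_eq_in_sym; apply: (ae_eq_in_trans (qp m)).
  apply: ae_eq_in_refl => x mx; rewrite /G !(combE m) //.
  move: (dEa x) (dEb x) (dEc x) (dEd x); rewrite !fld_divE /d => ha hb hc hd.
  transitivity (sel m (fun x => partial 0 (Ea 0) x + partial 1 (Ea 1) x)
    (fun x => partial 0 (Eb 0) x + partial 1 (Eb 1) x) (fun x => partial 0 (Ec 0) x + partial 1 (Ec 1) x)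
    (fun x => partial 0 (Ed 0) x + partial 1 (Ed 1) x) x); last first.
    by case: (ord4P m) => ->; rewrite /sel /=; ring.
  by case: (ord4P m) => ->; rewrite /sel /= ?ha ?hb ?hc ?hd; ring.
have LG : L2 Q (G 0 0) by case: (wu 0 0).
have Lq : L2 Q q by exact: (piecewise_L2 mq (conj pp qp)).
(* [Wh] asks for [q] to be the sum of the weak derivatives as a function. Taking [q - G 0 0] as the
   second one, instead of the almost everywhere equal [G 1 1], makes the identity hold at every
   point. *)
exists u, (fun i => if i == 0 then G 0 0 else fun x => q x - G 0 0 x); split.
- move=> i; split; first by split => // k; exists (G i k).
  move=> m; exists (sel m (Ea i) (Eb i) (Ec i) (Ed i)); first exact: psel.
  by apply: ae_eq_in_refl => x mx; exact: combE.
- move=> i; case: (ord2P i) => -> //=.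
  apply: (weak_partial_ae dQ _ _ (wu 1 1)); first exact: (L2D dQ Lq (L2N LG)).
  apply: (ae_eq_in_trans (g := fun x => (G 0 0 x + G 1 1 x) - G 0 0 x)).
    by apply: ae_eq_in_refl => x _; rewrite addrC addKr.
  exact: (ae_eq_in_op2 (fun a b => a - b) qG (ae_eq_in_refl (fun x _ => erefl (G 0 0 x)))).
- by apply/funext => x; rewrite fct_sumE big_ord_recl big_ord1 /= addrC subrK.
Qed.

End Quad.
End DivergenceSpace.

(** * The piecewise affine map between two quadrilaterals *)

Section QuadMap.
Context {R : realType}.
Local Notation P := (plane R).
Local Notation mu := (@lebesgue2 R).
Implicit Types (v w : 'I_4 -> P).

Lemma cone_point v (m : 'I_4) (z : P) (a b : R) :
  \sum_i (if i == m then a else if i == m + 1 then b else 0) *: (v i - z) =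
  a *: (v m - z) + b *: (v (m + 1) - z).
Proof.
rewrite sum_ord4; case: (ord4P m) => ->; rewrite ?ord4E /= ?scale0r ?addr0 ?add0r //.
by rewrite addrC.
Qed.

Section Frame.
Variables (v : 'I_4 -> P) (z e1 e2 : P) (lam nu : R).
Hypothesis fr : quad_frame v z e1 e2 lam nu.

(** One coordinate of each opposite pair is zero; the two that remain are consecutive and single out
    a sector. *)
Lemma cone_decomposition x : exists m a b, [/\ 0 <= a, 0 <= b,
  \sum_i cone_crd z e1 e2 lam nu i x = a + b & x = z + a *: (v m - z) + b *: (v (m + 1) - z)].
Proof.
have := cone_crd02 z e1 e2 lam nu x; have := cone_crd13 z e1 e2 lam nu x.
have := cone_crdK fr x; rewrite !sum_ord4.
have c0 i : 0 <= cone_crd z e1 e2 lam nu i x by exact: (cone_crd_ge0 fr).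
move: (c0 0) (c0 1) (c0 2) (c0 3); move: (cone_crd _ _ _ _ _ 0 x) (cone_crd _ _ _ _ _ 1 x).
move: (cone_crd _ _ _ _ _ 2 x) (cone_crd _ _ _ _ _ 3 x) => c2 c3 c0' c1 p0 p1 p2 p3 <-.
move=> /eqP + /eqP; rewrite !mulf_eq0.
move=> /orP[/eqP ->|/eqP ->] /orP[/eqP ->|/eqP ->]; rewrite ?scale0r ?addr0 ?add0r.
- by exists 2, c2, c3; rewrite ord4E addrA.
- by exists 3, c3, c0'; rewrite ord4E -addrA (addrC (c3 *: _)) addrC; split.
- by exists 1, c1, c2; rewrite ord4E addrA.
- by exists 0, c0', c1; rewrite ord4E addrA.
Qed.

Lemma sector_det m : cross (v m - z) (v (m + 1) - z) != 0.
Proof.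
have De := frame_det fr; have l0 := frame_lam fr; have n0 := frame_mu fr.
have [k kn0 ->] : exists2 k, k != 0 & cross (v m - z) (v (m + 1) - z) = k * cross e1 e2.
  case: (ord4P m) => ->; rewrite ?ord4E ?(frame_v0 fr) ?(frame_v1 fr) ?(frame_v2 fr) ?(frame_v3 fr);
    [exists 1|exists lam|exists (lam * nu)|exists nu];
    rewrite ?oner_eq0 ?mulf_neq0 ?gt_eqF //; by rewrite /cross /= ?scaleRE; ring.
by rewrite mulf_neq0.
Qed.

End Frame.

(** The piecewise affine map that keeps the cone coordinates. Its inverse has the same form with [v]
    and [w] exchanged, and it is defined on the whole plane. *)
Definition quad_map v lam nu w (x : P) : P := quad_center w +
  \sum_i cone_crd (quad_center v) (v 0 - quad_center v) (v 1 - quad_center v) lam nu i x *: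
    (w i - quad_center w).

(** The affine branch of [quad_map] on sector [m], extended to the whole plane so that it can be
    composed with polynomials and evaluated at the centre. *)
Definition sector_map v w (m : 'I_4) (x : P) : P :=
  quad_center w
  + crd_s (quad_center v) (v m - quad_center v) (v (m + 1) - quad_center v) x *: (w m - quad_center w)
  + crd_t (quad_center v) (v m - quad_center v) (v (m + 1) - quad_center v) x *: (w (m + 1) - quad_center w).

Section Transport.
Variables (v w : 'I_4 -> P) (lv nv lw nw : R).
Local Notation zv := (quad_center v).
Local Notation zw := (quad_center w).
Hypothesis fv : quad_frame v zv (v 0 - zv) (v 1 - zv) lv nv.
Hypothesis fw : quad_frame w zw (w 0 - zw) (w 1 - zw) lw nw.
Local Notation cv := (cone_crd zv (v 0 - zv) (v 1 - zv) lv nv).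
Local Notation cw := (cone_crd zw (w 0 - zw) (w 1 - zw) lw nw).
Local Notation T := (quad_map v lv nv w).

Lemma quad_map_crd i x : cw i (T x) = cv i x.
Proof.
apply: (cone_crd_unique fw (r := fun i => cv i x)) => [m||]; first exact: (cone_crd_ge0 fv).
  exact: cone_crd02.
exact: cone_crd13.
Qed.

Lemma quad_map_quad x : quad v x -> quad w (T x).
Proof.
rewrite (quad_cone_crd fv) (quad_cone_crd fw) => h.
by under eq_bigr do rewrite quad_map_crd.
Qed.

Lemma quad_map_tri m x : tri v m x -> tri w m (T x).
Proof.
move=> /(tri_cone_crd fv erefl)[a b qx]; apply/(tri_cone_crd fw erefl).
by rewrite !quad_map_crd; split => //; exact: quad_map_quad.
Qed.

Lemma quad_mapK x : quad_map w lw nw v (T x) = x.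
Proof.
rewrite /quad_map; under eq_bigr do rewrite quad_map_crd.
exact: cone_crdK fv x.
Qed.

Lemma quad_map_cone m (a b : R) : 0 <= a -> 0 <= b ->
  T (zv + a *: (v m - zv) + b *: (v (m + 1) - zv)) = zw + a *: (w m - zw) + b *: (w (m + 1) - zw).
Proof.
move=> a0 b0; rewrite -!addrA -!cone_point.
pose r (i : 'I_4) := if i == m then a else if i == m + 1 then b else 0.
rewrite /quad_map; congr (_ + _); apply: eq_bigr => i _; congr (_ *: _).
apply: (cone_crd_unique fv (r := r)).
- by move=> j; rewrite /r; case: ifP => // _; case: ifP.
- by rewrite /r; case: (ord4P m) => ->; rewrite ?ord4E /= ?mulr0 ?mul0r.
- by rewrite /r; case: (ord4P m) => ->; rewrite ?ord4E /= ?mulr0 ?mul0r.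
Qed.

Lemma quad_map_sector m x : tri v m x -> T x = sector_map v w m x.
Proof.
rewrite triE => -[a [b [a0 b0 ab ->]]]; rewrite quad_map_cone ?(ltW a0) ?(ltW b0) //.
by rewrite /sector_map crd_sP ?crd_tP // (sector_det fv).
Qed.

Lemma sector_map_center m : sector_map v w m zv = zw.
Proof. by rewrite /sector_map crd_s_center crd_t_center !scale0r !addr0. Qed.

Lemma affine_sector_map m :
  affine_fun (fun x => (sector_map v w m x).1) /\ affine_fun (fun x => (sector_map v w m x).2).
Proof.
have [a1 [b1 [c1 E1]]] := affine_crd_s zv (v m - zv) (v (m + 1) - zv).
have [a2 [b2 [c2 E2]]] := affine_crd_t zv (v m - zv) (v (m + 1) - zv).
split.
  exists (a1 * (w m - zw).1 + a2 * (w (m + 1) - zw).1), (b1 * (w m - zw).1 + b2 * (w (m + 1) - zw).1),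
    (zw.1 + c1 * (w m - zw).1 + c2 * (w (m + 1) - zw).1) => x.
  by rewrite /sector_map /= !scaleRE E1 E2; ring.
exists (a1 * (w m - zw).2 + a2 * (w (m + 1) - zw).2), (b1 * (w m - zw).2 + b2 * (w (m + 1) - zw).2),
  (zw.2 + c1 * (w m - zw).2 + c2 * (w (m + 1) - zw).2) => x.
by rewrite /sector_map /= !scaleRE E1 E2; ring.
Qed.

Lemma null_sector_map m : null_map (sector_map v w m).
Proof.
have D := sector_det fv m; have D' := sector_det fw m.
move: D D'; set d := cross _ _; set d' := cross _ _ => D D'.
have [[a [b [e E1]]] [c [d0 [f E2]]]] := affine_sector_map m.
have mE : sector_map v w m = fun x => (a * x.1 + b * x.2 + e, c * x.1 + d0 * x.2 + f).
  by apply/funext => x; rewrite -E1 -E2; case: (sector_map _ _ _ _).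
rewrite mE; apply: null_map_affine.
(* The linear part sends the half-diagonals bounding the sector in [v] to those in [w], so its
   determinant is the ratio of their cross products. *)
have key : (a * d0 - b * c) * d = d'.
  have h1 := sector_map_center m.
  have h2 : sector_map v w m (v m) = w m.
    have := @crd_sP _ zv _ _ (sector_det fv m) 1 0; have := @crd_tP _ zv _ _ (sector_det fv m) 1 0.
    rewrite scale1r scale0r addr0 subrKC /sector_map => -> ->.
    by rewrite scale1r scale0r addr0 subrKC.
  have h3 : sector_map v w m (v (m + 1)) = w (m + 1).
    have := @crd_sP _ zv _ _ (sector_det fv m) 0 1; have := @crd_tP _ zv _ _ (sector_det fv m) 0 1.
    rewrite scale1r scale0r addr0 subrKC /sector_map => -> ->.
    by rewrite scale1r scale0r addr0 subrKC.
  rewrite /d /d' -h2 -h3 -h1 mE /cross /=; ring.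
by apply: contraNneq D' => h; rewrite -key h mul0r.
Qed.

Lemma continuous_cone_crd i : continuous (cv i).
Proof.
have cs := affine_fun_continuous (affine_crd_s zv (v 0 - zv) (v 1 - zv)).
have ct := affine_fun_continuous (affine_crd_t zv (v 0 - zv) (v 1 - zv)).
have cp (f : P -> R) : continuous f -> continuous (fun x => pos_part (f x)).
  move=> cf x; exact: (@continuous_max _ _ (cst 0) f x (@cvg_cst _ _ _ _ _) (cf x)).
have cN (f : P -> R) : continuous f -> continuous (fun x => - f x).
  by move=> cf x; exact: cvgN (cf x).
have cd (f : P -> R) k : continuous f -> continuous (fun x => f x * k).
  by move=> cf x; exact: cvgM (cf x) (@cvg_cst _ _ _ _ _).
case: (ord4P i) => ->; rewrite /cone_crd /=; [exact: cp|exact: cp| |].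
  exact: cd (cp _ (cN _ cs)).
exact: cd (cp _ (cN _ ct)).
Qed.

Lemma continuous_quad_map : continuous (fun x => (T x).1) /\ continuous (fun x => (T x).2).
Proof.
have cc i := continuous_cone_crd i.
have h (k0 k1 k2 k3 k : R) : continuous (fun x => k + (cv 0 x * k0 + cv 1 x * k1 + cv 2 x * k2 + cv 3 x * k3)).
  move=> x; apply: cvgD; first exact: cvg_cst.
  have hh i k' : (fun x => cv i x * k') @ x --> cv i x * k'.
    by apply: cvgM; [exact: cc|exact: cvg_cst].
  by apply: cvgD; [apply: cvgD; [apply: cvgD|]|]; exact: hh.
have Tf : T = fun x => (zw.1 + (cv 0 x * (w 0 - zw).1 + cv 1 x * (w 1 - zw).1 + cv 2 x * (w 2 - zw).1 + cv 3 x * (w 3 - zw).1),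
  zw.2 + (cv 0 x * (w 0 - zw).2 + cv 1 x * (w 1 - zw).2 + cv 2 x * (w 2 - zw).2 + cv 3 x * (w 3 - zw).2)).
  by apply/funext => x; rewrite /quad_map sum_ord4.
by rewrite Tf; split; exact: h.
Qed.

(** Every branch sends centre to centre, so the four numbers in [alternating] do not change. Degrees
    survive affine substitution, and exceptional null sets are pulled back branch by branch. *)
Lemma transport j q p :
  measurable_fun (quad w) q -> piecewise_poly w j q p -> alternating w p ->
  [/\ measurable_fun (quad v) (q \o T),
      piecewise_poly v j (q \o T) (fun m x => p m (sector_map v w m x))
    & alternating v (fun m x => p m (sector_map v w m x))].
Proof.
move=> mq [pp qp] ap; split.
- move=> mv B mB.
  have [c1 c2] := continuous_quad_map.
  have mQ := domain_measurable (domain_quad fw).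
  rewrite (_ : quad v `&` _ = quad v `&` T @^-1` (quad w `&` q @^-1` B)); last first.
    by apply/seteqP; split => x /= [qx]; [split=> //; split => //; exact: quad_map_quad|move=> []].
  by apply: measurableI => //; apply: measurable_preim => //; exact: mq.
- split=> [m|m].
    have [a1 a2] := affine_sector_map m.
    apply: (eq_polyfun _ (polyfun_comp a1 a2 (pp m))) => x.
    by case: (sector_map v w m x).
  have := null_sector_map m (qp m); apply: negligibleS => x /=; apply: contra_not => h tx.
  by rewrite (quad_map_sector tx); apply: h; rewrite -(quad_map_sector tx); exact: quad_map_tri.
- by rewrite /alternating !sector_map_center.
Qed.

End Transport.
End QuadMap.

(** * Reference maps *)

Section ReferenceMap.
Context {R : realType}.
Local Notation P := (plane R).
Implicit Types (v w : 'I_4 -> P).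

Lemma cone_closure v m (a b : R) : 0 <= a -> 0 <= b -> a + b <= 1 ->
  closure (tri v m) (quad_center v + a *: (v m - quad_center v) + b *: (v (m + 1) - quad_center v)).
Proof.
move=> a0 b0 ab B; set z := quad_center v; set y := _ + _ => yB.
(* A path from the given point towards the point with coordinates (1/4, 1/4). By convexity it is
   inside the open triangle for [0 < e < 1]. *)
pose g (e : R) := z + (a + e * (4^-1 - a)) *: (v m - z) + (b + e * (4^-1 - b)) *: (v (m + 1) - z).
have cg : g e @[e --> 0^'+] --> y.
  have -> : y = g 0 by rewrite /g !mul0r !addr0.
  apply: cvg_within_filter; rewrite /g.
  have ca (c : R) : (fun e : R => c + e * (4^-1 - c)) @ (0 : R) --> c + 0 * (4^-1 - c).
    by apply: cvgD; [exact: cvg_cst|apply: cvgM; [exact: cvg_id|exact: cvg_cst]].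
  by apply: cvgD; [apply: cvgD; [exact: cvg_cst|]|]; apply: cvgZr_tmp; exact: ca.
have gB : \forall e \near (0 : R)^'+, B (g e) by exact: cg _ yB.
near (0 : R)^'+ => e.
have e0 : 0 < e by near: e; exact: nbhs_right_gt.
have e11 : e < 1 by near: e; exact: nbhs_right_lt.
have Be : B (g e) by near: e.
exists (g e); split => //; rewrite triE; exists (a + e * (4^-1 - a)), (b + e * (4^-1 - b)).
have q4 : (0 : R) < 4^-1 by rewrite invr_gt0.
have ea := mulr_ge0 (ltW e0) a0; have eb := mulr_ge0 (ltW e0) b0.
split=> //.
- have -> : a + e * (4^-1 - a) = (1 - e) * a + e * 4^-1 by ring.
  by apply: ltr_wpDl; [rewrite mulr_ge0 // subr_ge0 ltW|rewrite mulr_gt0].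
- have -> : b + e * (4^-1 - b) = (1 - e) * b + e * 4^-1 by ring.
  by apply: ltr_wpDl; [rewrite mulr_ge0 // subr_ge0 ltW|rewrite mulr_gt0].
- have -> : a + e * (4^-1 - a) + (b + e * (4^-1 - b)) = (1 - e) * (a + b) + e / 2 by field.
  have : (1 - e) * (a + b) <= (1 - e) * 1 by rewrite ler_wpM2l // subr_ge0 ltW.
  by lra.
Unshelve. all: by end_near. Qed.

Lemma continuous_affine_map B b : continuous (@affine_map R B b).
Proof.
move=> x; rewrite /affine_map; apply: cvgD; last exact: cvg_cst.
have h (a c : R) : (fun y : P => a * y.1 + c * y.2) @ x --> a * x.1 + c * x.2.
  by apply: cvgD; apply: cvgM; try exact: cvg_cst; [exact: cvg_fst|exact: cvg_snd].
exact: (cvg_pair (h _ _) (h _ _)).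
Qed.

Lemma affine_mapE B b (z x y : P) (r s : R) :
  affine_map B b (z + r *: (x - z) + s *: (y - z)) =
  affine_map B b z + r *: (affine_map B b x - affine_map B b z)
                   + s *: (affine_map B b y - affine_map B b z).
Proof. by rewrite /affine_map; apply: plane_eq; rewrite /= !scaleRE; ring. Qed.

(* The affine branch of F on a triangle extends to the closed triangle by
   continuity, so it is determined by the prescribed vertex images. *)
Lemma reference_map_cone v F m (a b : R) : reference_map v F -> 0 <= a -> 0 <= b -> a + b <= 1 ->
  F (0 + a *: (vref m - 0) + b *: (vref (m + 1) - 0)) =
  quad_center v + a *: (v m - quad_center v) + b *: (v (m + 1) - quad_center v).
Proof.
move=> [Fc FA _ Fv Fz] a0 b0 ab; have [B [d FE]] := FA m.
have cA := @continuous_affine_map B d.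
have ext y : closure (tri vref m) y -> F y = affine_map B d y.
  move=> cy.
  have tQ : tri vref m `<=` closure (quad (@vref R)).
    by move=> x /(tri_sub (@convex_vref R)); exact: subset_closure.
  have cQy : closure (quad (@vref R)) y.
    exact: closure_subset (tri_sub (@convex_vref R) (m := m)) _ cy.
  have PF := within_nbhs_proper cy.
  have lF : F @ within (tri vref m) (nbhs y) --> F y.
    have := (@subspace_continuousP _ _ _ F).1 Fc y cQy; apply: cvg_trans.
    apply: cvg_app => A; rewrite /nbhs /= /within /=; apply: filterS => x + /tQ; exact.
  have lA : F @ within (tri vref m) (nbhs y) --> affine_map B d y.
    have lA : affine_map B d @ within (tri vref m) (nbhs y) --> affine_map B d y.
      exact: cvg_within_filter (cA y).
    apply: cvg_trans lA; apply: near_eq_cvg; rewrite near_withinE.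
    by apply: nearW => x tx; rewrite FE.
  exact: cvg_unique lF lA.
have Acl (r s : R) : 0 <= r -> 0 <= s -> r + s <= 1 ->
    F (0 + r *: (vref m - 0) + s *: (vref (m + 1) - 0)) =
    affine_map B d (0 + r *: (vref m - 0) + s *: (vref (m + 1) - 0)).
  move=> r0 s0 rs; apply: ext; have := @cone_closure (@vref R) m _ _ r0 s0 rs.
  by rewrite center_vref.
have A0 : affine_map B d 0 = quad_center v.
  by rewrite -Fz center_vref; have := Acl 0 0; rewrite !scale0r !addr0 => <-.
have A1 : affine_map B d (vref m) = v m.
  have := Acl 1 0 ler01 (lexx _); rewrite !subr0 !addr0 !add0r scale0r scale1r addr0 => <- //.
have A2 : affine_map B d (vref (m + 1)) = v (m + 1).
  have := Acl 0 1 (lexx _) ler01; rewrite !subr0 !add0r scale0r scale1r add0r => <- //.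
by rewrite Acl // affine_mapE A0 A1 A2.
Unshelve. all: by end_near. Qed.

(** Uniqueness of the reference map: every point of the square lies in a closed sector with
    coordinates of sum less than 1, where [F] is already determined. *)
Lemma reference_mapE v F (lam nu : R) :
  quad_frame vref (quad_center vref) (vref 0 - quad_center vref) (vref 1 - quad_center vref) lam nu ->
  reference_map v F -> forall x, quad vref x -> F x = quad_map vref lam nu v x.
Proof.
move=> fr rF x /(quad_cone_crd fr).
have [m [a [b [a0 b0 -> xE]]]] := cone_decomposition fr x => ab.
rewrite xE (quad_map_cone v fr) // center_vref (reference_map_cone m rF) //; exact: ltW.
Qed.

(** On the square [F] is a [quad_map], whose inverse is the one in the opposite direction. Every
    point of [quad v] is therefore an image, and the default [fun=> 0] of the partial inverse is
    never reached there. *)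
Lemma pinv_reference_map v F (lr nr lv nv : R) :
  quad_frame vref (quad_center vref) (vref 0 - quad_center vref) (vref 1 - quad_center vref) lr nr ->
  quad_frame v (quad_center v) (v 0 - quad_center v) (v 1 - quad_center v) lv nv ->
  reference_map v F -> forall x, quad v x ->
  'pinv_(fun=> 0) (quad vref) F x = quad_map v lv nv vref x.
Proof.
move=> fr fv rF x qx.
have FE := reference_mapE fr rF.
have injF : {in quad vref &, injective F}.
  move=> y y' /set_mem qy /set_mem qy'; rewrite !FE // => /(congr1 (quad_map v lv nv vref)).
  by rewrite !(quad_mapK fr fv).
have qy := quad_map_quad fv fr qx.
rewrite -[in LHS](quad_mapK fv fr x) -FE // pinvKV //; exact: mem_set.
Qed.

(** Membership is decided by measurability and almost-everywhere identities on the quadrilateral;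
    values elsewhere are free. *)
Lemma Wh_ext v j q q' : convex_quad v -> (forall x, quad v x -> q x = q' x) -> Wh v j q -> Wh v j q'.
Proof.
move=> cv qq' /(Wh_piecewise cv)[mq [p [[pp qp] ap]]].
apply: (piecewise_Wh cv _ (p := p)) => //.
  apply: (eq_measurable_fun q _ mq) => x /set_mem; exact: qq'.
split => // m; apply: ae_eq_in_trans (qp m).
by apply: ae_eq_in_refl => x /(tri_sub cv) qx; rewrite qq'.
Qed.

Lemma Wh_quad_map v w (lv nv lw nw : R) j q :
  convex_quad v -> convex_quad w ->
  quad_frame v (quad_center v) (v 0 - quad_center v) (v 1 - quad_center v) lv nv ->
  quad_frame w (quad_center w) (w 0 - quad_center w) (w 1 - quad_center w) lw nw ->
  Wh w j q -> Wh v j (q \o quad_map v lv nv w).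
Proof.
move=> cv cw fv fw /(Wh_piecewise cw)[mq [p [pq ap]]].
have [mq' pq' ap'] := transport fv fw mq pq ap.
exact: (piecewise_Wh cv mq' pq' ap').
Qed.

Lemma Wh_reference_map v F j : convex_quad v -> reference_map v F ->
  Wh v j = [set q | exists2 qh, Wh (@vref R) j qh &
           forall x, quad v x -> q x = qh ('pinv_(fun=> 0) (quad vref) F x)].
Proof.
move=> cv rF; have cr := @convex_vref R.
have [lv [nv fv]] := convex_quad_frame cv; have [lr [nr fr]] := convex_quad_frame cr.
have pE := pinv_reference_map fr fv rF.
apply/seteqP; split => q /=.
  move=> Wq; exists (q \o quad_map vref lr nr v); first exact: (Wh_quad_map cr cv fr fv).
  by move=> x qx; rewrite pE // /comp (quad_mapK fv fr).
move=> [qh Wqh qE]; apply: (Wh_ext cv _ (Wh_quad_map cv cr fv fr Wqh)) => x qx.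
by rewrite qE // pE.
Qed.

End ReferenceMap.

(** * Homogeneous parts on the reference square *)

Section HomogeneousParts.
Context {R : realType}.
Local Notation P := (plane R).
Implicit Types (p h : P -> R).

Lemma hpolyfun0 j : hpolyfun j (fun _ : P => 0 : R).
Proof. by exists (fun=> 0) => x; rewrite big1 // => a _; rewrite !mul0r. Qed.

Lemma hpolyfunD j p h : hpolyfun j p -> hpolyfun j h -> hpolyfun j (fun x => p x + h x).
Proof.
move=> [c cE] [d dE]; exists (fun a => c a + d a) => x.
by rewrite cE dE -big_split; apply: eq_bigr => a _; rewrite /= !mulrDl.
Qed.

Lemma hpolyfunZ j k p : hpolyfun j p -> hpolyfun j (fun x => k * p x).
Proof.
move=> [c cE]; exists (fun a => k * c a) => x.
by rewrite cE big_distrr; apply: eq_bigr => a _; rewrite /= !mulrA.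
Qed.

Lemma hpolyfun_monomial a b : hpolyfun (a + b) (fun x : P => x.1 ^+ a * x.2 ^+ b).
Proof.
have aj : (a < (a + b).+1)%N by rewrite ltnS leq_addr.
exists (fun a' => (a' == a)%:R) => x; rewrite (bigD1 (Ordinal aj)) //= eqxx mul1r addKn.
rewrite big1 ?addr0 // => i ni.
by rewrite -(inj_eq val_inj) /= in ni; rewrite (negbTE ni) !mul0r.
Qed.

Lemma hpolyfun_polyfun j p : hpolyfun j p -> polyfun j p.
Proof.
move=> [c cE]; apply: (@eq_polyfun _ _ (fun x => \sum_(a < j.+1) c a * (x.1 ^+ a * x.2 ^+ (j - a)))).
  by move=> x; rewrite cE; apply: eq_bigr => a _; rewrite mulrA.
rewrite (_ : (fun x => _) = \sum_(a < j.+1) (fun x : P => c a * (x.1 ^+ a * x.2 ^+ (j - a)))); last first.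
  by apply/funext => x; rewrite fct_sumE.
apply: (big_ind (polyfun j)) => [|f g|a _]; [exact: polyfun0|exact: polyfunD|].
by apply: polyfunZ; apply: polyfun_monomial; rewrite subnKC // -ltnS.
Qed.

Lemma hpolyfun_at0 j p : hpolyfun j.+1 p -> p 0 = 0.
Proof.
move=> [c ->]; rewrite big1 // => -[[|a] ?] _ /=; rewrite ?subn0 !expr0n /= ?mulr0 //.
by rewrite ?mulr0 ?mul0r.
Qed.

Lemma polyfun_homogeneous_split j p : polyfun j.+1 p ->
  exists q h, [/\ polyfun j q, hpolyfun j.+1 h & forall x, p x = q x + h x].
Proof.
move: p; apply: polyfun_ind.
- by exists (fun=> 0), (fun=> 0); split=> [||x]; [exact: polyfun0|exact: hpolyfun0|rewrite addr0].
- move=> p p' [q [h [pq hh E]]] [q' [h' [pq' hh' E']]].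
  exists (fun x => q x + q' x), (fun x => h x + h' x); split; [exact: polyfunD|exact: hpolyfunD|].
  by move=> x; rewrite E E' addrACA.
- move=> k p [q [h [pq hh E]]]; exists (fun x => k * q x), (fun x => k * h x).
  by split; [exact: polyfunZ|exact: hpolyfunZ|move=> x; rewrite E mulrDr].
- move=> a b; rewrite leq_eqVlt => /orP[/eqP <-|abj].
    exists (fun=> 0), (fun x => x.1 ^+ a * x.2 ^+ b).
    by split=> [||x]; [exact: polyfun0|exact: hpolyfun_monomial|rewrite add0r].
  exists (fun x => x.1 ^+ a * x.2 ^+ b), (fun=> 0).
  by split=> [||x]; [exact: polyfun_monomial|exact: hpolyfun0|rewrite addr0].
Qed.

Lemma polyfun_const p : polyfun 0 p -> forall x, p x = p 0.
Proof.
move: p; apply: polyfun_ind => [//|p q hp hq x|k p hp x|a b]; first by rewrite hp hq.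
  by rewrite hp.
by rewrite leqn0 addn_eq0 => /andP[/eqP -> /eqP ->].
Qed.

End HomogeneousParts.

(** * Spanning sets on the reference square *)

Section ReferenceSpace.
Context {R : realType}.
Local Notation P := (plane R).
Local Notation Q := (quad (@vref R)).
Local Notation cr := (@convex_vref R).
Implicit Types (v : 'I_4 -> P) (q f : P -> R) (p h : 'I_4 -> P -> R) (S : set (P -> R)) (s : seq R).

Definition glue h : P -> R := fun x => \sum_(m < 4) h m x * \1_(tri (@vref R) m) x.

Lemma glueE h m x : tri vref m x -> glue h x = h m x.
Proof.
move=> mx; rewrite /glue (bigD1 m) //= indicE mem_set // mulr1 big1 ?addr0 // => i im.
rewrite indicE memNset ?mulr0 // => ix; move: mx ix im.
rewrite !(tri_sectorE cr) => -[_ /=] + [_ /=].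
by case: (ord4P m) => ->; case: (ord4P i) => ->; rewrite /sgn_s /sgn_t //= ?mul1r ?mulN1r ?oppr_gt0
  => -[h1 h2] [h3 h4] _; lra.
Qed.

Lemma measurable_glue j h : (forall m, polyfun j (h m)) -> measurable_fun Q (glue h).
Proof.
move=> ph; rewrite /glue; apply: measurable_sum => m; apply: measurable_funM.
  by apply: continuous_measurable; exact: polyfun_continuous (ph m).
by apply: measurable_indic; exact: domain_measurable (domain_tri cr m).
Qed.

Lemma measurable_pwconst s : measurable_fun Q (@pwconst R s).
Proof.
apply: (@measurable_glue 0 (fun m _ => s`_m)) => m.
by exists (fun _ _ => s`_m) => x; rewrite !big_ord_recl !big_ord0 big_mkcond big_ord_recl big_ord0 /= !expr0 !mulr1 !addr0.
Qed.

Lemma pwconstE s (m : 'I_4) x : tri vref m x -> @pwconst R s x = s`_m.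
Proof. exact: (@glueE (fun m _ => s`_m)). Qed.

Lemma Wh_pwconst j s : s`_0 - s`_1 + s`_2 - s`_3 = 0 -> Wh (@vref R) j (pwconst s).
Proof.
move=> s0; apply: (piecewise_Wh cr (p := fun m _ => s`_m)); first exact: measurable_pwconst.
  split => m; last by apply: ae_eq_in_refl => x; exact: pwconstE.
  apply: (polyfun_leq (leq0n j)).
  by exists (fun _ _ => s`_m) => x; rewrite !big_ord_recl !big_ord0 big_mkcond big_ord_recl big_ord0 /= !expr0 !mulr1 !addr0.
exact: s0.
Qed.

Lemma PTh_piecewise j f : PTh j f -> measurable_fun Q f /\ exists2 h,
  forall m, hpolyfun j (h m) & forall m, ae_eq_in (tri vref m) f (h m).
Proof.
move=> [[mf _] fP]; split => //.
have /choice[h hP] m : exists h : P -> R, hpolyfun j h /\ ae_eq_in (tri vref m) f h.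
  by have [h ? ?] := fP m; exists h.
by exists h => m; case: (hP m).
Qed.

Lemma piecewise_PTh j f h : measurable_fun Q f -> (forall m, hpolyfun j (h m)) ->
  (forall m, ae_eq_in (tri vref m) f (h m)) -> PTh j f.
Proof.
move=> mf hh fh; split; last by move=> m; exists (h m).
by apply: (piecewise_L2 cr mf (j := j) (p := h)); split => // m; exact: hpolyfun_polyfun.
Qed.

(** The centre of the square is the origin, where homogeneous polynomials of positive degree vanish,
    so the four values in the condition are all zero. *)
Lemma Wh_PTh i j f : (0 < i <= j)%N -> PTh i f -> Wh (@vref R) j f.
Proof.
move=> /andP[i0 ij] /PTh_piecewise[mf [h hh fh]].
apply: (piecewise_Wh cr mf (p := h)).
  by split => // m; apply: (polyfun_leq ij); exact: hpolyfun_polyfun.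
rewrite /alternating center_vref; case: i i0 {ij} hh => // i _ hh.
by rewrite !(hpolyfun_at0 (hh _)) subr0 addr0 subr0.
Qed.

Lemma WhD v j q q' : convex_quad v -> Wh v j q -> Wh v j q' -> Wh v j (q + q').
Proof.
move=> cv /(Wh_piecewise cv)[mq [p [[pp qp] ap]]] /(Wh_piecewise cv)[mq' [p' [[pp' qp'] ap']]].
apply: (piecewise_Wh cv (p := fun m x => p m x + p' m x)); first exact: measurable_funD.
  split => m; first exact: polyfunD.
  exact: (ae_eq_in_op2 (fun a b => a + b) (qp m) (qp' m)).
by move: ap ap'; rewrite /alternating => ap ap'; rewrite -[RHS]addr0 -{1}ap -ap'; ring.
Qed.

Lemma WhZ v j k q : convex_quad v -> Wh v j q -> Wh v j (k *: q).
Proof.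
move=> cv /(Wh_piecewise cv)[mq [p [[pp qp] ap]]].
apply: (piecewise_Wh cv (p := fun m x => k * p m x)).
- by apply: measurable_funM => //; exact: measurable_cst.
- split => m; first exact: polyfunZ.
  exact: (ae_eq_in_op2 (fun a b => k * b) (qp m) (qp m)).
- by move: ap; rewrite /alternating => ap; rewrite -[RHS](mulr0 k) -ap; ring.
Qed.

Lemma Wh_span v j S : convex_quad v -> Wh v j 0 -> S `<=` Wh v j -> lin_span S `<=` Wh v j.
Proof.
move=> cv W0 SW _ [n [a [g [gS ->]]]]; apply: (big_ind (Wh v j)) => // [f f'|i _].
  exact: WhD.
by apply: WhZ => //; exact: SW.
Qed.

Lemma Wh_generators j S : (forall f, S f -> Wh (@vref R) j f) ->
  lin_span ([set c1; c2; c3] `|` S) `<=` Wh (@vref R) j.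
Proof.
move=> SW; have W0 : Wh (@vref R) j 0.
  have := @Wh_pwconst j [:: 0; 0; 0; 0]; rewrite (_ : pwconst _ = 0); last first.
    apply/funext => x; rewrite /pwconst big1 // => m _.
    by case: (ord4P m) => -> /=; rewrite mul0r.
  by apply => /=; ring.
apply: (Wh_span cr W0) => f [|/SW //]; case=> [[]|] ->; apply: Wh_pwconst => /=; ring.
Qed.

Lemma span_generators S s f : s`_0 - s`_1 + s`_2 - s`_3 = 0 -> S f ->
  lin_span ([set c1; c2; c3] `|` S) (@pwconst R s + f).
Proof.
move=> s0 Sf.
(* The solution of the linear system for the coefficients of [c1], [c2], [c3]. The one of [c3] is
   both [(s]_0 + s[_2) / 2] and [(s]_1 + s[_3) / 2], which agree by the alternating condition. *)
exists 4, (fun i => nth 0 [:: (s`_1 - s`_3) / 2; (s`_2 - s`_0) / 2; (s`_0 + s`_2) / 2; 1] i),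
  (fun i => nth 0 [:: c1; c2; c3; f] i); split.
  by move=> i; case: (ord4P i) => -> /=; [left|left|left|right] => //; [left; left|left; right|right].
apply/funext => x; rewrite sum_ord4 /= scale1r; congr (_ + _).
rewrite /c1 /c2 /c3 /pwconst /=.
have E3 : s`_3 = s`_0 - s`_1 + s`_2 by lra.
transitivity ((s`_1 - s`_3) / 2 * \sum_(m < 4) [:: 0; 1; 0; -1]`_m * \1_(tri (@vref R) m) x
  + (s`_2 - s`_0) / 2 * \sum_(m < 4) [:: -1; 0; 1; 0]`_m * \1_(tri (@vref R) m) x
  + (s`_0 + s`_2) / 2 * \sum_(m < 4) [:: 1; 1; 1; 1]`_m * \1_(tri (@vref R) m) x); last by [].
by rewrite !sum_ord4 /= E3; field.
Qed.

Lemma Wh1_span : Wh (@vref R) 1 = lin_span ([set c1; c2; c3] `|` PTh 1).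
Proof.
apply/seteqP; split; last by apply: Wh_generators => f; exact: Wh_PTh.
move=> q /(Wh_piecewise cr)[mq [p [[pp qp] ap]]].
have /choice[c pc] m := polyfun_homogeneous_split (pp m).
have /choice[h cE] m := pc m.
pose s := [:: c 0 0; c 1 0; c 2 0; c 3 0].
have sE (m : 'I_4) : s`_m = c m 0 by case: (ord4P m) => ->.
have s0 : s`_0 - s`_1 + s`_2 - s`_3 = 0.
  rewrite -ap /alternating center_vref /s /=.
  have pE m : p m 0 = c m 0.
    by case: (cE m) => _ hh ->; rewrite (hpolyfun_at0 hh) addr0.
  by rewrite !pE.
(* The decomposition must hold at every point, so the remainder, constrained only almost everywhere
   on the triangles, absorbs the behaviour of [q] on null sets. *)
have -> : q = pwconst s + (q - pwconst s) by rewrite subrKC.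
apply: (span_generators s0); apply: (piecewise_PTh (h := h)).
- by apply: measurable_funB => //; exact: measurable_pwconst.
- by move=> m; case: (cE m).
- move=> m; have [pc0 _ pE] := cE m.
  apply: (ae_eq_in_trans (ae_eq_in_op2 (fun a b => a - b) (qp m) (ae_eq_in_refl (fun x _ => erefl (pwconst s x))))).
  by apply: ae_eq_in_refl => x mx; rewrite (pwconstE s mx) sE pE (polyfun_const pc0) addrC addKr.
Qed.

Lemma Wh2_span : Wh (@vref R) 2 =
  lin_span ([set c1; c2; c3] `|` [set f + g | f in PTh 1 & g in PTh 2]).
Proof.
apply/seteqP; split; last first.
  by apply: Wh_generators => _ [f Pf [g Pg <-]]; apply: WhD => //; [exact: cr|exact: Wh_PTh Pf|exact: Wh_PTh Pg].
move=> q /(Wh_piecewise cr)[mq [p [[pp qp] ap]]].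
have /choice[l pl] m := polyfun_homogeneous_split (pp m).
have /choice[h2 lE] m := pl m.
have /choice[c pc] m : exists c h : P -> R, [/\ polyfun 0 c, hpolyfun 1 h & forall x, l m x = c x + h x].
  by case: (lE m) => /polyfun_homogeneous_split.
have /choice[h1 cE] m := pc m.
pose s := [:: c 0 0; c 1 0; c 2 0; c 3 0].
have sE (m : 'I_4) : s`_m = c m 0 by case: (ord4P m) => ->.
have hh1 m : hpolyfun 1 (h1 m) by case: (cE m).
have hh2 m : hpolyfun 2 (h2 m) by case: (lE m).
have pE m x : p m x = c m 0 + h1 m x + h2 m x.
  by case: (lE m) => _ _ ->; case: (cE m) => c0 _ ->; rewrite (polyfun_const c0).
have s0 : s`_0 - s`_1 + s`_2 - s`_3 = 0.
  rewrite -ap /alternating center_vref /s /= !pE.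
  by rewrite !(hpolyfun_at0 (hh1 _)) !(hpolyfun_at0 (hh2 _)) !addr0.
have mg : measurable_fun Q (glue h1) by exact: (measurable_glue (fun m => hpolyfun_polyfun (hh1 m))).
have -> : q = pwconst s + (q - pwconst s) by rewrite subrKC.
apply: (span_generators s0); exists (glue h1).
  apply: (piecewise_PTh mg hh1) => m; apply: ae_eq_in_refl => x; exact: glueE.
(* The constant and linear parts are built pointwise from their polynomials; the quadratic remainder
   carries all discrepancies on null sets. *)
exists (q - pwconst s - glue h1); last by rewrite subrKC.
apply: (piecewise_PTh (h := h2)) => //.
- by apply: measurable_funB => //; apply: measurable_funB => //; exact: measurable_pwconst.
- move=> m; have rE (u : P -> R) := ae_eq_in_refl (O := tri vref m) (fun x _ => erefl (u x)).
  apply: (ae_eq_in_trans (ae_eq_in_op2 (fun a b => a - b)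
    (ae_eq_in_op2 (fun a b => a - b) (qp m) (rE (pwconst s))) (rE (glue h1)))).
  by apply: ae_eq_in_refl => x mx; rewrite (pwconstE s mx) (glueE h1 mx) sE pE; ring.
Qed.

End ReferenceSpace.

Theorem mainTheorem6 (R : realType) :
  [/\ Wh (@vref R) 1 = lin_span ([set c1; c2; c3] `|` PTh 1),
      Wh (@vref R) 2 =
        lin_span ([set c1; c2; c3] `|` [set f + g | f in PTh 1 & g in PTh 2])
    & forall k : nat, k = 2%N \/ k = 3%N ->
      forall v : 'I_4 -> plane R, convex_quad v ->
      forall F : plane R -> plane R, reference_map v F ->
        Wh v k.-1 =
        [set q | exists2 qh, Wh (@vref R) k.-1 qh &
           forall x, quad v x -> q x = qh ('pinv_(fun=> 0) (quad vref) F x)]].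
Proof.
split; [exact: Wh1_span|exact: Wh2_span|].
by move=> k _ v cv F rF; exact: Wh_reference_map.
Qed.
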